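(* Let $\Omega\subset\mathbb{R}^n$ be a nonempty open bounded convex set satisfying an interior sphere condition, and let $u$ be the solution to the Dirichlet problem $-\Delta_\infty u=1$ in $\Omega$, $u=0$ on $\partial\Omega$. Then $u$ is continuously differentiable in $\Omega$.
   Context: For smooth $\varphi$, $\Delta_\infty\varphi:=\langle\nabla^2\varphi\,\nabla\varphi,\nabla\varphi\rangle$. A solution to the Dirichlet problem is a function $u\in C(\overline\Omega)$ with $u=0$ on $\partial\Omega$ which is a viscosity solution of $-\Delta_\infty u=1$ in $\Omega$, i.e. for every $x_0\in\Omega$ and $\varphi\in C^2(\Omega)$: if $u-\varphi$ has a local maximum at $x_0$ then $-\Delta_\infty\varphi(x_0)-1\le 0$, and if $u-\varphi$ has a local minimum at $x_0$ then $-\Delta_\infty\varphi(x_0)-1\ge 0$. It is known that the solution exists and is unique. Interior sphere condition: every point of $\partial\Omega$ lies on the boundary of some open ball contained in $\Omega$. *)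

(* Defs.v *)
From HB Require Import structures.
From mathcomp Require Export all_boot all_order all_algebra.
From mathcomp Require Export all_classical all_reals all_analysis.

Set Implicit Arguments.
Unset Strict Implicit.
Unset Printing Implicit Defensive.

Export Order.TTheory GRing.Theory Num.Theory.
Export numFieldNormedType.Exports.

Global Open Scope classical_set_scope.
Global Open Scope ring_scope.

(* The library norm `|x| on 'rV[R]_n is the sup norm; it induces the usual
   topology, bounded sets and differentials, but not the Euclidean balls. *)
Definition inner (R : realType) (n : nat) (x y : 'rV[R]_n) : R :=
  \sum_(i < n) x 0 i * y 0 i.

Definition enorm (R : realType) (n : nat) (x : 'rV[R]_n) : R :=
  Num.sqrt (inner x x).

Definition eball (R : realType) (n : nat) (c : 'rV[R]_n) (r : R) :
  set 'rV[R]_n := [set x | enorm (x - c) < r].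

Definition boundary (T : topologicalType) (A : set T) : set T :=
  closure A `\` interior A.

Definition interior_sphere_condition (R : realType) (n : nat)
    (Omega : set 'rV[R]_n) : Prop :=
  forall x, boundary Omega x ->
    exists (c : 'rV[R]_n) (r : R),
      [/\ 0 < r, eball c r `<=` Omega & boundary (eball c r) x].

Definition partial (R : realType) (n : nat) (i : 'I_n) (f : 'rV[R]_n -> R) :
  'rV[R]_n -> R := fun x => 'D_(delta_mx 0 i) f x.

Definition gradient (R : realType) (n : nat) (f : 'rV[R]_n -> R)
  (x : 'rV[R]_n) : 'rV[R]_n := \row_(i < n) partial i f x.

Definition hessian (R : realType) (n : nat) (f : 'rV[R]_n -> R)
    (x : 'rV[R]_n) : 'M[R]_n :=
  \matrix_(i < n, j < n) partial i (partial j f) x.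

(* The vector "Hessian times gradient" is written as a row vector, whence the
   transpose. *)
Definition infinity_laplacian (R : realType) (n : nat) (f : 'rV[R]_n -> R)
    (x : 'rV[R]_n) : R :=
  inner (gradient f x *m (hessian f x)^T) (gradient f x).

(* C1_on and C2_on are meant for open Omega: functions are total, but only
   their values on Omega matter, and continuity at a point of Omega is then the
   same as continuity relative to Omega. *)
Definition C1_on (R : realType) (n : nat) (Omega : set 'rV[R]_n)
    (f : 'rV[R]_n -> R) : Prop :=
  forall x, Omega x ->
    differentiable f x /\ {for x, continuous (gradient f)}.

Definition C2_on (R : realType) (n : nat) (Omega : set 'rV[R]_n)
    (f : 'rV[R]_n -> R) : Prop :=
  C1_on Omega f /\ forall i : 'I_n, C1_on Omega (partial i f).

Definition local_max_at (T : topologicalType) (R : realType) (f : T -> R)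
  (x0 : T) : Prop := \forall x \near x0, f x <= f x0.

Definition local_min_at (T : topologicalType) (R : realType) (f : T -> R)
  (x0 : T) : Prop := \forall x \near x0, f x0 <= f x.

(* Viscosity solutions of - Delta_oo u = 1 in Omega. *)
Definition viscosity_solution (R : realType) (n : nat)
    (Omega : set 'rV[R]_n) (u : 'rV[R]_n -> R) : Prop :=
  forall (x0 : 'rV[R]_n) (phi : 'rV[R]_n -> R), Omega x0 -> C2_on Omega phi ->
    (local_max_at (fun x => u x - phi x) x0 ->
       - infinity_laplacian phi x0 - 1 <= 0) /\
    (local_min_at (fun x => u x - phi x) x0 ->
       0 <= - infinity_laplacian phi x0 - 1).

Definition dirichlet_solution (R : realType) (n : nat)
    (Omega : set 'rV[R]_n) (u : 'rV[R]_n -> R) : Prop :=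
  [/\ {within closure Omega, continuous u},
      forall x, boundary Omega x -> u x = 0
    & viscosity_solution Omega u].

(* Main.v *)
From HB Require Import structures.
Require Import Defs.
From mathcomp Require Import ring lra.

(* Let [z = u ^ (3 / 4)].  Both the comparison principle for [- Delta_oo u = 1]
   and the concavity of [z] are reduced to one-variable inequalities, which
   avoids the theorem on sums.

   A subsolution satisfies a discrete inequality between the increments of its
   maximum over the balls of radius 0, eps and 2 eps around a point, namely the
   one satisfied by the radial solutions [- c (L - r) ^ (4 / 3)]; a supersolution
   satisfies the reverse one.  As in Armstrong and Smart's proof of Jensen's
   theorem, these two inequalities are incompatible at a maximum of
   [f x - v y] over [|x - y| <= 2 eps] when the equation of [v] is strict.

   For fixed weights let [m x] be the maximum of [w1 z x1 + w2 z x2] over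
   [w1 x1 + w2 x2 = x].  The interior sphere condition gives [z] an infinite
   slope at the boundary, so the optimal [x1, x2] of a point of [Omega] where
   [m] is touched from above are interior.  Comparing [z] near [xi] with radial
   parabolas on balls of radius proportional to [z xi] shows that
   [m ^ (4 / 3)] is a subsolution, whence [m <= z]: [z] is concave.

   If [z] had two supergradients at a point, it would be touched from above
   there by paraboloids arbitrarily concave in the direction of their gradient,
   contradicting the equation.  Hence the supergradient is unique, it is
   continuous, and it is the gradient of [z]. *)

Set Implicit Arguments.
Unset Strict Implicit.
Unset Printing Implicit Defensive.

(** * Euclidean geometry *)

(** The exponent 3/4 comes from scaling: [- Delta_oo u = 1] is invariant under replacing [u(x)] by
    [l ^ (- 4 / 3) * u(l x)], so [z] scales like a length and its equation reads: curvature times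
    [z] is a function of the slope. At the two points [x1], [x2] that realize the envelope the
    slopes agree, so the curvatures allowed there are [rhs / z x1] and [rhs / z x2]; their
    reciprocals are linear in [z], which is what survives averaging. The obstacle is that touching
    the envelope from above gives a single inequality on joint increments at [x1] and [x2], not a
    second derivative at each. Finite steps replace these: [quad_step] and [single_step] turn the
    equation into a lower bound on a second difference of [z], and such bounds add up with weights.
    Comparison needs a strict inequality; as the right-hand side is positive and the operator
    homogeneous of degree three, a factor above one on the supersolution provides it. *)

Section Euclid.
Variables (R : realType) (n : nat).
Implicit Types (x y z h : 'rV[R]_n) (a c r : R).

Lemma innerC x y : inner x y = inner y x.
Proof. by apply: eq_bigr => i _; rewrite mulrC. Qed.

Lemma innerDl x y z : inner (x + y) z = inner x z + inner y z.
Proof. by rewrite -big_split; apply: eq_bigr => i _; rewrite mxE mulrDl. Qed.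

Lemma innerZl a x y : inner (a *: x) y = a * inner x y.
Proof. by rewrite mulr_sumr; apply: eq_bigr => i _; rewrite mxE mulrA. Qed.

Lemma innerDr x y z : inner x (y + z) = inner x y + inner x z.
Proof. by rewrite innerC innerDl !(innerC x). Qed.

Lemma innerZr a x y : inner x (a *: y) = a * inner x y.
Proof. by rewrite innerC innerZl innerC. Qed.

Lemma innerNl x y : inner (- x) y = - inner x y.
Proof. by rewrite -scaleN1r innerZl mulN1r. Qed.

Lemma innerNr x y : inner x (- y) = - inner x y.
Proof. by rewrite innerC innerNl innerC. Qed.

Lemma inner0l y : inner 0 y = 0.
Proof. by rewrite -(scale0r 0) innerZl mul0r. Qed.

Lemma inner0r y : inner y 0 = 0.
Proof. by rewrite innerC inner0l. Qed.

Definition innerE := (innerDl, innerDr, innerNl, innerNr, innerZl, innerZr).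

Lemma inner_delta x i : inner x (delta_mx 0 i) = x 0 i.
Proof.
rewrite /inner (bigD1 i) //= mxE !eqxx mulr1 big1 ?addr0 // => j ji.
by rewrite mxE eqxx (negbTE ji) mulr0.
Qed.

Lemma inner_ge0 x : 0 <= inner x x.
Proof. by apply: sumr_ge0 => i _; rewrite -expr2 sqr_ge0. Qed.

Lemma enorm_ge0 x : 0 <= enorm x.
Proof. exact: sqrtr_ge0. Qed.

Lemma enorm_sqr x : enorm x ^+ 2 = inner x x.
Proof. by rewrite sqr_sqrtr ?inner_ge0. Qed.

Lemma enorm_le x c : 0 <= c -> (enorm x <= c) = (inner x x <= c ^+ 2).
Proof. by move=> c0; rewrite -enorm_sqr ler_pXn2r // nnegrE enorm_ge0. Qed.

Lemma coord_le_enorm x i : `|x 0 i| <= enorm x.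
Proof.
rewrite -(@ler_pXn2r _ 2) ?nnegrE ?enorm_ge0 // enorm_sqr real_normK ?num_real //.
rewrite /inner (bigD1 i) //= -expr2 lerDl.
by apply: sumr_ge0 => j _; rewrite -expr2 sqr_ge0.
Qed.

Lemma enorm_eq0 x : enorm x = 0 -> x = 0.
Proof.
move=> x0; apply/rowP => i; rewrite mxE; apply/eqP.
by rewrite -normr_le0 -x0 coord_le_enorm.
Qed.

Lemma enorm0 : enorm (0 : 'rV[R]_n) = 0.
Proof. by rewrite /enorm inner0l sqrtr0. Qed.

Lemma enorm_gt0 x : x != 0 -> 0 < enorm x.
Proof.
move=> x0; rewrite lt_def enorm_ge0 andbT.
by apply: contra_neq x0; exact: enorm_eq0.
Qed.

Lemma enormZ a x : enorm (a *: x) = `|a| * enorm x.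
Proof.
by rewrite /enorm innerZl innerZr mulrA -expr2 sqrtrM ?sqr_ge0 // sqrtr_sqr.
Qed.

Lemma enormN x : enorm (- x) = enorm x.
Proof. by rewrite -scaleN1r enormZ normrN1 mul1r. Qed.

Lemma enormB x y : enorm (x - y) = enorm (y - x).
Proof. by rewrite -enormN opprB. Qed.

Lemma cauchy_schwarz x y : inner x y <= enorm x * enorm y.
Proof.
have [->|x0] := eqVneq x 0; first by rewrite inner0l enorm0 mul0r.
have [->|y0] := eqVneq y 0; first by rewrite inner0r enorm0 mulr0.
have := inner_ge0 (enorm y *: x - enorm x *: y).
rewrite !innerE (innerC y x) -!enorm_sqr => H.
have xy0 : 0 < enorm x * enorm y by rewrite mulr_gt0 ?enorm_gt0.
by rewrite -(ler_pM2l xy0); nra.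
Qed.

Lemma cauchy_schwarz_norm x y : `|inner x y| <= enorm x * enorm y.
Proof.
by rewrite ler_norml cauchy_schwarz lerNl -innerNl -(enormN x) cauchy_schwarz.
Qed.

Lemma enormD x y : enorm (x + y) <= enorm x + enorm y.
Proof.
rewrite enorm_le ?addr_ge0 ?enorm_ge0 // !innerE (innerC y x) -!enorm_sqr.
have := cauchy_schwarz x y; nra.
Qed.

Lemma enormD_ge x y : enorm x - enorm y <= enorm (x + y).
Proof. by rewrite lerBlDr -{1}(addrK y x) -(enormN y) enormD. Qed.

Lemma norm_le_enorm x : `|x| <= enorm x.
Proof.
rewrite /Num.Def.normr /= mx_normrE; apply/bigmax_leP; split=> [|[i j] _ /=]; first
  exact: enorm_ge0.
by rewrite (ord1 i) coord_le_enorm.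
Qed.

Lemma enorm_le_norm x : enorm x <= (n%:R + 1) * `|x|.
Proof.
rewrite enorm_le ?mulr_ge0 ?addr_ge0 //.
have B (i : 'I_n) : x 0 i * x 0 i <= `|x| ^+ 2.
  rewrite -expr2 -real_normK ?num_real // ler_pXn2r ?nnegrE //.
  rewrite /Num.Def.normr /= mx_normrE; apply/bigmax_geP; right.
  by exists (ord0, i).
apply: (le_trans (ler_sum _ (fun i _ => B i))).
rewrite sumr_const card_ord -mulr_natl.
have := sqr_ge0 `|x|; have := ler0n R n; nra.
Qed.

Lemma nbhs_enormP x (A : set 'rV[R]_n) :
  nbhs x A <-> exists2 r, 0 < r & forall h, enorm h < r -> A (x + h).
Proof.
split.
  move=> /nbhs_ballP[r /= r0 rA]; exists r => // h hr; apply: rA.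
  rewrite -ball_normE /=; rewrite opprD addrA subrr add0r normrN.
  exact: le_lt_trans (norm_le_enorm h) hr.
move=> [r r0 rA]; apply/nbhs_ballP; exists (r / (n%:R + 1)) => /=.
  by rewrite divr_gt0 // ltr_wpDl.
move=> y; rewrite -ball_normE /= => xy; rewrite -(subrK x y) addrC; apply: rA.
apply: (le_lt_trans (enorm_le_norm _)).
by rewrite mulrC -ltr_pdivlMr ?ltr_wpDl // distrC.
Qed.

Lemma continuous_enormP (f : 'rV[R]_n -> R) x :
  {for x, continuous f} <-> forall e, 0 < e ->
    exists2 r, 0 < r & forall h, enorm h < r -> `|f (x + h) - f x| < e.
Proof.
split=> [fx e e0|fx A /nbhs_ballP[e /= e0 eA]].
  apply/(nbhs_enormP x [set y | `|f y - f x| < e]).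
  apply: (fx [set t | `|t - f x| < e]).
  by apply/nbhs_ballP; exists e => // t; rewrite -ball_normE /= distrC.
apply/nbhs_enormP; have [r r0 rP] := fx e e0; exists r => // h hr.
by apply: eA; rewrite -ball_normE /= distrC rP.
Qed.

Lemma dist_continuous y : continuous (fun x => enorm (x - y)).
Proof.
move=> x; apply/continuous_enormP => e e0; exists e => // h he.
rewrite addrAC ltr_norml; have := enormD (x - y) h; have := enormD_ge (x - y) h.
by move: he; move: (enorm (_ + h)) => ? *; apply/andP; split; lra.
Qed.

Lemma inner_continuous y : continuous (inner y).
Proof.
move=> x; apply/continuous_enormP => e e0.
exists (e / (enorm y + 1)); first by rewrite divr_gt0 // ltr_wpDl ?enorm_ge0.
move=> h; rewrite ltr_pdivlMr ?ltr_wpDl ?enorm_ge0 // => he.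
rewrite innerDr addrAC subrr add0r.
apply: le_lt_trans (cauchy_schwarz_norm _ _) _.
by have := enorm_ge0 h; have := enorm_ge0 y; nra.
Qed.

Lemma eball_bounded y r : bounded_set [set x | enorm (x - y) <= r].
Proof.
exists (enorm y + r); split; first exact: num_real.
move=> M ltM x /= xy; apply: le_trans (norm_le_enorm x) _.
rewrite -(subrK y x); apply: (le_trans (enormD _ _)).
by apply: ltW; apply: le_lt_trans ltM; rewrite addrC lerD2l.
Qed.

Lemma closed_eball y r : closed [set x : 'rV[R]_n | enorm (x - y) <= r].
Proof.
apply: (preimage_closed (f := fun x => enorm (x - y)) (D := [set t | t <= r])).
  by move=> x _; exact: dist_continuous.
exact: closed_le.
Qed.

Lemma compact_eball y r : compact [set x : 'rV[R]_n | enorm (x - y) <= r].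
Proof. exact: bounded_closed_compact (@eball_bounded y r) (@closed_eball y r). Qed.

End Euclid.

(** * Derivatives and second order expansions *)

Section Derive.
Variables (R : realType) (V : normedModType R).

Lemma is_derive_epsP (f : V -> R) (x v : V) (c : R) :
  is_derive x v f c <-> forall e : R, 0 < e -> exists2 d : R, 0 < d &
    forall h : R, `|h| < d -> `|f (h *: v + x) - f x - h * c| <= e * `|h|.
Proof.
split=> [[dx Dc] e e0|H].
  have := derivable_nbhs dx; rewrite Dc => /eqaddoP /(_ e e0) /nbhs_ballP[d /= d0 dP].
  exists d => // h hd.
  have := dP h; rewrite -ball_normE /= sub0r normrN => /(_ hd).
  by rewrite /= !fctE /= opprD addrA.
have C : h^-1 *: ((f \o shift x) (h *: v) - f x) @[h --> 0^'] --> c.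
  apply/cvgrPdist_le => e e0; have [d d0 dP] := H e e0.
  apply/nbhs_ballP; exists d => // h /=; rewrite -ball_normE /= sub0r normrN => hd h0.
  have -> : c - h^-1 *: ((f \o shift x) (h *: v) - f x)
      = - (h^-1 * (f (h *: v + x) - f x - h * c)).
    by rewrite -[_ *: _]/(h^-1 * _) /=; field.
  by rewrite normrN normrM normfV ler_pdivrMl ?normr_gt0 // [leRHS]mulrC; exact: dP.
split; first by apply/cvg_ex; exists c.
exact: cvg_lim C.
Qed.

Lemma is_derive_line (f : V -> R) (x v : V) (c d : R) :
  (forall h, f (h *: v + x) = f x + h * c + h ^+ 2 * d) -> is_derive x v f c.
Proof.
move=> fE; apply/is_derive_epsP => e e0.
exists (e / (`|d| + 1)); first by rewrite divr_gt0 // ltr_wpDl.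
move=> h; rewrite ltr_pdivlMr ?ltr_wpDl // => hd.
rewrite fE (_ : _ - _ = h * (h * d)); last by ring.
rewrite 2!normrM mulrC ler_wpM2r //.
by have := normr_ge0 h; have := normr_ge0 d; nra.
Qed.

End Derive.

(** Subtract from [F] the parabola with second derivative [f2 + eta]: near [x] the derivative of the
    difference has the sign opposite to [t - x], so the mean value theorem suffices and [G] has to
    be differentiable at [x] only. *)
Lemma taylor2_le (R : realType) (F G : R -> R) (x f2 d eta : R) :
  0 < d -> (forall t, `|t - x| < d -> is_derive t 1 F (G t)) ->
  is_derive x 1 G f2 -> 0 < eta ->
  exists2 r, 0 < r & forall t, `|t - x| < r ->
    F t <= F x + G x * (t - x) + (f2 + eta) / 2 * (t - x) ^+ 2.
Proof.
move=> d0 dF dG eta0.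
have [r [r0 rd rP]] : exists r, [/\ 0 < r, r <= d & forall t, `|t - x| < r ->
    `|G t - G x - f2 * (t - x)| <= eta * `|t - x|].
  have /is_derive_epsP/(_ eta eta0)[r r0 rP] := dG.
  exists (Num.min r d); split; rewrite ?lt_min ?r0 ?ge_min ?lexx ?orbT // => t.
  by rewrite lt_min => /andP[/rP + _]; rewrite scaler1 subrK [_ * f2]mulrC.
exists r => // t tr.
pose P s := - F x - G x * (s - x) - (f2 + eta) / 2 * (s - x) ^+ 2.
have dP s : is_derive (s : R) 1 P (- G x - (f2 + eta) * (s - x)).
  apply: (@is_derive_line R _ _ _ _ _ (- (f2 + eta) / 2)) => h.
  by rewrite scaler1 /P; field.
pose H s := F s + P s.
have dH s : `|s - x| < d -> is_derive s 1 H (G s + (- G x - (f2 + eta) * (s - x))).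
  by move=> sd; have := dF s sd => ?; apply: is_deriveD.
suff : H t <= 0 by rewrite /H /P; lra.
have Hx : H x = 0 by rewrite /H /P; lra.
have cH a b : (forall s, s \in `[a, b] -> `|s - x| < d) -> {within `[a, b],
  continuous H}.
  by move=> ab; apply: derivable_within_continuous => s /ab /dH [].
have [tx|xt|->] := ltgtP t x; last by rewrite Hx.
- have sub s : s \in `[t, x] -> `|s - x| < r.
    by rewrite in_itv /= => /andP[? ?]; move: tr; rewrite !ltr_norml => /andP[? ?];
      apply/andP; split; lra.
  have subd s (sI : s \in `[t, x]) : `|s - x| < d := lt_le_trans (sub s sI) rd.
  have [c /subset_itv_oo_cc/[dup]/sub/rP] := MVT tx (fun s h => dH s (subd s
    (subset_itv_oo_cc h))) (cH _ _ subd).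
  rewrite in_itv /= ler_norml => /andP[B1 B2] /andP[tc cx] E.
  move: B1 B2; rewrite ler0_norm ?subr_le0 // => B1 B2.
  have : 0 <= G c - G x - (f2 + eta) * (c - x) by lra.
  by move: E; rewrite Hx; nra.
- have sub s : s \in `[x, t] -> `|s - x| < r.
    by rewrite in_itv /= => /andP[? ?]; move: tr; rewrite !ltr_norml => /andP[? ?];
      apply/andP; split; lra.
  have subd s (sI : s \in `[x, t]) : `|s - x| < d := lt_le_trans (sub s sI) rd.
  have [c /subset_itv_oo_cc/[dup]/sub/rP] := MVT xt (fun s h => dH s (subd s
    (subset_itv_oo_cc h))) (cH _ _ subd).
  rewrite in_itv /= ler_norml => /andP[B1 B2] /andP[tc cx] E.
  move: B1 B2; rewrite ger0_norm ?subr_ge0 // => B1 B2.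
  have : G c - G x - (f2 + eta) * (c - x) <= 0 by lra.
  by move: E; rewrite Hx; nra.
Qed.

(** * Touching from above by paraboloids *)

(* Paraboloids of this form suffice as test functions, since the infinity
   Laplacian only sees the Hessian in the direction of the gradient [q *: e]. *)
Definition touched (R : realType) (n : nat) (f : 'rV[R]_n -> R) (x e : 'rV[R]_n)
    (q k K : R) : Prop :=
  exists2 r : R, 0 < r & forall h, enorm h < r ->
    f (x + h) <= f x + q * inner e h - k / 2 * inner e h ^+ 2
                 + K * (inner h h - inner e h ^+ 2).

Section Touch.
Variables (R : realType) (n : nat).
Implicit Types (x y e h : 'rV[R]_n).

Lemma inner_unit_le e h : enorm e = 1 -> inner e h ^+ 2 <= inner h h.
Proof.
move=> e1; rewrite -enorm_sqr -real_normK ?num_real // ler_pXn2r ?nnegrE ?enorm_ge0 //.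
by apply: le_trans (cauchy_schwarz_norm _ _) _; rewrite e1 mul1r.
Qed.

Lemma inner_sqrD x y :
  inner (x + y) (x + y) = inner x x + 2 * inner x y + inner y y.
Proof. by rewrite !innerE (innerC y x); ring. Qed.

(** Second order chain rule, with [eta] absorbing the remainders. As [g] may be discontinuous,
    [g (x + h)] can lie far below [g x]; this is why monotonicity of [F] is required between
    [g (x + h)] and a value [t] near [g x]. *)
Lemma touched_comp (g : 'rV[R]_n -> R) (F : R -> R) x e q k K f1 f2 eta :
  enorm e = 1 -> 0 <= f1 -> 0 < eta ->
  (forall eps, 0 < eps -> exists2 d, 0 < d & forall t, `|t - g x| < d ->
     F t <= F (g x) + f1 * (t - g x) + (f2 + eps) / 2 * (t - g x) ^+ 2) ->
  (exists2 d, 0 < d & forall h t, enorm h < d -> `|t - g x| < d ->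
     g (x + h) <= t -> F (g (x + h)) <= F t) ->
  touched g x e q k K ->
  touched (F \o g) x e (f1 * q) (f1 * k - f2 * q ^+ 2 - eta) (f1 * K + eta).
Proof.
move=> e1 f1_ge0 eta0 taylorF [d d0 monoF] [r r0 gle].
pose C := `|q| + `|k| + `|K| + 1.
have C1 : 1 <= C by rewrite lerDr !addr_ge0.
have C0 : 0 < C by lra.
have eta'0 : 0 < eta / (2 * C ^+ 2) by rewrite divr_gt0 // mulr_gt0 // exprn_gt0.
have [d' d'0 tF] := taylorF _ eta'0.
(* Makes the cubic cross term [f2 * (Q ^+ 2 - (q * l) ^+ 2)] at most [eta / 2] times the square of
   [enorm h]. *)
pose a0 := eta / (4 * (`|f2| + 1) * C ^+ 2).
have a00 : 0 < a0 by rewrite divr_gt0 // !mulr_gt0 ?exprn_gt0 // ltr_wpDl.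
exists (Num.min (Num.min r d) (Num.min (d' / C) (Num.min (d / C) (Num.min 1 a0)))).
  by rewrite !lt_min r0 d0 a00 !divr_gt0 ?ltr01.
move=> h; rewrite !lt_min => /andP[/andP[hr hd] /and4P[hd' hd2 h1 ha]].
set l := inner e h; set Nn := inner h h; have lN : l ^+ 2 <= Nn by exact: inner_unit_le.
set a := enorm h in hr hd hd' hd2 h1 ha.
have aN : a ^+ 2 = Nn by exact: enorm_sqr.
have a_ge0 : 0 <= a by exact: enorm_ge0.
have la : `|l| <= a by rewrite /l /a -[enorm h]mul1r -e1 cauchy_schwarz_norm.
pose T := - k / 2 * l ^+ 2 + K * (Nn - l ^+ 2).
have Tle : `|T| <= (`|k| + `|K|) * Nn.
  have [l0 n0] : 0 <= l ^+ 2 /\ 0 <= Nn - l ^+ 2 by rewrite sqr_ge0 subr_ge0.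
  have [k1 k2] : - `|k| <= k /\ k <= `|k| by apply/andP; rewrite -ler_norml.
  have [K1 K2] : - `|K| <= K /\ K <= `|K| by apply/andP; rewrite -ler_norml.
  have := normr_ge0 k; have := normr_ge0 K; move: l0 n0.
  by rewrite ler_norml /T; move: (l ^+ 2) => L *; apply/andP; split; nra.
have C_ge : `|k| + `|K| <= C - `|q| by rewrite /C; lra.
have TC : `|T| <= C * a ^+ 2.
  apply: le_trans Tle _; rewrite aN ler_wpM2r -?aN ?sqr_ge0 //.
  by have := normr_ge0 q; lra.
have qla : `|q * l| <= `|q| * a by rewrite normrM ler_wpM2l.
pose Q := q * l + T.
have TCa : `|T| <= (C - `|q|) * a.
  apply: le_trans Tle _; rewrite -aN; apply: ler_pM => //.
    by rewrite sqr_ge0.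
  by rewrite expr2 ler_piMl // ltW.
have QC : `|Q| <= C * a by rewrite (le_trans (ler_normD _ _)) //; lra.
have Qd : `|Q| < d by apply: le_lt_trans QC _; rewrite mulrC -ltr_pdivlMr.
have Qd' : `|Q| < d' by apply: le_lt_trans QC _; rewrite mulrC -ltr_pdivlMr.
have gQ : g (x + h) <= g x + Q.
  by apply: le_trans (gle h hr) _; rewrite /Q /T -/l -/Nn; lra.
have E : g x + Q - g x = Q by rewrite addrAC subrr add0r.
apply: le_trans (monoF h (g x + Q) hd _ gQ) _; first by rewrite E.
apply: le_trans (tF (g x + Q) _) _; first by rewrite E.
rewrite E /=.
have Q2 : Q ^+ 2 <= C ^+ 2 * Nn.
  by rewrite -aN -exprMn -real_normK ?num_real // ler_pXn2r // nnegrE mulr_ge0 // ltW.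
have D2 : f2 * (Q ^+ 2 - (q * l) ^+ 2) <= eta / 2 * Nn.
  apply: le_trans (ler_norm _) _; rewrite normrM.
  have -> : Q ^+ 2 - (q * l) ^+ 2 = T * (Q + q * l) by rewrite /Q; ring.
  rewrite normrM.
  have B1 : `|Q + q * l| <= 2 * C * a.
    rewrite (le_trans (ler_normD _ _)) //.
    have : `|q| * a <= C * a by rewrite ler_wpM2r // /C; have := normr_ge0 k; have :=
      normr_ge0 K; lra.
    lra.
  have B2 : `|T| * `|Q + q * l| <= C * a ^+ 2 * (2 * C * a).
    by apply: ler_pM.
  apply: le_trans (ler_wpM2l (normr_ge0 f2) B2) _.
  have B3 : a * (4 * (`|f2| + 1) * C ^+ 2) <= eta.
    by rewrite -ler_pdivlMr ?mulr_gt0 ?exprn_gt0 ?ltr_wpDl // ltW.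
  have -> : `|f2| * (C * a ^+ 2 * (2 * C * a)) = Nn / 2 * (a * (4 * `|f2| * C ^+ 2))
    by rewrite -aN; field.
  rewrite [leRHS](_ : _ = Nn / 2 * eta); last by field.
  apply: ler_wpM2l; first by rewrite -aN divr_ge0 ?sqr_ge0.
  apply: le_trans B3; apply: ler_wpM2l => //; apply: ler_wpM2r; first exact: sqr_ge0.
  lra.
have D1 : eta / (2 * C ^+ 2) * Q ^+ 2 <= eta / 2 * Nn.
  apply: (le_trans (ler_wpM2l _ Q2)); first by rewrite divr_ge0 ?mulr_ge0 ?sqr_ge0 //
    ltW.
  by rewrite le_eqVlt; apply/orP; left; apply/eqP; field; rewrite gt_eqF.
have n2 : 0 <= eta * (Nn - l ^+ 2) by rewrite mulr_ge0 ?subr_ge0 // ltW.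
by move: D1 D2 n2; rewrite /Q /T; set A := eta / (2 * C ^+ 2); lra.
Qed.

(** The exact transverse coefficient is half of the one stated; doubling it leaves room for the
    higher order terms, and the inequality follows by squaring both sides. *)
Lemma touched_dist x y : x != y ->
  touched (fun z => enorm (z - y)) x ((enorm (x - y))^-1 *: (x - y)) 1 0
    (enorm (x - y))^-1.
Proof.
rewrite -subr_eq0 => /enorm_gt0; set r := enorm _ => r0.
exists (r / 2); first by rewrite divr_gt0.
move=> h hr; rewrite addrAC -/r mul0r mul0r subr0 mul1r innerZl.
set l := r^-1 * _; have lh : `|l| <= enorm h.
  rewrite /l normrM gtr0_norm ?invr_gt0 // ler_pdivrMl //.
  exact: cauchy_schwarz_norm.
have n2 : 0 <= inner h h - l ^+ 2.
  by rewrite subr_ge0 -enorm_sqr -real_normK ?num_real // ler_pXn2r // nnegrE enorm_ge0.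
have s0 : r / 2 < r + l by move: lh; rewrite ler_norml => /andP[? ?]; lra.
rewrite enorm_le; last first.
  by rewrite addr_ge0 ?mulr_ge0 ?invr_ge0 ?(ltW r0) //; apply: ltW; lra.
rewrite inner_sqrD -enorm_sqr -/r.
have -> : inner (x - y) h = r * l by rewrite /l mulrA divff ?mul1r // gt_eqF.
have i1 : 1 <= 2 * (r^-1 * (r + l)).
  by rewrite mulrCA ler_pdivlMl // mulr1; lra.
rewrite [leRHS](_ : _ = (r + l) ^+ 2 + 2 * (r^-1 * (r + l)) * (inner h h - l ^+ 2)
                        + (r^-1 * (inner h h - l ^+ 2)) ^+ 2); last by ring.
have := sqr_ge0 (r^-1 * (inner h h - l ^+ 2)).
have := ler_wpM2r n2 i1.
by move=> *; lra.
Qed.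

Lemma unit_dir x : x != 0 -> enorm ((enorm x)^-1 *: x) = 1.
Proof.
by move=> /enorm_gt0 x0; rewrite enormZ gtr0_norm ?invr_gt0 // mulVf // gt_eqF.
Qed.

End Touch.

(** * Quadratic test functions *)

Section Diff.
Variables (R : realType) (n : nat).
Implicit Types (x y e h p : 'rV[R]_n).

Lemma inner_is_linear p : linear (inner p : 'rV[R]_n -> R).
Proof. by move=> a u v; rewrite innerDr innerZr. Qed.

Lemma differentiable_gradient (f : 'rV[R]_n -> R) x p :
  (forall eps : R, 0 < eps -> exists2 r, 0 < r & forall h, enorm h < r ->
     `|f (x + h) - f x - inner p h| <= eps * enorm h) ->
  differentiable f x /\ gradient f x = p.
Proof.
move=> fP.
pose lM := GRing.isLinear.Build _ _ _ _ _ (@inner_is_linear p).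
pose L : {linear 'rV[R]_n -> R} := HB.pack (inner p : 'rV[R]_n -> R) lM.
have cL : continuous L by exact: inner_continuous.
have expand (eps : R) : 0 < eps -> \forall h \near (0 : 'rV[R]_n),
    `|f (h + x) - (f x + inner p h)| <= eps * `|h|.
  move=> eps0; have n1 : 0 < n%:R + 1 :> R by rewrite ltr_wpDl.
  have [r r0 rP] := fP (eps / (n%:R + 1)) (divr_gt0 eps0 n1).
  apply/nbhs_enormP; exists r => // h hr.
  rewrite add0r (addrC h) opprD addrA.
  apply: le_trans (rP h hr) _; rewrite mulrAC -mulrA ler_wpM2l ?(ltW eps0) //.
  by rewrite ler_pdivrMr // mulrC enorm_le_norm.
have dL : 'd f x = L :> ('rV[R]_n -> R).
  by apply: diff_unique => //; apply/eqaddoP; exact: expand.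
have df : differentiable f x.
  by apply/diff_locallyP; rewrite dL; split=> //; apply/eqaddoP; exact: expand.
split => //; apply/rowP => i; rewrite mxE /partial deriveE // dL.
by rewrite -[LHS]/(inner p _) inner_delta.
Qed.

Lemma gradient_quadratic (f : 'rV[R]_n -> R) x p (C : R) :
  (forall h, `|f (x + h) - f x - inner p h| <= C * enorm h ^+ 2) ->
  differentiable f x /\ gradient f x = p.
Proof.
move=> fC; apply: differentiable_gradient => eps eps0.
exists (eps / (`|C| + 1)); first by rewrite divr_gt0 // ltr_wpDl.
move=> h; rewrite ltr_pdivlMr ?ltr_wpDl // => hr.
apply: le_trans (fC h) _; rewrite expr2 mulrA ler_wpM2r ?enorm_ge0 //.
have := enorm_ge0 h; have := ler_norm C; nra.
Qed.

Lemma continuous_rV_enormP (f : 'rV[R]_n -> 'rV[R]_n) x :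
  (forall eps : R, 0 < eps -> exists2 r, 0 < r &
     forall h, enorm h < r -> enorm (f (x + h) - f x) < eps) ->
  {for x, continuous f}.
Proof.
move=> fP A /nbhs_enormP[eps eps0 epsA]; have [r r0 rP] := fP eps eps0.
apply/nbhs_enormP; exists r => // h hr /=.
by rewrite -(subrK (f x) (f (x + h))) addrC; apply/epsA/rP.
Qed.

End Diff.

Section Quad.
Variables (R : realType) (n : nat).
Implicit Types (x y e h p : 'rV[R]_n).

Definition quad x e (q k K : R) y : R :=
  q * inner e (y - x) - k / 2 * inner e (y - x) ^+ 2
  + K * (inner (y - x) (y - x) - inner e (y - x) ^+ 2).

Definition quad_gradient x e (q k K : R) y : 'rV[R]_n :=
  (q - (k + 2 * K) * inner e (y - x)) *: e + (2 * K) *: (y - x).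

Lemma quadP x e q k K y : enorm e = 1 ->
  differentiable (quad x e q k K) y /\
  gradient (quad x e q k K) y = quad_gradient x e q k K y.
Proof.
move=> e1; apply: (@gradient_quadratic _ _ _ _ _ (`|k| + 2 * `|K|)) => h.
rewrite /quad /quad_gradient (addrAC y h); move: (y - x) => d.
rewrite [inner (_ *: e + _) h]innerDl !innerZl (innerDr e) inner_sqrD.
set l := inner e d; set l' := inner e h; set N := inner d h.
have lN : l' ^+ 2 <= inner h h by exact: inner_unit_le.
rewrite enorm_sqr [X in `|X|](_ : _ =
  - k / 2 * l' ^+ 2 + K * (inner h h - l' ^+ 2)); last by field.
have [k1 k2] : - `|k| <= k /\ k <= `|k| by apply/andP; rewrite -ler_norml.
have [K1 K2] : - `|K| <= K /\ K <= `|K| by apply/andP; rewrite -ler_norml.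
have := normr_ge0 k; have := normr_ge0 K; have := sqr_ge0 l'.
move: lN; rewrite ler_norml; move: (l' ^+ 2) (inner h h) => L M *.
by apply/andP; split; nra.
Qed.

Lemma partial_quad x e q k K i : enorm e = 1 ->
  partial i (quad x e q k K) = (fun y => quad_gradient x e q k K y 0 i).
Proof.
move=> e1; apply/funext => y; have [_ <-] := quadP x q k K y e1.
by rewrite mxE.
Qed.

Lemma partial2_quad x e q k K i y : enorm e = 1 ->
  differentiable (partial i (quad x e q k K)) y /\
  gradient (partial i (quad x e q k K)) y
    = (- (k + 2 * K) * e 0 i) *: e + (2 * K) *: delta_mx 0 i.
Proof.
move=> e1; rewrite partial_quad //.
apply: (@gradient_quadratic _ _ _ _ _ 0) => h.
rewrite mul0r innerDl !innerZl (innerC (delta_mx _ _)) inner_delta.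
rewrite /quad_gradient (addrAC y h) !mxE (innerDr e (y - x) h).
by rewrite [X in `|X|](_ : _ = 0) ?normr0 //; ring.
Qed.

Lemma C2_quad Omega x e q k K : enorm e = 1 -> C2_on Omega (quad x e q k K).
Proof.
move=> e1; split=> [y _|i y _].
  split; first by have [] := quadP x q k K y e1.
  have -> : gradient (quad x e q k K) = quad_gradient x e q k K.
    by apply/funext => z; have [] := quadP x q k K z e1.
  apply: continuous_rV_enormP => eps eps0.
  exists (eps / (`|k + 2 * K| + 2 * `|K| + 1)).
    by rewrite divr_gt0 // ltr_wpDl // addr_ge0 ?mulr_ge0.
  move=> h; rewrite ltr_pdivlMr ?ltr_wpDl ?addr_ge0 ?mulr_ge0 // => hr.
  rewrite /quad_gradient (addrAC y h); move: (y - x) => d.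
  have -> : (q - (k + 2 * K) * inner e (d + h)) *: e + (2 * K) *: (d + h) -
      ((q - (k + 2 * K) * inner e d) *: e + (2 * K) *: d)
      = (- (k + 2 * K) * inner e h) *: e + (2 * K) *: h.
    by apply/rowP => i; rewrite innerDr !mxE; ring.
  apply: le_lt_trans (enormD _ _) _; rewrite !enormZ e1 mulr1 !normrM normrN.
  rewrite (ger0_norm (x := 2)) //.
  have := cauchy_schwarz_norm e h; rewrite e1 mul1r => eh.
  have := ler_wpM2l (normr_ge0 (k + 2 * K)) eh; have := enorm_ge0 h.
  by move: hr; lra.
split; first by have [] := partial2_quad x q k K i y e1.
have -> : gradient (partial i (quad x e q k K)) =
    cst ((- (k + 2 * K) * e 0 i) *: e + (2 * K) *: delta_mx 0 i).
  by apply/funext => z; have [] := partial2_quad x q k K i z e1.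
by apply: continuous_rV_enormP => eps eps0; exists 1 => // h _; rewrite subrr enorm0.
Qed.

(** At [x] the gradient is [q *: e], and [e] is an eigenvector, of eigenvalue [- k], of the Hessian
    [2 K I - (k + 2 K) e e^T]; hence [K] drops out. *)
Lemma infinity_laplacian_quad x e q k K : enorm e = 1 ->
  infinity_laplacian (quad x e q k K) x = - (q ^+ 2 * k).
Proof.
move=> e1; have ee : inner e e = 1 by rewrite -enorm_sqr e1 expr1n.
have g0 : gradient (quad x e q k K) x = q *: e.
  have [_ ->] := quadP x q k K x e1.
  by rewrite /quad_gradient subrr inner0r mulr0 subr0 scaler0 addr0.
rewrite /infinity_laplacian g0.
suff -> : q *: e *m (hessian (quad x e q k K) x)^T = (- (q * k)) *: e.
  by rewrite innerZl innerZr ee; ring.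
apply/rowP => j; rewrite !mxE.
under eq_bigr => i _.
  have -> : (hessian (quad x e q k K) x)^T i j
      = ((- (k + 2 * K) * e 0 j) *: e + (2 * K) *: delta_mx 0 j) 0 i.
    rewrite [LHS]mxE [LHS]mxE.
    have [_ /rowP/(_ j)] := partial2_quad x q k K i x e1.
    rewrite mxE => ->; rewrite !mxE !eqxx /= (eq_sym j i); ring.
  over.
rewrite -[LHS]/(inner (q *: e) _) innerDr !innerZr innerZl ee innerZl inner_delta.
by ring.
Qed.

End Quad.

(** * Radial comparison functions *)

Section Subsolution.
Variables (R : realType) (n : nat).
Implicit Types (x y e h p : 'rV[R]_n).

(** The product [q ^+ 2 * k] is [- Delta_oo] of the touching paraboloid. The operator being odd,
    supersolutions for [kappa] are handled as functions whose opposite is a subsolution for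
    [- kappa]. *)
Definition subsolution (Omega : set 'rV[R]_n) (f : 'rV[R]_n -> R) (kappa : R) :=
  forall x e q k K, Omega x -> enorm e = 1 -> touched f x e q k K ->
    q ^+ 2 * k <= kappa.

Lemma viscosity_subsolution Omega u :
  viscosity_solution Omega u -> subsolution Omega u 1.
Proof.
move=> visc x e q k K Ox e1 [r r0 rP].
have [+ _] := visc x (quad x e q k K) Ox (C2_quad _ _ _ _ _ e1).
rewrite infinity_laplacian_quad // opprK subr_le0; apply.
apply/nbhs_enormP; exists r => // h /rP; rewrite /quad (addrAC x h) subrr add0r.
by rewrite inner0l inner0r; lra.
Qed.

Lemma viscosity_supersolution Omega u :
  viscosity_solution Omega u -> subsolution Omega (fun x => - u x) (- 1).
Proof.
move=> visc x e q k K Ox e1 [r r0 rP].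
have [_] := visc x (quad x e (- q) (- k) (- K)) Ox (C2_quad _ _ _ _ _ e1).
rewrite infinity_laplacian_quad // opprK sqrrN mulrN.
move=> H; suff /H : local_min_at (fun y => u y - quad x e (- q) (- k) (- K) y) x by lra.
apply/nbhs_enormP; exists r => // h /rP; rewrite /quad (addrAC x h) subrr add0r.
by rewrite inner0l inner0r; lra.
Qed.

(** Chain rule for [g] composed with the distance to [y], which is smooth at [p]. The transverse
    coefficient stays existential because the equation ignores it. *)
Lemma touched_radial (f : 'rV[R]_n -> R) (g G : R -> R) (g2 d eta : R) p y :
  0 < enorm (p - y) ->
  (exists2 r, 0 < r & forall h, enorm h < r ->
     f (p + h) - g (enorm (p + h - y)) <= f p - g (enorm (p - y))) ->
  0 < d -> (forall t, `|t - enorm (p - y)| < d -> is_derive t 1 g (G t)) ->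
  is_derive (enorm (p - y)) 1 G g2 -> 0 <= G (enorm (p - y)) ->
  (forall s t, `|s - enorm (p - y)| < d -> `|t - enorm (p - y)| < d ->
     s <= t -> g s <= g t) -> 0 < eta ->
  exists e K, enorm e = 1 /\ touched f p e (G (enorm (p - y))) (- g2 - eta) K.
Proof.
move=> py0 [r r0 rP] d0 dg dG G0 gmono eta0.
have py : p != y by apply: contraTneq py0 => ->; rewrite subrr enorm0 ltxx.
pose e := (enorm (p - y))^-1 *: (p - y).
have e1 : enorm e = 1 by apply: unit_dir; rewrite subr_eq0.
exists e, (G (enorm (p - y)) * (enorm (p - y))^-1 + eta); split => //.
have mono : exists2 d', 0 < d' & forall h t, enorm h < d' ->
    `|t - enorm (p - y)| < d' -> enorm (p + h - y) <= t ->
    g (enorm (p + h - y)) <= g t.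
  exists d => // h t hd td; apply: gmono => //.
  have := enormD (p - y) h; have := enormD_ge (p - y) h; rewrite (addrAC p h).
  by rewrite ltr_norml => ? ?; apply/andP; split; lra.
have [r' r'0 r'P] := @touched_comp _ _ (fun z => enorm (z - y)) g p e 1 0
  (enorm (p - y))^-1 (G (enorm (p - y))) g2 eta e1 G0 eta0
  (fun eps eps0 => taylor2_le d0 dg dG eps0)
  mono (touched_dist py).
exists (Num.min r r'); first by rewrite lt_min r0.
move=> h; rewrite lt_min => /andP[/rP + /r'P]; rewrite /= expr1n.
by lra.
Qed.

(** If the maximum of [f - g] exceeds [A], it is reached neither at the vertex nor on the sphere;
    otherwise [xs] itself is a maximum point. *)
Lemma radial_max (f : 'rV[R]_n -> R) (g : R -> R) (A rho : R) y xs :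
  (exists2 p, enorm (p - y) <= rho & forall x, enorm (x - y) <= rho ->
     f x - g (enorm (x - y)) <= f p - g (enorm (p - y))) ->
  f y <= g 0 + A -> (forall x, enorm (x - y) = rho -> f x <= g rho + A) ->
  0 < enorm (xs - y) -> enorm (xs - y) < rho -> g (enorm (xs - y)) + A <= f xs ->
  exists p, [/\ 0 < enorm (p - y), enorm (p - y) < rho & 
    exists2 r, 0 < r & forall h, enorm h < r ->
     f (p + h) - g (enorm (p + h - y)) <= f p - g (enorm (p - y))].
Proof.
move=> [p prho pmax] fy fsph xs0 xsrho fxs.
have near_max q : enorm (q - y) < rho ->
    (forall x, enorm (x - y) <= rho ->
       f x - g (enorm (x - y)) <= f q - g (enorm (q - y))) ->
    exists2 r, 0 < r & forall h, enorm h < r ->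
     f (q + h) - g (enorm (q + h - y)) <= f q - g (enorm (q - y)).
  move=> qrho qmax; exists (rho - enorm (q - y)); first by rewrite subr_gt0.
  move=> h hr; apply: qmax; rewrite addrAC.
  by apply: le_trans (enormD _ _) _; lra.
have [pA|pA] := leP (f p - g (enorm (p - y))) A.
  exists xs; split=> //; apply: near_max => // x /pmax.
  by lra.
have p0 : 0 < enorm (p - y).
  rewrite lt_def enorm_ge0 andbT; apply: contraTneq pA => p0.
  have /eqP := enorm_eq0 p0; rewrite subr_eq0 => /eqP py.
  by rewrite -leNgt p0 py; lra.
have prho' : enorm (p - y) < rho.
  rewrite lt_neqAle prho andbT; apply: contraTneq pA => E.
  by rewrite -leNgt E; have := fsph p E; lra.
by exists p; split => //; apply: near_max.
Qed.

(* The only semicontinuity needed of [f], which will be a power of an envelope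
   not known to be continuous beforehand. *)
Definition attains_max (Omega : set 'rV[R]_n) (f : 'rV[R]_n -> R) :=
  forall y rho (g : R -> R), 0 <= rho ->
    (forall x, enorm (x - y) <= rho -> Omega x) -> continuous g ->
    exists2 p, enorm (p - y) <= rho & forall x, enorm (x - y) <= rho ->
     f x - g (enorm (x - y)) <= f p - g (enorm (p - y)).

Lemma continuous_attains_max Omega f : continuous f -> attains_max Omega f.
Proof.
move=> cf y rho g rho0 _ cg.
have [|||p /set_mem/= pr pmax] := @compact_EVT_max _ R (fun x => f x - g (enorm (x -
  y)))
    [set x | enorm (x - y) <= rho].
- by exists y; rewrite /= subrr enorm0.
- exact: compact_eball.
- have cg' : continuous (fun x => g (enorm (x - y))).
    move=> x; apply: (@continuous_comp _ _ _ (fun x => enorm (x - y)) g x).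
      exact: dist_continuous.
    exact: cg.
  by apply: continuous_subspaceT => x; exact: (continuousB (cf x) (cg' x)).
by exists p => // x xr; apply: pmax; rewrite inE.
Qed.

End Subsolution.

(** * Radial profiles of exponent 4/3 *)

Section Profile.
Variable R : realType.
Implicit Types (c s t r L : R).

(* [g r = profile c (L + r)] solves [g'^2 g'' = c^3 * 64 / 81] where [L + r > 0],
   and [g r = - profile c (L - r)] solves [- g'^2 g'' = c^3 * 64 / 81] where
   [r < L]. *)
Definition profile c t := c * (Num.max t 0) `^ (4 / 3).
Definition dprofile c t := c * (4 / 3) * t `^ (1 / 3).
Definition ddprofile c t := c * (4 / 9) * t `^ (- (2 / 3)).

Lemma is_derive_affine (F : R -> R) (a b c t : R) :
  is_derive (a * t + b) 1 F c -> is_derive t 1 (fun r => F (a * r + b)) (a * c).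
Proof.
move=> /is_derive_epsP H; apply/is_derive_epsP => e e0.
have [d d0 dP] := H (e / (`|a| + 1)) (divr_gt0 e0 (ltr_wpDl (normr_ge0 _) ltr01)).
exists (d / (`|a| + 1)); first by rewrite divr_gt0 // ltr_wpDl.
move=> h; rewrite ltr_pdivlMr ?ltr_wpDl // => hd.
have := dP (a * h); rewrite normrM !scaler1.
have -> : a * h + (a * t + b) = a * (h + t) + b by ring.
have -> : a * h * c = h * (a * c) by ring.
move=> /(_ _)/le_trans; apply.
  by have := normr_ge0 h; lra.
rewrite mulrAC -mulrA ler_wpM2l ?(ltW e0) //.
rewrite mulrAC -[leRHS]mul1r ler_wpM2r // ler_pdivrMr ?ltr_wpDl //; lra.
Qed.

Lemma is_derive_near (F G : R -> R) (t d c : R) : 0 < d ->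
  (forall s, `|s - t| < d -> F s = G s) -> is_derive t 1 G c -> is_derive t 1 F c.
Proof.
move=> d0 FG /is_derive_epsP H; apply/is_derive_epsP => e /H[r r0 rP].
exists (Num.min d r); first by rewrite lt_min d0.
move=> h; rewrite lt_min => /andP[hd /rP].
by rewrite !FG // ?subrr ?normr0 // scaler1 addrK.
Qed.

Lemma maxpow_continuous (a : R) : 0 < a -> continuous (fun t : R => (Num.max t 0) `^ a).
Proof.
move=> a0 t; have [t0|t0] := ltP 0 t.
  suff [dd _] : is_derive t 1 (fun t : R => (Num.max t 0) `^ a) (a * t `^ (a - 1)).
    exact/differentiable_continuous/derivable1_diffP.
  apply: (@is_derive_near _ (fun s => s `^ a) _ t) => //.
    by move=> s; rewrite ltr_norml => /andP[? ?]; rewrite max_l //; lra.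
  exact: is_derive1_powR.
apply/cvgrPdist_lt => e e0; apply/nbhs_ballP.
exists (e `^ a^-1); first by rewrite /= powR_gt0.
move=> s /=; rewrite /ball /= /ball_ /= => st.
rewrite (max_r t0) powR0 ?gt_eqF // sub0r normrN ger0_norm ?powR_ge0 //.
have [s0|s0] := ltP 0 s; last by rewrite powR0 ?gt_eqF.
have -> : e = (e `^ a^-1) `^ a by rewrite -powRrM mulVf ?gt_eqF // powRr1 // ltW.
rewrite gt0_ltr_powR ?nnegrE ?powR_ge0 ?(ltW s0) //.
by apply: le_lt_trans st; rewrite distrC; apply: le_trans (ler_norm _); lra.
Qed.

Lemma profile_derive c t : 0 < t -> is_derive t 1 (profile c) (dprofile c t).
Proof.
move=> t0; apply: (@is_derive_near _ (c \*: (fun s => s `^ (4 / 3))) _ t) => //.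
  move=> s st; rewrite /profile max_l //; move: st.
  by rewrite ltr_norml => /andP[? ?]; lra.
rewrite /dprofile -mulrA.
have := is_derive1_powR (4 / 3) t0; rewrite (_ : 4 / 3 - 1 = 1 / 3) => [?|]; last by
  field.
exact: is_deriveZ.
Qed.

Lemma dprofile_derive c t : 0 < t -> is_derive t 1 (dprofile c) (ddprofile c t).
Proof.
move=> t0; rewrite /dprofile /ddprofile.
have -> : c * (4 / 9) * t `^ (- (2 / 3)) = (c * (4 / 3)) *: (1 / 3 * t `^ (- (2 / 3))).
  by rewrite -[_ *: _]/(_ * _); field.
have := is_derive1_powR (1 / 3) t0; rewrite (_ : 1 / 3 - 1 = - (2 / 3)) => [?|]; last
  by field.
exact: is_deriveZ.
Qed.

Lemma dprofile_gt0 c t : 0 < c -> 0 < t -> 0 < dprofile c t.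
Proof. by move=> c0 t0; rewrite !mulr_gt0 ?powR_gt0. Qed.

Lemma powR_third t : 0 <= t -> (t `^ (1 / 3)) ^+ 3 = t.
Proof.
by move=> t0; rewrite -powR_mulrn ?powR_ge0 // -powRrM (_ : 1 / 3 * 3 = 1) ?powRr1
  //; field.
Qed.

Lemma profile_ode c t : 0 < t ->
  dprofile c t ^+ 2 * ddprofile c t = c ^+ 3 * (64 / 81).
Proof.
move=> t0; rewrite /dprofile /ddprofile powRN.
have -> : t `^ (2 / 3) = (t `^ (1 / 3)) ^+ 2.
  by rewrite -powR_mulrn ?powR_ge0 // -powRrM; congr (_ `^ _); field.
by field; rewrite gt_eqF ?powR_gt0.
Qed.

Lemma profile_homo c : 0 <= c -> {homo profile c : s t / s <= t}.
Proof.
move=> c0 s t st; rewrite /profile ler_wpM2l // ge0_ler_powR ?nnegrE ?le_max ?lexx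
  ?orbT //.
have [s0|s0] := ltP 0 s; have [t0|t0] := ltP 0 t => //; lra.
Qed.

Lemma profile0 c : profile c 0 = 0.
Proof. by rewrite /profile maxxx powR0 ?mulr0 // gt_eqF. Qed.

Lemma profile_continuous c : continuous (profile c).
Proof.
move=> t; apply: (continuousM (@cst_continuous _ _ c t)).
by apply: maxpow_continuous; rewrite divr_gt0.
Qed.

End Profile.

(** * Increments of the profiles *)

Section ProfileIncrements.
Variable R : realType.
Implicit Types (c s t e : R).

Lemma powR_third_lt s t : 0 <= s -> s < t -> s `^ (1 / 3) < t `^ (1 / 3).
Proof. by move=> s0 st; rewrite gt0_ltr_powR ?nnegrE //; lra. Qed.

Lemma profileE c t : 0 <= t -> profile c t = c * (t * t `^ (1 / 3)).
Proof.
move=> t0; rewrite /profile max_l //.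
by rewrite (_ : 1 / 3 = 4 / 3 - 1) ?mulr_powRB1 //; field.
Qed.

Lemma profile_o c e : 0 <= c -> 0 < e ->
  exists2 d, 0 < d & forall t, 0 <= t -> t < d -> profile c t <= e * t.
Proof.
move=> c0 e0; have w0 : 0 < e / (c + 1) by rewrite divr_gt0 // ltr_wpDl.
exists ((e / (c + 1)) ^+ 3); first by rewrite exprn_gt0.
move=> t t0 td; rewrite profileE //.
have tw : t `^ (1 / 3) < e / (c + 1).
  rewrite -(@ltr_pXn2r _ 3) ?nnegrE ?powR_ge0 ?(ltW w0) //.
  by rewrite powR_third.
rewrite mulrCA mulrC ler_wpM2r //.
move: tw; rewrite ltr_pdivlMr ?ltr_wpDl // => tw.
have := powR_ge0 t (1 / 3); nra.
Qed.

Lemma profile_MVT c s t : 0 <= c -> 0 <= s -> s < t ->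
  exists2 z, s < z < t & profile c t - profile c s = dprofile c z * (t - s).
Proof.
move=> c0 s0 st.
have [||z] := @MVT R (profile c) (dprofile c) s t st.
- by move=> x; rewrite in_itv /= => /andP[? _]; apply: profile_derive; lra.
- by apply: continuous_subspaceT; exact: profile_continuous.
by rewrite in_itv /= => zst E; exists z.
Qed.

Lemma profile_lt c s t : 0 < c -> 0 <= s -> s < t -> profile c s < profile c t.
Proof.
move=> c0 s0 st; have [z /andP[sz zt] E] := profile_MVT (ltW c0) s0 st.
rewrite -subr_gt0 E mulr_gt0 ?subr_gt0 // dprofile_gt0 //; lra.
Qed.

Lemma dprofile_lt c s t : 0 < c -> 0 <= s -> s < t -> dprofile c s < dprofile c t.
Proof.
move=> c0 s0 st; rewrite /dprofile ltr_pM2l ?mulr_gt0 //.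
exact: powR_third_lt.
Qed.

(** The slope grows like a cube root, so a factor [tau] on the coefficient amounts to [tau ^+ 3] on
    the argument; this is the origin of the cube in [T] below. *)
Lemma dprofile_scale c tau t : 0 < tau -> 0 <= t ->
  dprofile (c * tau) t = dprofile c (tau ^+ 3 * t).
Proof.
move=> tau0 t0; rewrite /dprofile powRM ?exprn_ge0 ?(ltW tau0) //.
rewrite -powR_mulrn ?(ltW tau0) // -powRrM (_ : 3%:R * (1 / 3) = 1); last by field.
by rewrite powRr1 ?(ltW tau0) //; ring.
Qed.

Lemma affine_continuous (a b : R) : continuous (fun s => a * s + b).
Proof.
move=> s; apply: differentiable_continuous; apply/derivable1_diffP.
have [] // : is_derive s 1 (fun s => a * s + b) a.
by apply: (@is_derive_line _ _ _ _ _ _ 0) => h; rewrite scaler1; ring.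
Qed.

(* [T] is such that the slopes of [profile c (T + s)] and
   [profile (c * tau) (C + s)] agree at [s = e]; the former is larger for
   [s < e], the latter for [s > e]. *)
Lemma profile_compare c tau C e : 0 < c -> 1 < tau -> 0 <= C -> 0 < e ->
  let T := tau ^+ 3 * (C + e) - e in
  [/\ 0 < T,
      profile c (T + 2 * e) - profile c (T + e)
        < profile (c * tau) (C + 2 * e) - profile (c * tau) (C + e) &
      profile (c * tau) (C + e) - profile (c * tau) C
        < profile c (T + e) - profile c T].
Proof.
move=> c0 tau1 C0 e0 T.
have tau0 : 0 < tau by lra.
have t3 : 1 < tau ^+ 3 by rewrite exprn_egt1.
have T0 : 0 < T by rewrite /T; nra.
pose F s := profile c (1 * s + T) - profile (c * tau) (1 * s + C).
have dF s : 0 < s -> is_derive s 1 F (1 * dprofile c (1 * s + T) - 1 * dprofile (c *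
  tau) (1 * s + C)).
  move=> s0.
  have ? : is_derive s 1 (fun s => profile c (1 * s + T)) (1 * dprofile c (1 * s + T)).
    by apply: is_derive_affine; apply: profile_derive; lra.
  have ? : is_derive s 1 (fun s => profile (c * tau) (1 * s + C)) (1 * dprofile (c *
    tau) (1 * s + C)).
    by apply: is_derive_affine; apply: profile_derive; lra.
  exact: is_deriveB.
have cF : continuous F.
  have cP b k : continuous (fun s => profile k (1 * s + b)).
    move=> s; apply: (@continuous_comp _ _ _ (fun s => 1 * s + b) (profile k)).
      exact: affine_continuous.
    exact: profile_continuous.
  by move=> s; apply: cvgB; exact: cP.
have mvt (a b : R) : 0 <= a -> a < b -> exists2 s, s \in `]a, b[ &
    F b - F a = (1 * dprofile c (1 * s + T) - 1 * dprofile (c * tau) (1 * s + C)) *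
      (b - a).
  move=> a0 ab; apply: MVT ab _ (continuous_subspaceT cF) => s.
  by rewrite in_itv /= => /andP[? _]; apply: dF; lra.
have slope s : 0 < s ->
    tau ^+ 3 * (s + C) = s + T + (tau ^+ 3 - 1) * (s - e) by rewrite /T => _; ring.
split => //.
- have e2 : e < 2 * e by lra.
  have [s] := mvt e (2 * e) (ltW e0) e2.
  rewrite in_itv /= /F !mul1r !(addrC _ T) !(addrC _ C) => /andP[es se].
  rewrite dprofile_scale //; last by lra.
  rewrite [tau ^+ 3 * _](_ : _ = T + s + (tau ^+ 3 - 1) * (s - e)); last by rewrite
    addrC slope ?(addrC s); lra.
  have : dprofile c (T + s) < dprofile c (T + s + (tau ^+ 3 - 1) * (s - e)).
    by apply: dprofile_lt => //; [lra|rewrite ltrDl mulr_gt0 ?subr_gt0].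
  by nra.
- have [s] := mvt 0 e (lexx 0) e0.
  rewrite in_itv /= /F !mul1r !add0r !(addrC _ T) !(addrC _ C) => /andP[s0 se].
  rewrite dprofile_scale //; last by lra.
  rewrite [tau ^+ 3 * _](_ : _ = T + s + (tau ^+ 3 - 1) * (s - e)); last by rewrite
    addrC slope ?(addrC s); lra.
  have : dprofile c (T + s + (tau ^+ 3 - 1) * (s - e)) < dprofile c (T + s).
    apply: dprofile_lt => //; last by rewrite gtrDl pmulr_rlt0 ?subr_gt0 // subr_lt0.
    have := slope s s0; rewrite (addrC T) => <-; rewrite mulr_ge0 ?exprn_ge0; lra.
  by nra.
Qed.

End ProfileIncrements.

(** * Radial comparison estimates *)

Section RadialEstimates.
Variables (R : realType) (n : nat) (Omega : set 'rV[R]_n).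
Implicit Types (x y e h p : 'rV[R]_n) (f v : 'rV[R]_n -> R).

Lemma mul_small (a gap : R) : 0 <= a -> 0 < gap -> exists2 eta, 0 < eta & a * eta < gap.
Proof.
move=> a0 g0; exists (gap / (a + 1)); first by rewrite divr_gt0 // ltr_wpDl.
by rewrite mulrA ltr_pdivrMr ?ltr_wpDl //; lra.
Qed.

(** Off its vertex the radial function has [- Delta_oo] equal to [- (c ^+ 3 * (64 / 81))], more than
    a subsolution allows; the strict gap absorbs the error [eta] of [touched_radial]. *)
Lemma profile_not_touching f kappa c C p y : subsolution Omega f kappa ->
  0 <= c -> - (c ^+ 3 * (64 / 81)) > kappa -> 0 <= C ->
  Omega p -> 0 < enorm (p - y) ->
  (exists2 r, 0 < r & forall h, enorm h < r ->
     f (p + h) - profile c (C + enorm (p + h - y))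
       <= f p - profile c (C + enorm (p - y))) -> False.
Proof.
move=> fsub c0 ck C0 Op r0 near_max.
set r := enorm (p - y) in r0 near_max.
pose g s := profile c (1 * s + C).
have gE s : g s = profile c (C + s) by rewrite /g mul1r addrC.
have r1 : 0 < C + r by lra.
have gap : 0 < - (c ^+ 3 * (64 / 81)) - kappa by lra.
have [eta eta0 eta_small] := mul_small (sqr_ge0 (1 * dprofile c (1 * r + C))) gap.
have [|||||||e [K [e1 touch]]] := @touched_radial _ _ f g (fun s => 1 * dprofile c (1
  * s + C))
   (1 * (1 * ddprofile c (1 * r + C))) r eta p y r0.
- case: near_max => d d0 dP; exists d; [exact: d0|move=> h hd].
  by rewrite !gE -/r; exact: dP.
- by [].
- move=> t; rewrite -/r ltr_norml => /andP[t1 t2].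
  by apply: is_derive_affine; apply: profile_derive; lra.
- have ? : is_derive r 1 (fun s => dprofile c (1 * s + C)) (1 * ddprofile c (1 * r +
  C)).
    by apply: is_derive_affine; apply: dprofile_derive; lra.
  exact: (@is_deriveZ _ _ _ _ 1).
- by rewrite mul1r mulr_ge0 ?powR_ge0 ?mulr_ge0.
- by move=> s t _ _ st; apply: profile_homo => //; rewrite lerD2r !mul1r.
- by [].
have := fsub p e _ _ K Op e1 touch.
have r1' : 0 < 1 * r + C by lra.
have := profile_ode c r1'; rewrite -/r; move: eta_small; rewrite !mul1r.
by move: (dprofile _ _) (ddprofile _ _) => a b; nra.
Qed.

(** Counterpart with the concave branch [- profile c (L - r)], still increasing in [r], whose
    [- Delta_oo] is [c ^+ 3 * (64 / 81)]. *)
Lemma neg_profile_not_touching f kappa c L p y : subsolution Omega f kappa ->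
  0 <= c -> kappa < c ^+ 3 * (64 / 81) -> enorm (p - y) < L ->
  Omega p -> 0 < enorm (p - y) ->
  (exists2 r, 0 < r & forall h, enorm h < r ->
     f (p + h) + profile c (L - enorm (p + h - y))
       <= f p + profile c (L - enorm (p - y))) -> False.
Proof.
move=> fsub c0 ck rL Op r0 near_max.
set r := enorm (p - y) in r0 rL near_max.
pose g s := (- 1) * profile c (- 1 * s + L).
have gE s : g s = - profile c (L - s) by rewrite /g !mulN1r addrC.
have gap : 0 < c ^+ 3 * (64 / 81) - kappa by lra.
have [eta eta0 eta_small] := mul_small (sqr_ge0 (dprofile c (L - r))) gap.
have [|||||||e [K [e1 touch]]] := @touched_radial _ _ f g
   (fun s => (- 1) * (- 1 * dprofile c (- 1 * s + L)))
   (- 1 * (- 1 * (- 1 * ddprofile c (- 1 * r + L)))) (L - r) eta p y r0.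
- case: near_max => d d0 dP; exists d; [exact: d0|move=> h hd].
  by rewrite !gE -/r !opprK; exact: dP.
- by lra.
- move=> t; rewrite -/r ltr_norml => /andP[t1 t2].
  have ? : is_derive t 1 (fun s => profile c (- 1 * s + L)) (- 1 * dprofile c (- 1 *
    t + L)).
    by apply: is_derive_affine; apply: profile_derive; lra.
  exact: (@is_deriveZ _ _ _ _ (- 1)).
- have ? : is_derive r 1 (fun s => dprofile c (- 1 * s + L)) (- 1 * ddprofile c (- 1
  * r + L)).
    by apply: is_derive_affine; apply: dprofile_derive; lra.
  have ? := @is_deriveZ _ _ _ (fun s : R => dprofile c (- 1 * s + L)) (- 1) r 1 _ _.
  exact: (@is_deriveZ _ _ _ _ (- 1)).
- by rewrite !mulN1r opprK mulr_ge0 ?powR_ge0 ?mulr_ge0.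
- by move=> s t _ _ st; rewrite /g !mulN1r lerN2 profile_homo // lerD2r lerN2.
- by [].
have := fsub p e _ _ K Op e1 touch.
have rL' : 0 < L - r by lra.
have := profile_ode c rL'; rewrite -/r; move: eta_small; rewrite !mulN1r !opprK
  (addrC (- r)).
by move: (dprofile _ _) (ddprofile _ _) => a b; nra.
Qed.

Lemma affine_profile_continuous (a c b C : R) :
  continuous (fun s => a * profile c (b * s + C)).
Proof.
move=> s; apply: (@continuous_comp _ _ _ (fun s => profile c (b * s + C)) (fun t => a
  * t)).
  apply: (@continuous_comp _ _ _ (fun s => b * s + C) (profile c)).
    exact: affine_continuous.
  exact: profile_continuous.
have := @affine_continuous R a 0 (profile c (b * s + C)).
by under eq_fun do rewrite addr0.
Qed.

(** Barrier from below: [v ys + profile c (C + eps) - profile c (C + |x - x0|)]. It is at most [v]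
    on the sphere of radius [2 * eps] and, were the conclusion false, at [x0], yet at least [v] at
    [ys]; so it touches [v] away from its vertex. *)
Lemma super_step v kappa c C eps x0 ys : attains_max Omega (fun x => - v x) ->
  subsolution Omega (fun x => - v x) (- kappa) ->
  0 <= c -> c ^+ 3 * (64 / 81) < kappa -> 0 <= C -> 0 < eps ->
  (forall x, enorm (x - x0) <= 2 * eps -> Omega x) -> enorm (ys - x0) <= eps ->
  (forall x, enorm (x - x0) <= 2 * eps ->
     v ys - (profile c (C + 2 * eps) - profile c (C + eps)) <= v x) ->
  v x0 - v ys <= profile c (C + eps) - profile c C.
Proof.
move=> vmax vsub c0 ck C0 eps0 inO yseps low.
rewrite leNgt; apply/negP => bad.
have ys0 : 0 < enorm (ys - x0).
  rewrite lt_def enorm_ge0 andbT; apply: contraTneq bad => /enorm_eq0/eqP.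
  rewrite subr_eq0 => /eqP ->; rewrite subrr -leNgt subr_ge0.
  by apply: profile_homo => //; lra.
have [||||||p [p0 p2 pmax]] := @radial_max _ _ (fun x => - v x) (fun s => 1 * profile
  c (1 * s + C))
  (- v ys - profile c (C + eps)) (2 * eps) x0 ys.
- apply: (vmax x0 (2 * eps) (fun s => 1 * profile c (1 * s + C))) => //.
    by lra.
  exact: affine_profile_continuous.
- by rewrite mul1r mulr0 add0r; lra.
- move=> x xe; have := low x; rewrite xe lexx => /(_ isT).
  by rewrite !mul1r (addrC _ C); lra.
- by [].
- by lra.
- rewrite !mul1r; have : profile c (enorm (ys - x0) + C) <= profile c (C + eps).
    by apply: profile_homo => //; rewrite addrC lerD2l.
  by lra.
have Op : Omega p by apply: inO; exact: ltW.
apply: (profile_not_touching vsub c0 _ C0 Op p0); first by lra.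
case: pmax => r r0 rP; exists r; [exact: r0|move=> h /rP].
by rewrite !mul1r !(addrC C).
Qed.

(** Barrier from above: [f xs + profile c (T + eps) - profile c (T + 2 * eps - |x - x0|)]. The two
    increment hypotheses put it above [f] at [x0] and on the sphere, while it is at most [f xs] at
    [xs]. Positivity of [T] keeps the profile smooth on the whole ball. *)
Lemma sub_step f kappa c T eps x0 xs : attains_max Omega f ->
  subsolution Omega f kappa ->
  0 <= c -> kappa < c ^+ 3 * (64 / 81) -> 0 < T -> 0 < eps ->
  (forall x, enorm (x - x0) <= 2 * eps -> Omega x) -> enorm (xs - x0) <= eps ->
  profile c (T + 2 * eps) - profile c (T + eps) < f xs - f x0 ->
  (forall x, enorm (x - x0) <= 2 * eps ->
     f x <= f xs + (profile c (T + eps) - profile c T)) -> False.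
Proof.
move=> fmax fsub c0 ck T0 eps0 inO xseps incr up.
have xs0 : 0 < enorm (xs - x0).
  rewrite lt_def enorm_ge0 andbT; apply: contraTneq incr => /enorm_eq0/eqP.
  rewrite subr_eq0 => /eqP ->; rewrite subrr -leNgt subr_ge0.
  by apply: profile_homo => //; lra.
have [||||||p [p0 p2 pmax]] := @radial_max _ _ f (fun s => - 1 * profile c (- 1 * s +
  (T + 2 * eps)))
  (f xs + profile c (T + eps)) (2 * eps) x0 xs.
- apply: (fmax x0 (2 * eps) (fun s => - 1 * profile c (- 1 * s + (T + 2 * eps)))) => //.
    by lra.
  exact: affine_profile_continuous.
- by rewrite mulr0 add0r; lra.
- move=> x xe; have := up x; rewrite xe lexx => /(_ isT).
  have -> : - 1 * (2 * eps) + (T + 2 * eps) = T by ring.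
  by lra.
- by [].
- by lra.
- have : profile c (T + eps) <= profile c (- 1 * enorm (xs - x0) + (T + 2 * eps)).
    by apply: profile_homo => //; lra.
  by lra.
have Op : Omega p by apply: inO; exact: ltW.
have pL : enorm (p - x0) < T + 2 * eps by lra.
apply: (neg_profile_not_touching fsub c0 ck pL Op p0).
case: pmax => r r0 rP; exists r; [exact: r0|move=> h /rP].
by rewrite !mulN1r !(addrC (T + _)) !opprK.
Qed.

End RadialEstimates.

(** * Decrease of a supersolution around an arbitrary point *)

Section Vertex.
Variables (R : realType) (n : nat) (Omega : set 'rV[R]_n).
Implicit Types (x y e h p : 'rV[R]_n) (f v : 'rV[R]_n -> R).

Lemma line_continuous f y h : continuous f -> continuous (fun t : R => f (y + t *: h)).
Proof.
move=> cf t; apply/cvgrPdist_lt => e e0.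
have /continuous_enormP/(_ e e0)[r r0 rP] := cf (y + t *: h).
apply/nbhs_ballP; exists (r / (enorm h + 1)).
  by rewrite /= divr_gt0 // ltr_wpDl // enorm_ge0.
move=> s /=; rewrite /ball /= /ball_ /= ltr_pdivlMr ?ltr_wpDl ?enorm_ge0 // => st.
have -> : y + s *: h = y + t *: h + (s - t) *: h by rewrite -addrA -scalerDl [t +
  _]addrC subrK.
rewrite distrC; apply: rP; rewrite enormZ distrC.
by have := enorm_ge0 h; have := normr_ge0 (t - s); lra.
Qed.

(** The exponent 4/3 exceeds one, so the modulus of continuity is [o(|a - b|)] and the derivative
    along every segment vanishes. *)
Lemma flat_on_ball f c y eta : 0 <= c -> continuous f ->
  (forall a b, enorm (a - y) < eta -> enorm (b - y) < eta ->
     f a - f b <= profile c (enorm (a - b))) ->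
  forall h, enorm h < eta -> f (y + h) = f y.
Proof.
move=> c0 cf fP h hr.
pose phi (t : R) := f (y + t *: h).
have dphi (t : R) : t \in `]0, 1[ -> is_derive t 1 phi 0.
  rewrite in_itv /= => /andP[t0 t1]; apply/is_derive_epsP => e e0.
  have h1 : 0 < enorm h + 1 by rewrite ltr_wpDl ?enorm_ge0.
  have [d d0 dP] := profile_o c0 (divr_gt0 e0 h1).
  exists (Num.min (d / (enorm h + 1)) (Num.min t (1 - t))).
    by rewrite !lt_min divr_gt0 //= t0 subr_gt0.
  move=> s; rewrite !lt_min scaler1 mulr0 subr0 ltr_pdivlMr // ltr_norml (ltr_norml s
    (1 - t)).
  move=> /and3P[sd /andP[s1 s2] /andP[s3 s4]].
  have inB w : 0 <= w -> w <= 1 -> enorm (y + w *: h - y) < eta.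
    move=> w0 w1; rewrite addrAC subrr add0r enormZ ger0_norm //.
    by apply: le_lt_trans hr; rewrite ler_piMl ?enorm_ge0.
  have B1 : enorm (y + (s + t) *: h - y) < eta by apply: inB; lra.
  have B2 : enorm (y + t *: h - y) < eta by apply: inB; lra.
  have D : enorm (y + (s + t) *: h - (y + t *: h)) = `|s| * enorm h.
    by rewrite opprD addrACA subrr add0r -scalerBl addrK enormZ.
  have small : profile c (`|s| * enorm h) <= e * `|s|.
    have := enorm_ge0 h; have := normr_ge0 s => s_ge0 h_ge0.
    apply: le_trans (dP _ _ _) _; [by rewrite mulr_ge0|by lra|].
    rewrite mulrAC -mulrA ler_wpM2l ?(ltW e0) // ler_pdivrMr //; lra.
  rewrite /phi ler_norml; apply/andP; split.
    have := fP _ _ B2 B1; rewrite enormB D; lra.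
  by have := fP _ _ B1 B2; rewrite D; lra.
have [s _] := MVT ltr01 dphi (continuous_subspaceT (@line_continuous f y h cf)).
by rewrite mul0r /phi scale1r scale0r addr0 => /eqP; rewrite subr_eq0 => /eqP.
Qed.

(* Otherwise [v x >= v y' - c' |x - y'| ^ (4 / 3)] for all [x] and [y'] near [y],
   because the minimum over [x] can only be reached at the vertex [y']; then [v]
   is constant near [y]. *)
Lemma super_vertex v kappa c y rho e0 : enorm e0 = 1 -> continuous v ->
  subsolution Omega (fun x => - v x) (- kappa) ->
  0 < c -> c ^+ 3 * (64 / 81) < kappa -> 0 < rho ->
  (forall x, enorm (x - y) <= rho -> Omega x) ->
  exists2 x, enorm (x - y) <= rho & v x <= v y - profile c rho.
Proof.
move=> e01 cv vsub c0 ck rho0 inO; apply: contrapT => nex.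
pose f x := - v x.
have cf : continuous f by move=> x; exact: (continuousN (cv x)).
have low x : enorm (x - y) <= rho -> f x < f y + profile c rho.
  by move=> xr; rewrite ltNge; apply/negP => bad; apply: nex; exists x; rewrite // /f
    in bad *; lra.
have ballmax (F : 'rV[R]_n -> R) : continuous F -> exists2 p, enorm (p - y) <= rho &
    forall x, enorm (x - y) <= rho -> F x <= F p.
  move=> cF; have [p pr pP] := continuous_attains_max cF (ltW rho0) inO
    (@cst_continuous _ _ (0 : R)).
  by exists p => // x /pP; rewrite /= !subr0.
have [pM pMr pMP] := ballmax f cf.
pose p43 := rho * rho `^ (1 / 3).
have p430 : 0 < p43 by rewrite mulr_gt0 ?powR_gt0.
have Pr k : profile k rho = k * p43 by rewrite profileE // ltW.
(* [mu] is the least nonnegative coefficient whose profile at radius [rho] bounds [f pM - f y].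
   Taking [c'] strictly between [mu] and [c] leaves a slack [delta] on the sphere: half of it pays
   for replacing [f y] by [f y'], half for the change of radius when the vertex moves to [y']. *)
pose mu := Num.max 0 ((f pM - f y) / p43).
have mu0 : 0 <= mu by rewrite le_max lexx.
have muc : mu < c.
  by rewrite gt_max c0 ltr_pdivrMr // -Pr; have := low _ pMr; lra.
have muM : f pM - f y <= mu * p43 by rewrite -ler_pdivrMr // le_max lexx orbT.
pose c' := (c + mu) / 2.
have c'0 : 0 < c' by rewrite /c'; lra.
have c'c : c' < c by rewrite /c'; lra.
have c'k : c' ^+ 3 * (64 / 81) < kappa.
  apply: lt_trans ck; rewrite ltr_pM2r // ltr_pXn2r // nnegrE; lra.
pose delta := profile c' rho - (f pM - f y).
have delta0 : 0 < delta.
  by rewrite subr_gt0 Pr; apply: le_lt_trans muM _; rewrite ltr_pM2r // /c'; lra.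
have d2 : 0 < delta / 2 by lra.
have /continuous_enormP/(_ _ d2)[r1 r10 r1P] := cf y.
have := @profile_continuous _ c' rho.
move=> /cvgrPdist_lt/(_ _ d2)/nbhs_ballP[r2 /= r20 r2P].
pose eta := Num.min r1 (Num.min r2 rho).
have eta0 : 0 < eta by rewrite !lt_min r10 r20.
have key y' x : enorm (y' - y) < eta -> enorm (x - y) <= rho ->
    f x - f y' <= profile c' (enorm (x - y')).
  rewrite !lt_min => /and3P[y1 y2 y3] xr.
  pose F z := f z - profile c' (enorm (z - y')).
  have cF : continuous F.
    have cP : continuous (fun z : 'rV[R]_n => profile c' (enorm (z - y'))).
      move=> z; apply: (@continuous_comp _ _ _ (fun z : 'rV[R]_n => enorm (z - y'))
        (profile c') z).
        exact: dist_continuous.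
      exact: profile_continuous.
    by move=> z; exact: (continuousB (cf z) (cP z)).
  have [p pr pP] := ballmax F cF.
  have y'r : enorm (y' - y) <= rho by exact: ltW.
  have Fy' : F y' = f y' by rewrite /F subrr enorm0 profile0 subr0.
  have [py'|py'] := eqVneq p y'.
    by have := pP x xr; rewrite py' Fy' /F; lra.
  have py'0 : 0 < enorm (p - y') by rewrite enorm_gt0 // subr_eq0.
  have [prr|prr] := ltP (enorm (p - y)) rho.
    exfalso; have ck' : - (c' ^+ 3 * (64 / 81)) > - kappa by lra.
    apply: (profile_not_touching vsub (ltW c'0) ck' (lexx 0) (inO p pr) py'0).
    exists (rho - enorm (p - y)); [by lra|move=> h hr].
    rewrite !add0r; apply: pP; rewrite addrAC.
    by apply: le_trans (enormD _ _) _; lra.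
  exfalso; have prE : enorm (p - y) = rho by apply/eqP; rewrite eq_le pr.
  have pd : `|enorm (p - y') - rho| < r2.
    have E1 : p - y = (p - y') + (y' - y) by rewrite subrKA.
    have E2 : p - y' = (p - y) - (y' - y) by rewrite opprB subrKA.
    have := enormD (p - y') (y' - y); have := enormD (p - y) (- (y' - y)).
    rewrite -E1 -E2 prE enormN ltr_norml => A1 A2; apply/andP; split; lra.
  have := r2P (enorm (p - y')); rewrite /ball /= /ball_ /= distrC => /(_ pd).
  have := r1P (y' - y) y1; rewrite [y + _]addrC subrK.
  have := pMP p pr; have := pP y' y'r; rewrite Fy' /F !ltr_norml /delta.
  by move=> A1 A2 /andP[A3 A4] /andP[A5 A6]; lra.
have flat := @flat_on_ball f c' y eta (ltW c'0) cf (fun a b ha hb =>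
  key b a hb (ltW (lt_le_trans ha (_ : eta <= rho)))).
have {}flat : forall h, enorm h < eta -> f (y + h) = f y.
  by apply: flat; rewrite !ge_min lexx !orbT.
(* A locally constant function is touched with [q = k = 0], which contradicts [kappa > 0]. *)
have : 0 ^+ 2 * 0 <= - kappa.
  apply: (vsub y e0 0 0 0) => //; first by apply: inO; rewrite subrr enorm0 ltW.
  by exists eta => // h /flat; rewrite /f => ->; lra.
have : 0 < c ^+ 3 by rewrite exprn_gt0.
lra.
Qed.

End Vertex.

(** * Comparison principle *)

Section Comparison.
Variables (R : realType) (n : nat) (Omega : set 'rV[R]_n).
Implicit Types (x y e h p : 'rV[R]_n) (f v : 'rV[R]_n -> R).

Lemma profile_increment (c eps b : R) : 0 < c -> 0 < eps ->
  profile c (2 * eps) - profile c eps <= b ->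
  exists2 C, 0 <= C & profile c (C + 2 * eps) - profile c (C + eps) = b.
Proof.
move=> c0 eps0 lowb.
have k0 : 0 < c * (4 / 3) * eps by rewrite !mulr_gt0.
(* By the mean value theorem the increment at [C = s ^+ 3] is at least [dprofile c (s ^+ 3) * eps],
   that is [s * (c * (4 / 3) * eps)]. *)
pose s := Num.max 0 (b / (c * (4 / 3) * eps)).
have s0 : 0 <= s by rewrite le_max lexx.
have bs : b <= s * (c * (4 / 3) * eps) by rewrite -ler_pdivrMr // le_max lexx orbT.
pose F (C : R) := profile c (1 * C + 2 * eps) - profile c (1 * C + eps).
have cF : continuous F.
  have cP (k : R) : continuous (fun C : R => profile c (1 * C + k)).
    move=> C; apply: (@continuous_comp _ _ _ (fun C : R => 1 * C + k) (profile c)).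
      exact: affine_continuous.
    exact: profile_continuous.
  by move=> C; exact: (continuousB (cP _ C) (cP _ C)).
have F0 : F 0 <= b by rewrite /F mulr0 !add0r.
have F1 : b <= F (s ^+ 3).
  have s30 : 0 <= s ^+ 3 by rewrite exprn_ge0.
  have [||z /andP[z1 _] E] := @profile_MVT _ c (1 * s ^+ 3 + eps) (1 * s ^+ 3 + 2 *
    eps) (ltW c0); [lra|lra|].
  rewrite /F E; apply: le_trans bs _.
  have -> : 1 * s ^+ 3 + 2 * eps - (1 * s ^+ 3 + eps) = eps by ring.
  rewrite /dprofile mulrC mulrAC ler_wpM2r ?(ltW eps0) //.
  rewrite ler_wpM2l ?mulr_ge0 ?(ltW c0) //.
  rewrite -(@ler_pXn2r _ 3) ?nnegrE ?powR_ge0 // powR_third; lra.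
have [|||C] := @IVT R F 0 (s ^+ 3) b.
- by rewrite exprn_ge0.
- exact: continuous_subspaceT.
- by rewrite ge_min F0 le_max F1 orbT.
rewrite in_itv /= => /andP[C0 _] E; exists C => //.
by rewrite -E /F mul1r.
Qed.

(* Armstrong and Smart's argument: [xs] and [ys] maximize [f x - v y] subject to
   [|x - y| <= 2 eps], and the increments of [f] and [v] around their midpoint
   [x0] violate the radial comparison estimates. *)
Lemma comparison_local f v theta eps x0 xs ys e0 : enorm e0 = 1 ->
  attains_max Omega f -> subsolution Omega f 1 ->
  continuous v -> subsolution Omega (fun x => - v x) (- theta ^+ 3) ->
  1 < theta -> 0 < eps ->
  (forall x, enorm (x - x0) <= 2 * eps -> Omega x) ->
  enorm (xs - x0) <= eps -> enorm (ys - x0) <= eps ->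
  (forall x, enorm (x - x0) <= 2 * eps ->
     f x - v x0 <= f xs - v ys /\ f x0 - v x <= f xs - v ys) -> False.
Proof.
move=> e01 fmax fsub cv vsub theta1 eps0 inO xse yse opt.
(* Normalized so that [c0 ^+ 3 * (64 / 81) = 1]. The factors [1 < t1 < t2 < theta] then make the
   profile of coefficient [c1] strict for [f], that of [c2] strict for [v], and [c1 < c2]. *)
pose c0 : R := (81 / 64) `^ (1 / 3).
have c00 : 0 < c0 by rewrite powR_gt0 // divr_gt0.
have c03 : c0 ^+ 3 = 81 / 64 by rewrite powR_third // divr_ge0.
pose t1 := 1 + (theta - 1) / 3; pose t2 := 1 + (theta - 1) * (2 / 3).
have t1_gt : 1 < t1 by rewrite /t1; lra.
have t12 : t1 < t2 by rewrite /t1 /t2; lra.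
have t2th : t2 < theta by rewrite /t2; lra.
pose c1 := c0 * t1; pose tau := t2 / t1.
have t10 : 0 < t1 by lra.
have c1tau : c1 * tau = c0 * t2 by rewrite /c1 /tau; field; rewrite gt_eqF.
have tau1 : 1 < tau by rewrite /tau ltr_pdivlMr // mul1r.
have c10 : 0 < c1 by rewrite mulr_gt0.
have c20 : 0 < c1 * tau by rewrite mulr_gt0 //; lra.
have c1k : 1 < c1 ^+ 3 * (64 / 81).
  rewrite /c1 exprMn c03 mulrAC (_ : 81 / 64 * (64 / 81) = 1) ?mul1r; last by field.
  by rewrite exprn_egt1.
have c2k : (c1 * tau) ^+ 3 * (64 / 81) < theta ^+ 3.
  rewrite c1tau exprMn c03 mulrAC (_ : 81 / 64 * (64 / 81) = 1) ?mul1r; last by field.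
  by rewrite ltr_pXn2r // nnegrE; lra.
set c2 := c1 * tau in c20 c2k.
have nvcont : continuous (fun x => - v x) by move=> x; exact: (continuousN (cv x)).
have nvmax := continuous_attains_max (Omega := Omega) nvcont.
have eps20 : 0 < 2 * eps by lra.
have [y2 y2r y2P] := nvmax x0 (2 * eps) (cst 0) (ltW eps20) inO (@cst_continuous _ _
  (0 : R)).
have {}y2P x : enorm (x - x0) <= 2 * eps -> v y2 <= v x.
  by move=> /y2P; rewrite /= !subr0 lerN2.
have step C : 0 <= C -> v ys - v y2 <= profile c2 (C + 2 * eps) - profile c2 (C +
  eps) ->
    v x0 - v ys <= profile c2 (C + eps) - profile c2 C.
  move=> C0 H; apply: (super_step nvmax vsub (ltW c20) c2k C0 eps0 inO yse).
  by move=> x /y2P; lra.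
(* Allows the increment of [v] to be matched with some [C >= 0]: were it smaller than the increment
   at [C = 0], the step with [C = 0] would give [v x0 - v y2 < profile c2 (2 * eps)], against
   [super_vertex]. *)
have lowb : profile c2 (2 * eps) - profile c2 eps <= v ys - v y2.
  rewrite leNgt; apply/negP => bad.
  have := step 0 (lexx 0); rewrite !add0r profile0 => /(_ (ltW bad)).
  have [x /y2P] := super_vertex e01 cv vsub c20 c2k eps20 inO.
  by lra.
have [C C0 CE] := profile_increment c20 eps0 lowb.
have := profile_compare c10 tau1 C0 eps0; rewrite -/c2 /=.
set T := _ - eps => -[T0 T1 T2].
have a' := step C C0; rewrite CE in a' T1; have {}a' := a' (lexx _).
(* Maximality transfers increments: [f] rises from [x0] to [xs] at least as much as [v] from [y2] to
   [ys], and rises beyond [xs] at most as much as [v] from [ys] to [x0]. [profile_compare] turns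
   both into strict bounds for the profile of coefficient [c1]. *)
apply: (sub_step fmax fsub (ltW c10) c1k T0 eps0 inO xse).
  by have [_] := opt y2 y2r; lra.
by move=> x /opt[H _]; lra.
Qed.

End Comparison.

(** * The solution, extended by zero *)

Section Domain.
Variables (R : realType) (n : nat) (Omega : set 'rV[R]_n) (u : 'rV[R]_n -> R).
Implicit Types (x y e h p : 'rV[R]_n).
Hypotheses (n_gt0 : (0 < n)%N) (oO : open Omega) (bO : bounded_set Omega).
Hypothesis sol : dirichlet_solution Omega u.

(* Unlike [u], it is continuous on the whole space. *)
Definition extension x : R := if x \in Omega then u x else 0.
Local Notation u0 := extension.

Lemma extension_in x : Omega x -> u0 x = u x.
Proof. by move=> Ox; rewrite /u0 mem_set. Qed.

Lemma extension_out x : ~ Omega x -> u0 x = 0.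
Proof. by move=> Ox; rewrite /u0 memNset. Qed.

Lemma open_enorm x : Omega x -> exists2 r, 0 < r & forall h, enorm h < r -> Omega (x
  + h).
Proof. by move=> Ox; apply/nbhs_enormP; exact: open_nbhs_nbhs. Qed.

Lemma extension_continuous : continuous u0.
Proof.
have [uc ub _] := sol.
move=> x; apply/continuous_enormP => eps eps0.
have within_u : closure Omega x -> exists2 r, 0 < r & forall h, enorm h < r ->
    closure Omega (x + h) -> `|u (x + h) - u x| < eps.
  move=> cx; have /subspace_continuousP/(_ x cx) := uc.
  move=> /(_ [set t | `|t - u x| < eps]) H.
  apply/(nbhs_enormP x [set y | closure Omega y -> `|u y - u x| < eps]).
  apply: H; apply/nbhs_ballP; exists eps => // t.
  by rewrite /ball /= /ball_ /= distrC.
have [Ox|Ox] := pselect (Omega x).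
  have [r r0 rP] := within_u (subset_closure Ox).
  have [r' r'0 r'P] := open_enorm Ox.
  exists (Num.min r r'); first by rewrite lt_min r0.
  move=> h; rewrite lt_min => /andP[hr hr']; have Oh := r'P h hr'.
  by rewrite !extension_in //; apply: rP => //; exact: subset_closure.
rewrite (extension_out Ox).
have [cx|cx] := pselect (closure Omega x).
  have [r r0 rP] := within_u cx.
  exists r => // h hr; have [Oh|Oh] := pselect (Omega (x + h)).
    have := rP h hr (subset_closure Oh); rewrite extension_in // (ub x) //.
    by split=> // /interior_subset.
  by rewrite extension_out // subrr normr0.
have [r r0 rP] : exists2 r, 0 < r & forall h, enorm h < r -> (~` closure Omega) (x + h).
  apply/nbhs_enormP; apply: open_nbhs_nbhs; split => //.
  exact/closed_openC/closed_closure.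
exists r => // h /rP hO; rewrite extension_out ?subrr ?normr0 // => Oh.
exact/hO/subset_closure.
Qed.

Lemma touched_local f g x e q k K : Omega x -> (forall y, Omega y -> f y = g y) ->
  touched f x e q k K -> touched g x e q k K.
Proof.
move=> Ox fg [r r0 rP]; have [r' r'0 r'P] := open_enorm Ox.
exists (Num.min r r'); first by rewrite lt_min r0.
by move=> h; rewrite lt_min => /andP[/rP + /r'P Oh]; rewrite !fg.
Qed.

Lemma extension_sub : subsolution Omega u0 1.
Proof.
have [_ _ visc] := sol; move=> x e q k K Ox e1 touch.
apply: (viscosity_subsolution visc Ox e1 (K := K)).
by apply: touched_local touch => // y /extension_in.
Qed.

Lemma extension_super : subsolution Omega (fun x => - u0 x) (- 1).
Proof.
have [_ _ visc] := sol; move=> x e q k K Ox e1 touch.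
apply: (viscosity_supersolution visc Ox e1 (K := K)).
by apply: touched_local touch => // y /extension_in ->.
Qed.

Lemma unit_exists : exists e : 'rV[R]_n, enorm e = 1.
Proof.
exists (delta_mx 0 (Ordinal n_gt0)); rewrite /enorm inner_delta mxE !eqxx.
exact: sqrtr1.
Qed.

Lemma compact_closure : compact (closure Omega).
Proof.
apply: bounded_closed_compact; last exact: closed_closure.
case: bO => M [Mr MP]; exists (M + 1); split; first exact: num_real.
move=> N ltN x cx.
have [y [Oy]] := cx _ (nbhsx_ballx x 1 ltr01).
rewrite -ball_normE /= => xy.
rewrite -(subrK y x); apply: le_trans (ler_normD _ _) _.
have := MP (N - 1) _ y Oy; rewrite ltrBrDr => /(_ ltN).
by move: xy => /=; lra.
Qed.

Lemma no_interior_min p : Omega p ->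
  (exists2 r, 0 < r & forall h, enorm h < r -> u0 p <= u0 (p + h)) -> False.
Proof.
move=> Op [r r0 rP]; have [e e1] := unit_exists.
have : 0 ^+ 2 * 0 <= (- 1 : R).
  apply: (extension_super Op e1 (K := 0)).
  by exists r => // h /rP; lra.
lra.
Qed.

(** A minimum over the closure reached outside [Omega] has value 0, and then a point [x] with
    [u0 x <= 0] is itself an interior minimum; interior minima are excluded by a constant test
    function. *)
Lemma extension_gt0 x : Omega x -> 0 < u0 x.
Proof.
move=> Ox; rewrite ltNge; apply/negP => x_le0.
have cx : closure Omega x by exact: subset_closure.
have [|||p /set_mem cp pmin] := @compact_EVT_min _ R u0 (closure Omega).
- by exists x.
- exact: compact_closure.
- exact: continuous_subspaceT extension_continuous.
have Omin q : Omega q -> (forall t, Omega t -> u0 q <= u0 t) -> False.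
  move=> Oq qmin; apply: (no_interior_min Oq).
  have [r r0 rP] := open_enorm Oq; exists r => // h /rP; exact: qmin.
have px := pmin x (mem_set cx).
have [Op|Op] := pselect (Omega p).
  by apply: (Omin p Op) => t Ot; apply: pmin; rewrite inE; exact: subset_closure.
move: px; rewrite (extension_out Op) => px.
apply: (Omin x Ox) => t Ot; have := pmin t; rewrite (extension_out Op) inE => /(_
  (subset_closure Ot)).
lra.
Qed.

Lemma extension_ge0 x : 0 <= u0 x.
Proof.
have [/extension_gt0/ltW //|Ox] := pselect (Omega x).
by rewrite extension_out.
Qed.

(** The paraboloid has [- Delta_oo] equal to [8 * eta ^+ 3 * |x - c| ^ 2], which the choice of [eta]
    keeps below [r ^ 2 / (r + 1) ^ 3 < 1], and it vanishes on the sphere; so it cannot exceed [u0]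
    inside. At the centre its gradient is zero and any unit vector serves. *)
Lemma ball_barrier c r : 0 < r -> eball c r `<=` Omega ->
  exists2 eta, 0 < eta &
    forall x, enorm (x - c) <= r -> eta * (r ^+ 2 - enorm (x - c) ^+ 2) <= u0 x.
Proof.
move=> r0 cr.
pose eta := (2 * (r + 1))^-1.
have eta0 : 0 < eta by rewrite invr_gt0; lra.
have etar : 8 * eta ^+ 3 * r ^+ 2 < 1.
  rewrite /eta exprVn mulrAC ltr_pdivrMr ?exprn_gt0 //; last by lra.
  by nra.
exists eta => // x xr.
pose F y := - u0 y + eta * (r ^+ 2 - enorm (y - c) ^+ 2).
have cF : continuous F.
  have cG : continuous (fun y : 'rV[R]_n => eta * (r ^+ 2 - enorm (y - c) ^+ 2)).
    move=> y; apply: (@continuous_comp _ _ _ (fun y : 'rV[R]_n => enorm (y - c))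
      (fun d : R => eta * (r ^+ 2 - d ^+ 2))); first exact: dist_continuous.
    apply: differentiable_continuous; apply/derivable1_diffP.
    set d := enorm _.
    have [] // : is_derive d 1 (fun d : R => eta * (r ^+ 2 - d ^+ 2)) (- (2 * eta * d)).
    by apply: (@is_derive_line _ _ _ _ _ _ (- eta)) => h; rewrite scaler1; ring.
  by move=> y; exact: (continuousD (continuousN (@extension_continuous y)) (cG y)).
have [|||p /set_mem/= pr pmax] := @compact_EVT_max _ R F [set y | enorm (y - c) <= r].
- by exists x.
- exact: compact_eball.
- exact: continuous_subspaceT.
suff : F p <= 0 by have := pmax x (mem_set xr); rewrite /F; lra.
have [prr|prr] := ltP (enorm (p - c)) r; last first.
  have -> : F p = - u0 p by rewrite /F (_ : enorm (p - c) = r) ?subrr ?mulr0 ?addr0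
    //; apply/eqP; rewrite eq_le pr.
  by rewrite oppr_le0 extension_ge0.
exfalso; have Op : Omega p by exact: cr.
have near_p h : enorm h < r - enorm (p - c) ->
    - u0 (p + h) <= - u0 p + eta * (2 * inner (p - c) h + inner h h).
  move=> hr; have := pmax (p + h); rewrite inE /= addrAC => /(_ _).
  have -> : enorm (p - c + h) <= r by apply: le_trans (enormD _ _) _; lra.
  move=> /(_ isT); rewrite /F [p + h - c]addrAC !enorm_sqr (inner_sqrD (p - c) h).
  by lra.
have [pc|pc] := eqVneq p c.
  have [e e1] := unit_exists.
  have : 0 ^+ 2 * (- (2 * eta)) <= (- 1 : R).
    apply: (extension_super Op e1 (K := eta)).
    exists (r - enorm (p - c)); [by lra|move=> h /near_p].
    by rewrite pc subrr inner0l; lra.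
  by rewrite expr2 !mul0r; lra.
have pc0 : p - c != 0 by rewrite subr_eq0.
have e1 := unit_dir pc0; have d0 := enorm_gt0 pc0.
have : (2 * eta * enorm (p - c)) ^+ 2 * (- (2 * eta)) <= - 1.
  apply: (extension_super Op e1 (K := eta)).
  exists (r - enorm (p - c)); [by lra|move=> h /near_p].
  rewrite innerZl; have -> : 2 * eta * enorm (p - c) * ((enorm (p - c))^-1 * inner (p
    - c) h) = 2 * eta * inner (p - c) h.
    by field; rewrite gt_eqF.
  by lra.
have -> : (2 * eta * enorm (p - c)) ^+ 2 * - (2 * eta) = - (8 * eta ^+ 3 * enorm (p -
  c) ^+ 2) by ring.
have : 8 * eta ^+ 3 * enorm (p - c) ^+ 2 <= 8 * eta ^+ 3 * r ^+ 2.
  by rewrite ler_wpM2l ?mulr_ge0 ?exprn_ge0 ?(ltW eta0) // ler_pXn2r // nnegrE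
    ?enorm_ge0 // ltW.
lra.
Qed.

Lemma boundary_eball c r x : boundary (eball c r) x -> enorm (x - c) = r.
Proof.
move=> [cx ix]; apply/eqP; rewrite eq_le; apply/andP; split.
  apply: (closed_eball (y := c) (r := r)); apply: closureS cx => y /=; exact: ltW.
rewrite leNgt; apply/negP => xr; apply: ix; apply/nbhs_enormP.
exists (r - enorm (x - c)); [by lra|move=> h hr].
by rewrite /eball /= addrAC; apply: le_lt_trans (enormD _ _) _; lra.
Qed.

(** On the way from [x] to the centre of the interior ball the barrier is
    [eta * r ^ 2 * (1 - (1 - t) ^ 2)], at least [eta * r ^ 2 * t]. *)
Lemma linear_growth x : interior_sphere_condition Omega -> closure Omega x -> ~ Omega
  x ->
  exists (d : 'rV[R]_n) (a : R), 0 < a /\ forall t, 0 <= t <= 1 ->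
    closure Omega (x + t *: d) /\ a * t <= u0 (x + t *: d).
Proof.
move=> isc cx Ox; have [|c [r [r0 cr /boundary_eball xr]]] := isc x.
  by split=> // /interior_subset.
have [eta eta0 etaP] := ball_barrier r0 cr.
exists (c - x), (eta * r ^+ 2); split; first by rewrite mulr_gt0 ?exprn_gt0.
move=> t /andP[t0 t1].
have E : enorm (x + t *: (c - x) - c) = (1 - t) * r.
  have -> : x + t *: (c - x) - c = (1 - t) *: (x - c) by apply/rowP => i; rewrite
    !mxE; ring.
  by rewrite enormZ xr ger0_norm // subr_ge0.
split.
  have [->|t_neq0] := eqVneq t 0; first by rewrite scale0r addr0.
  apply: subset_closure; apply: cr; rewrite /eball /= E gtr_pMl //.
  by rewrite gtrBl lt_def t_neq0.
have xr' : enorm (x + t *: (c - x) - c) <= r by rewrite E ler_piMl ?(ltW r0) // gerBl.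
have := etaP _ xr'; rewrite E; apply: le_trans.
rewrite -mulrA ler_wpM2l ?(ltW eta0) //.
rewrite exprMn; suff : 0 <= r ^+ 2 * (t * (1 - t)) by lra.
by apply: mulr_ge0; [exact: sqr_ge0|apply: mulr_ge0; lra].
Qed.

End Domain.

(** * The power 3/4 of the solution *)

Section Powers.
Variables (R : realType) (n : nat).
Implicit Types (x y e h p : 'rV[R]_n) (a s t q k : R).

Definition root34 t : R := (Num.max t 0) `^ (3 / 4).

Lemma root34_ge0 t : 0 <= root34 t.
Proof. exact: powR_ge0. Qed.

Lemma root34_0 : root34 0 = 0.
Proof. by rewrite /root34 maxxx powR0 // gt_eqF // divr_gt0. Qed.

Lemma root34_gt0 t : 0 < t -> 0 < root34 t.
Proof. by move=> t0; rewrite powR_gt0 // lt_max t0. Qed.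

Lemma root34_continuous : continuous root34.
Proof. by apply: maxpow_continuous; rewrite divr_gt0. Qed.

Lemma profile_root34 t : 0 <= t -> profile 1 (root34 t) = t.
Proof.
move=> t0; rewrite /profile /root34 (max_l t0) max_l ?powR_ge0 // mul1r -powRrM.
by rewrite (_ : 3 / 4 * (4 / 3) = 1) ?powRr1 //; field.
Qed.

Lemma root34_profile t : 0 <= t -> root34 (profile 1 t) = t.
Proof.
move=> t0; rewrite /profile /root34 mul1r (max_l t0) max_l ?powR_ge0 // -powRrM.
by rewrite (_ : 4 / 3 * (3 / 4) = 1) ?powRr1 //; field.
Qed.

Lemma root34_homo : {homo root34 : s t / s <= t}.
Proof.
move=> s t st; rewrite /root34 ge0_ler_powR ?nnegrE ?le_max ?lexx ?orbT ?divr_ge0 //.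
by have [s0|s0] := ltP 0 s; have [t0|t0] := ltP 0 t => //; lra.
Qed.

(* Along a line with slope [q], [g] solves [g * (- g'') = root_rhs q] iff
   [g ^ (4 / 3)] solves [- u'^2 u'' = 1]. *)
Definition root_rhs q : R := (27 / 64 + q ^+ 4 / 3) / q ^+ 2.

(** By the chain rule [(F1 q)^2 (F1 k - F2 q^2) <= 1] up to [eta], where [F1 ^ 3 = 64 / 27 * g x]
    and [F1 ^ 2 * F2 = 64 / 81]; solving for [g x * k] gives [root_rhs q]. *)
Lemma touched_root Omega (g : 'rV[R]_n -> R) x e q k K :
  subsolution Omega (profile 1 \o g) 1 -> Omega x -> 0 < g x ->
  enorm e = 1 -> 0 < q -> touched g x e q k K -> g x * k <= root_rhs q.
Proof.
move=> gsub Ox g0 e1 q0 touch.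
rewrite /root_rhs ler_pdivlMr ?exprn_gt0 //.
pose F1 := dprofile 1 (g x); pose F2 := ddprofile 1 (g x).
have F10 : 0 < F1 by exact: dprofile_gt0.
have F13 : F1 ^+ 3 = 64 / 27 * g x.
  by rewrite /F1 /dprofile exprMn powR_third ?(ltW g0) //; field.
have F12 : F1 ^+ 2 * F2 = 64 / 81 by rewrite /F1 /F2 profile_ode // expr1n mul1r.
rewrite leNgt; apply/negP => bad.
have gap : 0 < 64 / 27 * (g x * k * q ^+ 2 - (27 / 64 + q ^+ 4 / 3)) by lra.
have [eta eta0 eta_small] := mul_small (sqr_ge0 (F1 * q)) gap.
have tay eps : 0 < eps -> exists2 d, 0 < d & forall t, `|t - g x| < d ->
    profile 1 t <= profile 1 (g x) + F1 * (t - g x) + (F2 + eps) / 2 * (t - g x) ^+ 2.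
  move=> eps0; apply: taylor2_le g0 _ (dprofile_derive 1 g0) eps0.
  by move=> t; rewrite ltr_norml => /andP[? ?]; apply: profile_derive; lra.
have mono : exists2 d, 0 < d & forall h t, enorm h < d -> `|t - g x| < d ->
    g (x + h) <= t -> profile 1 (g (x + h)) <= profile 1 t.
  by exists 1 => // h t _ _; exact: profile_homo.
have := gsub x e _ _ _ Ox e1 (touched_comp e1 (ltW F10) eta0 tay mono touch).
have -> : (F1 * q) ^+ 2 * (F1 * k - F2 * q ^+ 2 - eta)
  = F1 ^+ 3 * q ^+ 2 * k - F1 ^+ 2 * F2 * q ^+ 4 - (F1 * q) ^+ 2 * eta by ring.
rewrite F13 F12; lra.
Qed.

Lemma touched_opp (f : 'rV[R]_n -> R) x e q k K :
  touched f x e q k K -> touched f x (- e) (- q) k K.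
Proof.
by move=> [r r0 rP]; exists r => // h /rP; rewrite innerNl sqrrN mulrNN.
Qed.

Lemma touched_profile (g : 'rV[R]_n -> R) x e s k K :
  (forall y, 0 <= g y) -> 0 < g x ->
  (forall e q k K, enorm e = 1 -> 0 < q -> touched g x e q k K -> g x * k <= root_rhs
    q) ->
  enorm e = 1 -> touched (profile 1 \o g) x e s k K -> s ^+ 2 * k <= 1.
Proof.
move=> g_ge0 g0 gsub.
wlog s0 : e s / 0 < s => [H e1 touch|e1 touch].
  have [s0|s0|->] := ltgtP s 0; last by rewrite expr2 !mul0r.
    rewrite -sqrrN; apply: (H (- e)); rewrite ?oppr_gt0 ?enormN //.
    exact: touched_opp.
  exact: (H e).
(* In terms of this cube root the derivatives of [root34] at [profile 1 (g x) = a ^+ 4] are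
   rational: [3 / (4 a)] and [- 3 / (16 a ^ 5)]. *)
pose a := g x `^ (1 / 3).
have a0 : 0 < a by rewrite powR_gt0.
have ga : g x = a ^+ 3 by rewrite powR_third // ltW.
have Pa : profile 1 (g x) = a ^+ 4.
  by rewrite (profileE 1 (ltW g0)) mul1r -/a ga -exprSr.
have Pa0 : 0 < profile 1 (g x) by rewrite Pa exprn_gt0.
pose D1 t : R := 3 / 4 * t `^ (- (1 / 4)).
have D1E : D1 (profile 1 (g x)) = 3 / 4 / a.
  rewrite /D1 Pa -powR_mulrn ?(ltW a0) // -powRrM (_ : 4%:R * _ = - 1); last by field.
  by rewrite powR_inv1 // ltW.
have dD1 t : 0 < t -> is_derive t 1 root34 (D1 t).
  move=> t0; apply: (@is_derive_near _ _ (fun s => s `^ (3 / 4)) _ t) => //.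
    by move=> w; rewrite ltr_norml => /andP[? ?]; rewrite /root34 max_l //; lra.
  rewrite /D1 (_ : - (1 / 4) = 3 / 4 - 1); last by field.
  exact: is_derive1_powR.
have ddD1 : is_derive (profile 1 (g x)) 1 D1 (- (3 / 16) / a ^+ 5).
  have -> : - (3 / 16) / a ^+ 5 = (3 / 4) *: (- (1 / 4) * profile 1 (g x) `^ (- (1 /
    4) - 1)).
    rewrite Pa -(powR_mulrn 4 (ltW a0)) -powRrM (_ : 4%:R * _ = - 5%:R); last by field.
    by rewrite powR_invn ?(ltW a0) // -[_ *: _]/(_ * _); field; rewrite gt_eqF.
  have ? := is_derive1_powR (- (1 / 4)) Pa0.
  exact: is_deriveZ.
rewrite leNgt; apply/negP => bad.
pose F1 := 4 / 3 * a.
have gap : 0 < s ^+ 2 * k - 1 by lra.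
have F10 : 0 < F1 by rewrite mulr_gt0.
have w0 : 0 <= F1 * s ^+ 2 by rewrite mulr_ge0 ?sqr_ge0 ?ltW.
have [eta eta0 eta_small] := mul_small w0 gap.
have tay eps : 0 < eps -> exists2 d, 0 < d & forall t, `|t - profile 1 (g x)| < d ->
    root34 t <= root34 (profile 1 (g x)) + 3 / 4 / a * (t - profile 1 (g x))
      + (- (3 / 16) / a ^+ 5 + eps) / 2 * (t - profile 1 (g x)) ^+ 2.
  move=> eps0; rewrite -D1E; apply: taylor2_le Pa0 _ ddD1 eps0.
  by move=> t; rewrite ltr_norml => /andP[? ?]; apply: dD1; lra.
have mono : exists2 d, 0 < d & forall h t, enorm h < d -> `|t - profile 1 (g x)| < d ->
    profile 1 (g (x + h)) <= t -> root34 (profile 1 (g (x + h))) <= root34 t.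
  by exists 1 => // h t _ _; exact: root34_homo.
have f10 : 0 <= 3 / 4 / a by rewrite !divr_ge0 // ltW.
have [r r0 rP] := touched_comp (g := profile 1 \o g) e1 f10 eta0 tay mono touch.
have q0 : 0 < 3 / 4 / a * s by rewrite mulr_gt0 // !divr_gt0.
have gs : touched g x e (3 / 4 / a * s)
    (3 / 4 / a * k - - (3 / 16) / a ^+ 5 * s ^+ 2 - eta) (3 / 4 / a * K + eta).
  by exists r => // h /rP; rewrite /= !root34_profile.
have := gsub _ _ _ _ e1 q0 gs.
rewrite /root_rhs ler_pdivlMr ?exprn_gt0 // ga.
have -> : a ^+ 3 * (3 / 4 / a * k - - (3 / 16) / a ^+ 5 * s ^+ 2 - eta) * (3 / 4 / a
  * s) ^+ 2
   = 27 / 64 * (s ^+ 2 * k - F1 * s ^+ 2 * eta) + (3 / 4 / a * s) ^+ 4 / 3.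
  by rewrite /F1; field; rewrite gt_eqF.
lra.
Qed.

End Powers.

Opaque profile dprofile ddprofile.

(** * Concave combinations and touching *)

Section Envelope.
Variables (R : realType) (n : nat) (Omega : set 'rV[R]_n) (z : 'rV[R]_n -> R).
Implicit Types (x y e h p : 'rV[R]_n) (q k w eps : R).
Hypotheses (oO : open Omega) (cz : continuous z).
Hypothesis z_gt0 : forall x, Omega x -> 0 < z x.
Hypothesis zsub : subsolution Omega (profile 1 \o z) 1.

Lemma root_rhs_gt0 q : 0 < q -> 0 < root_rhs q.
Proof.
move=> q0; apply: divr_gt0; last exact: exprn_gt0.
have : 0 < q ^+ 4 by exact: exprn_gt0.
lra.
Qed.

Lemma root_rhs_continuous q : 0 < q -> {for q, continuous (@root_rhs R)}.
Proof.
move=> q0; apply: cvgM; last first.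
  by apply: cvgV; [rewrite gt_eqF ?exprn_gt0|exact: exprn_continuous].
apply: cvgD; first exact: cvg_cst.
by apply: cvgM; [exact: exprn_continuous|exact: cvg_cst].
Qed.

(** The radial parabola of slope [s] and curvature [k] centred at [x - eps *: e] and passing through
    the value [z x] at [x] is too concave to touch [z] from above, since [root_rhs q < z x * k]
    persists for nearby points and slopes. It dominates [z] at its centre by hypothesis, so [z] must
    reach its value at radius [2 * eps] somewhere in the ball. *)
Lemma quad_step x e q k : Omega x -> enorm e = 1 -> 0 < q -> 0 < k ->
  root_rhs q < z x * k ->
  exists sigma r0, [/\ 0 < sigma, 0 < r0 & forall eps s, 0 < eps -> eps < r0 ->
    q <= s -> s <= q + sigma ->
    z (x - eps *: e) + s * eps - k / 2 * eps ^+ 2 <= z x ->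
    exists2 x', enorm (x' - (x - eps *: e)) <= 2 * eps &
      z x + s * eps - 3 / 2 * k * eps ^+ 2 <= z x'].
Proof.
move=> Ox e1 q0 k0 qk.
pose gap := z x * k - root_rhs q.
have gap0 : 0 < gap / 2 by rewrite divr_gt0 // subr_gt0.
have /cvgrPdist_lt/(_ _ gap0)/nbhs_ballP[d /= d0 dP] := root_rhs_continuous q0.
have {}dP t : `|t - q| < d -> root_rhs t < root_rhs q + gap / 2.
  move=> td; have := dP t; rewrite /ball /= /ball_ /= distrC => /(_ td).
  by rewrite ltr_norml => /andP[? ?]; lra.
have /continuous_enormP/(_ (gap / 2 / k))[|r1 r10 r1P] := @cz x.
  by rewrite divr_gt0.
have {}r1P h : enorm h < r1 -> z x * k - gap / 2 < z (x + h) * k.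
  move=> /r1P; rewrite ltr_norml => /andP[+ _].
  by rewrite -(ltr_pM2r k0) mulNr divfK ?gt_eqF //; lra.
have [r2 r20 r2P] := open_enorm oO Ox.
pose sigma := Num.min (d / 2) (q / 2).
pose r0 := Num.min (Num.min (r1 / 3) (r2 / 3)) (Num.min (d / (4 * k)) (q / (8 * k))).
have k4 : 0 < 4 * k by lra.
have k8 : 0 < 8 * k by lra.
exists sigma, r0; split; first by rewrite lt_min !divr_gt0.
  by rewrite !lt_min !divr_gt0.
move=> eps s eps0; rewrite !lt_min => /andP[/andP[er1 er2] /andP[]].
rewrite !ltr_pdivlMr // => ed eq qs ssig base.
have s1 : s <= q + d / 2 by apply: le_trans ssig _; rewrite lerD2l ge_min lexx.
have s2 : s <= q + q / 2 by apply: le_trans ssig _; rewrite lerD2l ge_min lexx orbT.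
set y := x - eps *: e in base *.
have xy : enorm (x - y) = eps.
  by rewrite /y opprB addrC subrK enormZ e1 mulr1 ger0_norm // ltW.
apply: contrapT => nex.
have low x' : enorm (x' - y) <= 2 * eps -> z x' <= z x + s * eps - 3 / 2 * k * eps ^+ 2.
  by move=> x'y; rewrite leNgt; apply/negP => /ltW bad; apply: nex; exists x'.
have inB p : enorm (p - y) <= 2 * eps -> Omega p /\ z x * k - gap / 2 < z p * k.
  move=> py; have px : enorm (p - x) <= 3 * eps.
    by have := enormD (p - y) (y - x); rewrite subrKA (enormB y x) xy; lra.
  have -> : p = x + (p - x) by rewrite addrC subrK.
  by split; [apply: r2P|apply: r1P]; lra.
pose g (r : R) := s * r - k / 2 * r ^+ 2.
have dg (r : R) : is_derive r 1 g (s - k * r).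
  by apply: (@is_derive_line _ _ _ _ _ _ (- k / 2)) => h; rewrite scaler1 /g; field.
have ddg (r : R) : is_derive r 1 (fun r => s - k * r) (- k).
  by apply: (@is_derive_line _ _ _ _ _ _ 0) => h; rewrite scaler1; ring.
have cg : continuous g.
  move=> r; apply: differentiable_continuous; apply/derivable1_diffP.
  by have [] := dg r.
have eps2 : 0 <= 2 * eps by lra.
have [||||||p [p0 p2 near_max]] := @radial_max _ _ z g
    (z x - s * eps + k / 2 * eps ^+ 2) (2 * eps) y x.
- apply: (continuous_attains_max (Omega := Omega) cz eps2 _ cg).
  by move=> p /inB[].
- by rewrite /g; lra.
- by move=> p py; have := low p; rewrite py lexx => /(_ isT); rewrite /g; lra.
- by rewrite xy.
- by rewrite xy; lra.
- by rewrite xy /g; lra.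
have [Op zp] := inB p (ltW p2).
set r := enorm (p - y) in p0 p2 near_max.
have slope0 : 0 < s - k * r.
  have : k * r < k * (2 * eps) by rewrite ltr_pM2l.
  lra.
have slope_d : `|s - k * r - q| < d.
  have : 0 < k * r by rewrite mulr_gt0.
  have : k * r < k * (2 * eps) by rewrite ltr_pM2l.
  by rewrite ltr_norml => ? ?; apply/andP; split; lra.
have rhs := dP _ slope_d.
have gap' : 0 < z p * k - root_rhs (s - k * r) by move: rhs; rewrite /gap in zp *; lra.
have [eta eta0 eta_small] := mul_small (ltW (z_gt0 Op)) gap'.
have gmono a b : `|a - r| < eps -> `|b - r| < eps -> a <= b -> g a <= g b.
  rewrite !ltr_norml => /andP[a1 a2] /andP[b1 b2] ab.
  rewrite -subr_ge0 /g.
  have -> : s * b - k / 2 * b ^+ 2 - (s * a - k / 2 * a ^+ 2)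
    = (b - a) * (s - k * ((a + b) / 2)) by field.
  rewrite mulr_ge0 ?subr_ge0 //.
  have : k * ((a + b) / 2) <= k * (3 * eps) by rewrite ler_pM2l //; lra.
  lra.
have [e' [K [e'1 touch]]] := touched_radial p0 near_max eps0 (fun t _ => dg t)
  (ddg _) (ltW slope0) gmono eta0.
have := touched_root zsub Op (z_gt0 Op) e'1 slope0 touch.
by rewrite opprK; lra.
Qed.

(** The paraboloid is largest at [eps *: e], the extreme point of the ball in direction [e]: with
    [w] the [e]-coordinate from the centre, the transverse term is at most
    [4 * eps * (2 * eps - w) * |K|], which half of the loss [q * (2 * eps - w)] absorbs for small
    [eps]. *)
Lemma quad_ball_bound e q k K : enorm e = 1 -> 0 < q -> 0 < k ->
  exists2 r0, 0 < r0 & forall eps h, 0 < eps -> eps < r0 ->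
    enorm (h + eps *: e) <= 2 * eps ->
    q * inner e h - k / 2 * inner e h ^+ 2 + K * (inner h h - inner e h ^+ 2)
      <= q * eps - k / 2 * eps ^+ 2.
Proof.
move=> e1 q0 k0.
have ee : inner e e = 1 by rewrite -enorm_sqr e1 expr1n.
have K8 : 0 < 8 * (`|K| + 1) by rewrite mulr_gt0 // ltr_wpDl.
have k2 : 0 < 2 * k by lra.
exists (Num.min (q / (8 * (`|K| + 1))) (q / (2 * k))); first by rewrite lt_min
  !divr_gt0.
move=> eps h eps0; rewrite lt_min !ltr_pdivlMr // => /andP[eK ek].
set W := h + eps *: e; pose w := inner e W => hW.
have hl : inner e h = w - eps by rewrite /w /W innerDr innerZr ee; ring.
have WW : inner W W <= (2 * eps) ^+ 2 by rewrite -enorm_le //; lra.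
have w2 : w <= 2 * eps by apply: le_trans (cauchy_schwarz _ _) _; rewrite e1 mul1r.
have hh : inner h h - inner e h ^+ 2 = inner W W - w ^+ 2.
  by rewrite /w /W inner_sqrD !innerE ee (innerC h e); ring.
have N0 : 0 <= inner W W - w ^+ 2 by rewrite subr_ge0; exact: inner_unit_le.
rewrite hh hl.
have N1 : inner W W - w ^+ 2 <= 4 * eps * (2 * eps - w) by nra.
have N2 : K * (inner W W - w ^+ 2) <= q / 2 * (2 * eps - w).
  apply: le_trans (ler_wpM2r N0 (ler_norm K)) _.
  apply: le_trans (ler_wpM2l (normr_ge0 K) N1) _.
  rewrite mulrA ler_wpM2r ?subr_ge0 //.
  by have := normr_ge0 K; lra.
have N3 : 0 <= (2 * eps - w) * (q / 2 - k * w / 2).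
  rewrite mulr_ge0 ?subr_ge0 //.
  have : k * w <= k * (2 * eps) by rewrite ler_pM2l.
  lra.
move: N2 N3; move: (inner W W) => WW'; lra.
Qed.

(** The slope given to [quad_step] is the one that makes its hypothesis at [x - eps *: e] an
    equality, so that no differentiability of [z] is needed. It is at least [q] because [z] lies
    below the paraboloid at [x - eps *: e]; if it exceeded [q + sigma], the step with slope
    [q + sigma] would lead above the paraboloid. *)
Lemma single_step x e q k K w k' : Omega x -> enorm e = 1 -> 0 < q -> 0 < k ->
  0 < w -> 0 < k' -> root_rhs q < z x * k' ->
  (exists2 r, 0 < r & forall h, enorm h < r -> w * (z (x + h) - z x)
     <= q * inner e (w *: h) - k / 2 * inner e (w *: h) ^+ 2
        + K * (inner (w *: h) (w *: h) - inner e (w *: h) ^+ 2)) ->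
  exists2 r0, 0 < r0 & forall eps, 0 < eps -> eps < r0 ->
    exists2 h, enorm (h + eps *: e) <= 2 * eps &
      z x - z (x - eps *: e) - k' * eps ^+ 2 <= z (x + h) - z x.
Proof.
move=> Ox e1 q0 k0 w0 k'0 qk' [r r_gt0 up].
have ee : inner e e = 1 by rewrite -enorm_sqr e1 expr1n.
have [sigma [r1 [sigma0 r10 step]]] := quad_step Ox e1 q0 k'0 qk'.
have [r2 r20 bound] := quad_ball_bound K e1 q0 k0.
have k'2 : 0 < 2 * k' by lra.
exists (Num.min (Num.min r1 (r2 / w)) (Num.min (r / 3) (sigma / (2 * k')))).
  by rewrite !lt_min r10 !divr_gt0.
move=> eps eps0; rewrite !lt_min !ltr_pdivlMr // => /andP[/andP[er1 er2] /andP[er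
  esig]].
set b := z x - z (x - eps *: e).
have eb : q * eps <= b.
  have : enorm (- (eps *: e)) < r by rewrite enormN enormZ e1 mulr1 ger0_norm ?(ltW
    eps0) //; lra.
  move=> /up; rewrite !innerE ee => H.
  have : w * (q * eps) <= w * b.
    have : 0 <= k * (w * eps) ^+ 2 by rewrite mulr_ge0 ?sqr_ge0 // ltW.
    by move: H; rewrite /b; lra.
  by rewrite ler_pM2l.
have hx x' : x + (x' - x) = x' by rewrite addrC subrK.
have hball x' : enorm (x' - (x - eps *: e)) <= 2 * eps ->
    enorm (x' - x + eps *: e) <= 2 * eps by rewrite opprB addrA addrAC.
have E : (b / eps + k' / 2 * eps) * eps = b + k' / 2 * eps ^+ 2 by field; rewrite
  gt_eqF.
have [small|large] := leP (b / eps + k' / 2 * eps) (q + sigma).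
  have qs : q <= b / eps + k' / 2 * eps.
    have : q <= b / eps by rewrite ler_pdivlMr.
    suff : 0 <= k' / 2 * eps by lra.
    by rewrite mulr_ge0 ?divr_ge0 ?ltW.
  have [|x' x'b] := step eps _ eps0 er1 qs small.
    by rewrite E /b; lra.
  rewrite E => zx'; exists (x' - x); first exact: hball.
  by rewrite hx; lra.
exfalso.
have qs : q <= q + sigma by lra.
have bs : (q + sigma) * eps < b + k' / 2 * eps ^+ 2.
  by rewrite -E ltr_pM2r.
have [|x' x'b zx'] := step eps _ eps0 er1 qs (lexx _).
  by move: bs; rewrite /b; lra.
have hb := hball x' x'b.
have hr : enorm (x' - x) < r.
  have := enormD_ge (x' - x) (eps *: e); rewrite enormZ e1 mulr1 ger0_norm ?(ltW
    eps0) //.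
  by lra.
have := up _ hr; rewrite hx.
have we0 : 0 < w * eps by rewrite mulr_gt0.
have := bound (w * eps) (w *: (x' - x)) we0 _ _.
rewrite -scalerA -scalerDr enormZ ger0_norm ?(ltW w0) // mulrCA ler_pM2l // (mulrC w).
move=> /(_ er2 hb) B1 /le_trans/(_ B1).
have : 0 <= k * (eps * w) ^+ 2 by rewrite mulr_ge0 ?sqr_ge0 // ltW.
have : w * (sigma * eps - 3 / 2 * k' * eps ^+ 2) > 0.
  rewrite mulr_gt0 //.
  have : 0 < eps * (sigma - eps * (2 * k')) by rewrite mulr_gt0 // subr_gt0.
  have : 0 < k' * eps ^+ 2 by rewrite mulr_gt0 // exprn_gt0.
  lra.
have : w * (z x + (q + sigma) * eps - 3 / 2 * k' * eps ^+ 2) <= w * z x' by rewrite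
  ler_pM2l.
lra.
Qed.

(* The increments [eps_i = (z x_i / m0) eps] and the second differences
   [k_i = B / z x_i] are those for which [\sum w_i eps_i = eps] and
   [\sum w_i k_i eps_i^2 = (B / m0) eps^2]: the harmonic mean structure of the
   equation of [z]. *)
Lemma joint_touching x1 x2 w1 w2 e q k K : Omega x1 -> Omega x2 ->
  0 < w1 -> 0 < w2 -> enorm e = 1 -> 0 < q ->
  (exists2 r, 0 < r & forall h1 h2, enorm h1 < r -> enorm h2 < r ->
     let h := w1 *: h1 + w2 *: h2 in
     w1 * z (x1 + h1) + w2 * z (x2 + h2) <= w1 * z x1 + w2 * z x2
     + q * inner e h - k / 2 * inner e h ^+ 2 + K * (inner h h - inner e h ^+ 2)) ->
  (w1 * z x1 + w2 * z x2) * k <= root_rhs q.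
Proof.
move=> O1 O2 w10 w20 e1 q0 [r r_gt0 up].
have ee : inner e e = 1 by rewrite -enorm_sqr e1 expr1n.
have z1 := z_gt0 O1; have z2 := z_gt0 O2.
set m0 := w1 * z x1 + w2 * z x2.
have m00 : 0 < m0 by rewrite addr_gt0 // mulr_gt0.
have rhs0 := root_rhs_gt0 q0.
rewrite leNgt; apply/negP => bad.
have k0 : 0 < k by rewrite -(pmulr_rgt0 _ m00); lra.
(* Strictly between [root_rhs q] and [m0 * k]: the first inequality allows [single_step] with
   curvatures [B / z x1] and [B / z x2], the second contradicts the final bound [k <= B / m0]. *)
pose B := (root_rhs q + m0 * k) / 2.
have B1 : root_rhs q < B by rewrite /B; lra.
have B2 : B < m0 * k by rewrite /B; lra.
have B0 : 0 < B by lra.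
have kz x : Omega x -> 0 < B / z x /\ root_rhs q < z x * (B / z x).
  by move=> Ox; have zx := z_gt0 Ox; rewrite [z x * _]mulrC divfK ?gt_eqF // divr_gt0.
have [k10 k1P] := kz x1 O1; have [k20 k2P] := kz x2 O2.
have [|r1 r10 step1] := single_step (K := K) O1 e1 q0 k0 w10 k10 k1P.
  exists r => // h hr; have := up h 0 hr; rewrite enorm0 => /(_ r_gt0).
  by rewrite /= scaler0 !addr0; lra.
have [|r2 r20 step2] := single_step (K := K) O2 e1 q0 k0 w20 k20 k2P.
  exists r => // h hr; have := up 0 h; rewrite enorm0 => /(_ r_gt0 hr).
  by rewrite /= scaler0 add0r !addr0; lra.
have [r3 r30 bound] := quad_ball_bound K e1 q0 k0.
pose t1 := z x1 / m0; pose t2 := z x2 / m0.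
have t10 : 0 < t1 by rewrite divr_gt0.
have t20 : 0 < t2 by rewrite divr_gt0.
have wt : w1 * t1 + w2 * t2 = 1 by rewrite /t1 /t2 /m0; field; rewrite gt_eqF.
have [t1E t2E] : t1 = z x1 / m0 /\ t2 = z x2 / m0 by [].
clearbody t1 t2.
have t31 : 0 < 3 * t1 by rewrite pmulr_rgt0.
have t32 : 0 < 3 * t2 by rewrite pmulr_rgt0.
pose eps := Num.min (Num.min (r1 / t1) (r2 / t2)) (Num.min (Num.min (r / (3 * t1)) (r
  / (3 * t2))) r3) / 2.
have M0 : 0 < Num.min (Num.min (r1 / t1) (r2 / t2)) (Num.min (Num.min (r / (3 * t1))
  (r / (3 * t2))) r3).
  by rewrite !lt_min r30 (divr_gt0 r10 t10) (divr_gt0 r20 t20) (divr_gt0 r_gt0 t31)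
    (divr_gt0 r_gt0 t32).
have eps0 : 0 < eps by rewrite divr_gt0.
have : eps < Num.min (Num.min (r1 / t1) (r2 / t2)) (Num.min (Num.min (r / (3 * t1))
  (r / (3 * t2))) r3).
  by rewrite /eps; lra.
rewrite !lt_min => /andP[/andP[]]; rewrite !ltr_pdivlMr ?t10 ?t20 ?t31 ?t32 // => e_1
  e_2 /andP[/andP[e_3 e_4] e_5].
have a10 : 0 < eps * t1 by rewrite mulr_gt0.
have a20 : 0 < eps * t2 by rewrite mulr_gt0.
have [h1 h1b z1P] := step1 _ a10 e_1.
have [h2 h2b z2P] := step2 _ a20 e_2.
have hsmall h a : 0 < a -> 3 * a < r -> enorm (h + a *: e) <= 2 * a -> enorm h < r.
  move=> a0 ar ha; have := enormD_ge h (a *: e).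
  by rewrite enormZ e1 mulr1 ger0_norm ?(ltW a0) //; lra.
have h1r : enorm h1 < r by apply: hsmall h1b => //; lra.
have h2r : enorm h2 < r by apply: hsmall h2b => //; lra.
have := up h1 h2 h1r h2r; set H := _ + _ => /= upH.
have HB : enorm (H + eps *: e) <= 2 * eps.
  have -> : H + eps *: e = w1 *: (h1 + (eps * t1) *: e) + w2 *: (h2 + (eps * t2) *: e).
    rewrite -[eps]mulr1 -{1}wt; apply/rowP => i; rewrite !mxE; ring.
  apply: le_trans (enormD _ _) _; rewrite !enormZ !ger0_norm ?(ltW w10) ?(ltW w20) //.
  have : w1 * enorm (h1 + (eps * t1) *: e) <= w1 * (2 * (eps * t1)) by rewrite ler_pM2l.
  have : w2 * enorm (h2 + (eps * t2) *: e) <= w2 * (2 * (eps * t2)) by rewrite ler_pM2l.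
  have -> : 2 * eps = 2 * eps * (w1 * t1 + w2 * t2) by rewrite wt mulr1.
  lra.
have := bound _ _ eps0 e_5 HB => boundH.
have dn a : 0 < a -> 3 * a < r -> enorm (- (a *: e)) < r.
  by move=> a0 ar; rewrite enormN enormZ e1 mulr1 ger0_norm ?(ltW a0) //; lra.
have := up (- ((eps * t1) *: e)) (- ((eps * t2) *: e)) (dn _ a10 _) (dn _ a20 _).
have -> : w1 *: - ((eps * t1) *: e) + w2 *: - ((eps * t2) *: e) = - (eps *: e).
  apply/rowP => i; rewrite !mxE.
  have -> : eps * e 0 i = eps * (w1 * t1 + w2 * t2) * e 0 i by rewrite wt mulr1.
  by ring.
rewrite /= !innerE ee => /(_ _ _) upD.
have {}upD := upD ltac:(lra) ltac:(lra).
(* The unknown backward increments of [z] cancel: the weighted steps and the bound at [H] give them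
   an upper bound [q eps - k/2 eps^2 + B/m0 eps^2], and [upD] a lower bound [q eps + k/2 eps^2]. *)
have S1 : w1 * (B / z x1 * (eps * t1) ^+ 2) + w2 * (B / z x2 * (eps * t2) ^+ 2) = B /
  m0 * eps ^+ 2.
  have -> : B / m0 * eps ^+ 2 = B / m0 * eps ^+ 2 * (w1 * t1 + w2 * t2) by rewrite wt
    mulr1.
  by rewrite t1E t2E; field; rewrite !gt_eqF.
have m1 := ler_wpM2l (ltW w10) z1P; have m2 := ler_wpM2l (ltW w20) z2P.
have : k * eps ^+ 2 <= B / m0 * eps ^+ 2 by rewrite -S1; lra.
rewrite ler_pM2r ?exprn_gt0 // ler_pdivlMr // mulrC; lra.
Qed.

End Envelope.

(** * Convex domains *)

Section ConvexDomain.
Variables (R : realType) (n : nat) (Omega : set 'rV[R]_n).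
Implicit Types (x y e h p : 'rV[R]_n) (w : R).
Hypotheses (oO : open Omega)
  (convO : convex_set (Omega : set (convex_lmodType 'rV[R]_n))).

Lemma convex_open x y w1 w2 : Omega x -> Omega y -> 0 < w1 -> 0 < w2 ->
  w1 + w2 = 1 -> Omega (w1 *: x + w2 *: y).
Proof.
move=> Ox Oy w10 w20 w12.
have w1_lt : w1 < 1 by lra.
have := convex_setW Omega; move=> -[H _].
have := H convO x y (mem_set Ox) (mem_set Oy) (Itv01 (ltW w10) (ltW w1_lt)) w10 w1_lt.
rewrite inE /conv /= (_ : unstable.onem w1 = w2) //.
by rewrite /unstable.onem -w12 addrAC subrr add0r.
Qed.

Lemma closure_enorm x : closure Omega x <->
  forall eps : R, 0 < eps -> exists2 h, enorm h < eps & Omega (x + h).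
Proof.
split=> [cx eps eps0|H B /nbhs_enormP[eps eps0 epsB]].
  have [|y [Oy yeps]] := cx [set y | enorm (y - x) < eps].
    by apply/nbhs_enormP; exists eps => // h; rewrite /= addrAC subrr add0r.
  by exists (y - x) => //; rewrite addrC subrK.
by have [h hr Oh] := H eps eps0; exists (x + h); split => //; apply: epsB.
Qed.

Lemma convex_closure x y w1 w2 : closure Omega x -> closure Omega y ->
  0 < w1 -> 0 < w2 -> w1 + w2 = 1 -> closure Omega (w1 *: x + w2 *: y).
Proof.
move=> /closure_enorm cx /closure_enorm cy w10 w20 w12.
apply/closure_enorm => eps eps0.
have [h1 h1e O1] := cx eps eps0; have [h2 h2e O2] := cy eps eps0.
exists (w1 *: h1 + w2 *: h2).
  apply: le_lt_trans (enormD _ _) _; rewrite !enormZ !gtr0_norm //.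
  have : w1 * enorm h1 < w1 * eps by rewrite ltr_pM2l.
  have : w2 * enorm h2 < w2 * eps by rewrite ltr_pM2l.
  have : w1 * eps + w2 * eps = eps by rewrite -mulrDl w12 mul1r.
  lra.
by rewrite addrACA -!scalerDr; apply: convex_open.
Qed.

(** A small shift [h] bringing [y] into [Omega] is compensated by shifting [x] by [- (w2 / w1) *: h]
    within a ball around it. *)
Lemma convex_half_closure x y w1 w2 : Omega x -> closure Omega y ->
  0 < w1 -> 0 < w2 -> w1 + w2 = 1 -> Omega (w1 *: x + w2 *: y).
Proof.
move=> Ox /closure_enorm cy w10 w20 w12.
have [r r0 rP] := open_enorm oO Ox.
have [h hr Oh] := cy (w1 * r / w2) (divr_gt0 (mulr_gt0 w10 r0) w20).
have -> : w1 *: x + w2 *: y = w1 *: (x + (- (w2 / w1)) *: h) + w2 *: (y + h).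
  by apply/rowP => i; rewrite !mxE; field; rewrite gt_eqF.
apply: convex_open => //; apply: rP; rewrite enormZ normrN gtr0_norm ?divr_gt0 //.
by rewrite mulrAC ltr_pdivrMr // mulrC -ltr_pdivlMr // (mulrC r).
Qed.

Lemma compact_margin (X : set 'rV[R]_n) : compact X -> X `<=` Omega ->
  exists2 d : R, 0 < d & forall x h, X x -> enorm h < d -> Omega (x + h).
Proof.
move=> /compact_near_coveringP cX XO.
have := cX R (0 : R)^'+ (fun d x => forall h, enorm h < d -> Omega (x + h)) _ _.
case.
  move=> x Xx; have [r r0 rP] := open_enorm oO (XO x Xx).
  exists ([set x' | enorm (x' - x) < r / 2], [set d | d < r / 2]) => /=.
    split.
      by apply/nbhs_enormP; exists (r / 2); [lra|move=> h; rewrite /= addrAC subrr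
        add0r].
    by apply: nbhs_right_lt; lra.
  move=> [x' d] /= [x'r dr] h hd.
  have -> : x' + h = x + (x' - x + h) by apply/rowP => i; rewrite !mxE; ring.
  by apply: rP; apply: le_lt_trans (enormD _ _) _; lra.
move=> d /= d0 dP; exists (d / 2); first by rewrite divr_gt0.
move=> x h Xx hd; apply: (dP (d / 2)) => //=.
- by rewrite sub0r normrN gtr0_norm ?divr_gt0 //; lra.
- by rewrite divr_gt0.
Qed.

Lemma compact_max (T : topologicalType) (A D : set T) (F : T -> R) : compact A ->
  closed D ->
  (A `&` D) !=set0 -> continuous F ->
  exists2 c, A c /\ D c & forall t, A t -> D t -> F t <= F c.
Proof.
move=> cA cD ne cF.
have [||c /set_mem cAD cP] := @compact_EVT_max _ R F _ ne.
- exact: compact_closedI.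
- exact: continuous_subspaceT.
by exists c => // t At Dt; apply: cP; rewrite inE.
Qed.

End ConvexDomain.

(** * Continuity of linear combinations and distances *)

Section Continuity.
Variables (R : realType) (n : nat) (T : topologicalType).
Implicit Types (f g : T -> 'rV[R]_n) (w : R).

Lemma comb_continuous f g w1 w2 : continuous f -> continuous g ->
  continuous (fun t => w1 *: f t + w2 *: g t).
Proof.
move=> cf cg t A /nbhs_enormP[eps eps0 epsA].
pose d := eps / (`|w1| + `|w2| + 1).
have W0 : 0 < `|w1| + `|w2| + 1 by rewrite ltr_wpDl // addr_ge0.
have d0 : 0 < d by rewrite divr_gt0.
have N (c : 'rV[R]_n) : nbhs c [set y | enorm (y - c) < d].
  by apply/nbhs_enormP; exists d => // h; rewrite /= addrAC subrr add0r.
have nf : nbhs t [set s | enorm (f s - f t) < d] by exact: cf t _ (N (f t)).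
have ng : nbhs t [set s | enorm (g s - g t) < d] by exact: cg t _ (N (g t)).
apply: filterS (filterI nf ng) => s [/= fs gs].
have -> : w1 *: f s + w2 *: g s
  = w1 *: f t + w2 *: g t + (w1 *: (f s - f t) + w2 *: (g s - g t)).
  by apply/rowP => i; rewrite !mxE; ring.
apply: epsA; apply: le_lt_trans (enormD _ _) _; rewrite !enormZ.
have : `|w1| * enorm (f s - f t) <= `|w1| * d by rewrite ler_wpM2l // ltW.
have : `|w2| * enorm (g s - g t) <= `|w2| * d by rewrite ler_wpM2l // ltW.
have : d * (`|w1| + `|w2| + 1) = eps by rewrite /d divfK // gt_eqF.
lra.
Qed.

Lemma enorm_comp_continuous f y : continuous f -> continuous (fun t => enorm (f t - y)).
Proof.
move=> cf t; apply: (@continuous_comp _ _ _ f (fun x => enorm (x - y))); first exact: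
  cf.
exact: dist_continuous.
Qed.

End Continuity.

(** * The concave envelope *)

Section Concavity.
Variables (R : realType) (n : nat) (Omega : set 'rV[R]_n) (u : 'rV[R]_n -> R).
Implicit Types (x y e h p : 'rV[R]_n) (w : R).
Hypotheses (n_gt0 : (0 < n)%N) (oO : open Omega) (bO : bounded_set Omega)
  (convO : convex_set (Omega : set (convex_lmodType 'rV[R]_n)))
  (isc : interior_sphere_condition Omega) (sol : dirichlet_solution Omega u).

Local Notation u0 := (extension Omega u).

Definition uroot x : R := root34 (u0 x).

Let u0_ge0 := extension_ge0 n_gt0 oO bO sol.
Let cu0 := extension_continuous oO sol.

Lemma profile_root x : profile 1 (uroot x) = u0 x.
Proof. exact/profile_root34/u0_ge0. Qed.

Lemma root_ge0 x : 0 <= uroot x. Proof. exact: root34_ge0. Qed.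

Lemma root_out x : ~ Omega x -> uroot x = 0.
Proof. by move=> Ox; rewrite /uroot extension_out // root34_0. Qed.

Lemma root_gt0 x : Omega x -> 0 < uroot x.
Proof. by move=> Ox; apply: root34_gt0; exact: (extension_gt0 n_gt0 oO bO sol). Qed.

Lemma root_continuous : continuous uroot.
Proof.
have -> : uroot = @root34 R \o u0 by [].
move=> x; apply: continuous_comp; first exact: cu0.
exact: root34_continuous.
Qed.

Lemma root_subsolution : subsolution Omega (profile 1 \o uroot) 1.
Proof.
have -> : profile 1 \o uroot = u0 by apply/funext => x; exact: profile_root.
exact: (extension_sub oO sol).
Qed.

(** Integer powers express [uroot >= (a * t) ^ (3 / 4)], whose slope at [t = 0] is infinite. *)
Lemma root_growth x : closure Omega x -> ~ Omega x ->
  exists (d : 'rV[R]_n) (a : R), 0 < a /\ forall t, 0 <= t <= 1 ->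
    closure Omega (x + t *: d) /\ (a * t) ^+ 3 <= uroot (x + t *: d) ^+ 4.
Proof.
move=> cx Ox; have [d [a [a0 H]]] := linear_growth n_gt0 oO bO sol isc cx Ox.
exists d, a; split => // t t01; have [ct ut] := H t t01; split => //.
have -> : uroot (x + t *: d) ^+ 4 = u0 (x + t *: d) ^+ 3.
  rewrite /uroot /root34 max_l // -powR_mulrn ?powR_ge0 // -powRrM.
  by rewrite (_ : 3 / 4 * 4%:R = 3%:R) ?powR_mulrn //; field.
have /andP[t0 _] := t01.
rewrite ler_pXn2r // nnegrE //.
by rewrite mulr_ge0 // ltW.
Qed.

Section Weights.
Variables (w1 w2 : R).
Hypotheses (w10 : 0 < w1) (w20 : 0 < w2) (w12 : w1 + w2 = 1).

Local Notation mix x1 x2 := (w1 *: x1 + w2 *: x2).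
Local Notation mixz x1 x2 := (w1 * uroot x1 + w2 * uroot x2).

Lemma mix_same x : mix x x = x.
Proof. by rewrite -scalerDl w12 scale1r. Qed.

Lemma envelope_exists : exists m : 'rV[R]_n -> R,
  [/\ forall x, 0 <= m x,
      forall x1 x2, closure Omega x1 -> closure Omega x2 -> mixz x1 x2 <= m (mix x1
        x2) &
      forall x, closure Omega x -> exists x1 x2,
        [/\ closure Omega x1, closure Omega x2, mix x1 x2 = x & m x = mixz x1 x2]].
Proof.
have : forall x, exists M : R, [/\ 0 <= M,
    forall x1 x2, closure Omega x1 -> closure Omega x2 -> mix x1 x2 = x -> mixz x1 x2
      <= M &
    closure Omega x -> exists x1 x2,
        [/\ closure Omega x1, closure Omega x2, mix x1 x2 = x & M = mixz x1 x2]].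
  move=> x; have [cx|ncx] := pselect (closure Omega x); last first.
    exists 0; split => // x1 x2 c1 c2 E; exfalso; apply: ncx; rewrite -E.
    exact: convex_closure.
  (* The constraint determines the second point from the first, so the maximum runs over one
     variable in a compact set. *)
  pose other y := w2^-1 *: x + (- (w1 / w2)) *: y.
  have c_other : continuous other.
    by apply: comb_continuous; [exact: cst_continuous|move=> ?; exact: cvg_id].
  have mix_other y : mix y (other y) = x.
    by apply/rowP => i; rewrite !mxE; field; rewrite gt_eqF.
  have [||||y [cy coy] ymax] := @compact_max R _ (closure Omega) (other @^-1` closure
    Omega)
      (fun y => mixz y (other y)).
  - exact: compact_closure.
  - by apply: preimage_closed => [? _|]; [exact: c_other|exact: closed_closure].
  - exists x; split => //=; rewrite (_ : other x = x) //.
    apply/rowP => i; rewrite !mxE.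
    have w1E : w1 = 1 - w2 by rewrite -w12 addrK.
    by rewrite w1E; field; rewrite gt_eqF.
  - move=> y; apply: (@continuousD _ _ _ (fun y => w1 * uroot y) (fun y => w2 * uroot
    (other y))).
      exact: (continuousM (@cst_continuous _ _ w1 y) (@root_continuous y)).
    apply: (continuousM (@cst_continuous _ _ w2 y)).
    by apply: (@continuous_comp _ _ _ other uroot); [exact: c_other|exact:
      root_continuous].
  exists (mixz y (other y)); split.
  - by rewrite addr_ge0 // mulr_ge0 ?root_ge0 // ltW.
  - move=> x1 x2 c1 c2 E.
    have E2 : other x1 = x2.
      rewrite /other -E; apply/rowP => i; rewrite !mxE; field.
      by rewrite gt_eqF.
    by have := ymax x1 c1; rewrite /= E2; apply.
  - by move=> _; exists y, (other y); split.
move=> /choice[m mP]; exists m; split.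
- by move=> x; have [] := mP x.
- by move=> x1 x2 c1 c2; have [_ H _] := mP (mix x1 x2); exact: H.
- by move=> x cx; have [_ _ H] := mP x; exact: H.
Qed.

(* At a boundary point [uroot] has an infinite slope, by the interior sphere
   condition, so it cannot be touched from above by a smooth function there. *)
Lemma contact_interior x w e q k K r : closure Omega x -> 0 < w -> enorm e = 1 -> 0 <
  r ->
  (forall h, enorm h < r -> closure Omega (x + h) ->
     w * (uroot (x + h) - uroot x) <= q * inner e (w *: h) - k / 2 * inner e (w *: h)
       ^+ 2
       + K * (inner (w *: h) (w *: h) - inner e (w *: h) ^+ 2)) -> Omega x.
Proof.
move=> cx w0 e1 r0 touch; apply: contrapT => Ox.
have [d [a [a0 dP]]] := root_growth cx Ox.
pose C := `|q| * (w * enorm d) + (`|k| + `|K|) * (w * enorm d) ^+ 2 + 1.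
have wd : 0 <= w * enorm d by rewrite mulr_ge0 ?enorm_ge0 // ltW.
have C0 : 0 < C by rewrite ltr_wpDl // addr_ge0 // mulr_ge0 // ?sqr_ge0 // addr_ge0.
have d1 : 0 < enorm d + 1 by rewrite ltr_wpDl ?enorm_ge0.
(* Touching yields [w * uroot <= C * t] and the growth [(w * uroot) ^ 4 >= w ^ 4 * (a * t) ^ 3];
   these clash once [t * C ^ 4 < w ^ 4 * a ^ 3]. *)
pose t := Num.min (Num.min 1 (r / (enorm d + 1))) (w ^+ 4 * a ^+ 3 / C ^+ 4) / 2.
have M0 : 0 < Num.min (Num.min 1 (r / (enorm d + 1))) (w ^+ 4 * a ^+ 3 / C ^+ 4).
  by rewrite !lt_min ltr01 !divr_gt0 // ?mulr_gt0 // exprn_gt0.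
have t0 : 0 < t by rewrite divr_gt0.
have : t < Num.min (Num.min 1 (r / (enorm d + 1))) (w ^+ 4 * a ^+ 3 / C ^+ 4) by
  rewrite /t; lra.
rewrite !lt_min !ltr_pdivlMr ?exprn_gt0 // => /andP[/andP[t1 tr] tC]; clearbody t.
have t01 : 0 <= t <= 1 by rewrite !ltW.
have [ct ut] := dP t t01.
have hr : enorm (t *: d) < r by rewrite enormZ gtr0_norm //; lra.
have := touch _ hr ct; rewrite (root_out Ox) subr0 scalerA.
set l := inner e _; set N := inner _ _ => B.
have lN : l ^+ 2 <= N by exact: inner_unit_le.
have NE : N = (t * (w * enorm d)) ^+ 2.
  by rewrite /N !innerE -enorm_sqr; ring.
have lE : `|l| <= t * (w * enorm d).
  apply: le_trans (cauchy_schwarz_norm _ _) _; rewrite e1 mul1r enormZ gtr0_norm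
    ?mulr_gt0 //.
  lra.
have l0 := sqr_ge0 l.
have qB : q * l <= `|q| * (t * (w * enorm d)).
  by apply: le_trans (ler_norm _) _; rewrite normrM ler_wpM2l.
have kB : - (k / 2 * l ^+ 2) <= `|k| * N.
  have : - k <= `|k| by rewrite -normrN ler_norm.
  have := normr_ge0 k; nra.
have KB : K * (N - l ^+ 2) <= `|K| * N.
  have := ler_norm K; have := normr_ge0 K; nra.
have tt : t ^+ 2 <= t by rewrite expr2 ger_pMl //; lra.
have NB : (`|k| + `|K|) * N <= t * ((`|k| + `|K|) * (w * enorm d) ^+ 2).
  rewrite NE exprMn mulrCA ler_wpM2r // mulr_ge0 ?sqr_ge0 // addr_ge0 //.
have wz : w * uroot (x + t *: d) <= C * t by rewrite /C; lra.
have : (w * uroot (x + t *: d)) ^+ 4 <= (C * t) ^+ 4.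
  rewrite ler_pXn2r // nnegrE; last by rewrite mulr_ge0 // ltW.
  by rewrite mulr_ge0 ?root_ge0 // ltW.
rewrite leNgt => /negP; apply.
rewrite !exprMn; apply: lt_le_trans (ler_wpM2l (exprn_ge0 4 (ltW w0)) ut).
have -> : C ^+ 4 * t ^+ 4 = t ^+ 3 * (t * C ^+ 4) by ring.
have -> : w ^+ 4 * (a * t) ^+ 3 = t ^+ 3 * (w ^+ 4 * a ^+ 3) by ring.
by rewrite ltr_pM2l // exprn_gt0.
Qed.

Variable m : 'rV[R]_n -> R.
Hypotheses (m_ge0 : forall x, 0 <= m x)
  (m_ub : forall x1 x2, closure Omega x1 -> closure Omega x2 -> mixz x1 x2 <= m (mix
    x1 x2))
  (m_attained : forall x, closure Omega x -> exists x1 x2,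
        [/\ closure Omega x1, closure Omega x2, mix x1 x2 = x & m x = mixz x1 x2]).

Lemma envelope_ge x : closure Omega x -> uroot x <= m x.
Proof. by move=> cx; have := m_ub cx cx; rewrite mix_same -mulrDl w12 mul1r. Qed.

(** A paraboloid above [m] bounds the joint increments at the optimal [x1] and [x2]. Freezing one of
    the two points shows, by [contact_interior], that the other is in [Omega]; then [joint_touching]
    applies. *)
Lemma envelope_touched x e q k K : Omega x -> enorm e = 1 -> 0 < q ->
  touched m x e q k K -> m x * k <= root_rhs q.
Proof.
move=> Ox e1 q0 [r r0 rP].
have [x1 [x2 [c1 c2 E mE]]] := m_attained (subset_closure Ox).
have up h1 h2 : enorm (mix h1 h2) < r -> closure Omega (x1 + h1) ->
    closure Omega (x2 + h2) -> mixz (x1 + h1) (x2 + h2) <= mixz x1 x2 + (q * inner e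
      (mix h1 h2)
    - k / 2 * inner e (mix h1 h2) ^+ 2
    + K * (inner (mix h1 h2) (mix h1 h2) - inner e (mix h1 h2) ^+ 2)).
  move=> hr C1 C2; have := rP _ hr; rewrite -mE.
  have -> : x + mix h1 h2 = mix (x1 + h1) (x2 + h2).
    by rewrite -E !scalerDr addrACA.
  by have := m_ub C1 C2; lra.
have w1_lt : w1 < 1 by rewrite -w12 ltrDl.
have w2_lt : w2 < 1 by rewrite -w12 ltrDr.
have O1 : Omega x1.
  apply: (@contact_interior x1 w1 e q k K r) => // h hr C1.
  have := up h 0; rewrite scaler0 !addr0 enormZ gtr0_norm // => /(_ _ C1 c2).
  have -> : w1 * enorm h < r by apply: le_lt_trans hr; rewrite ler_piMl ?enorm_ge0 //
    ltW.
  by move=> /(_ isT); lra.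
have O2 : Omega x2.
  apply: (@contact_interior x2 w2 e q k K r) => // h hr C2.
  have := up 0 h; rewrite scaler0 add0r !addr0 enormZ gtr0_norm // => /(_ _ c1 C2).
  have -> : w2 * enorm h < r by apply: le_lt_trans hr; rewrite ler_piMl ?enorm_ge0 //
    ltW.
  by move=> /(_ isT); lra.
rewrite mE.
apply: (joint_touching oO root_continuous root_gt0 root_subsolution (K := K) O1 O2
  w10 w20 e1 q0).
have [r1 r10 r1P] := open_enorm oO O1; have [r2 r20 r2P] := open_enorm oO O2.
exists (Num.min r (Num.min r1 r2)); first by rewrite !lt_min r0 r10.
move=> h1 h2; rewrite !lt_min => /and3P[h1r h11 _] /and3P[h2r _ h22] /=; set h := mix
  h1 h2.
have := up h1 h2; rewrite -/h => /(_ _ (subset_closure (r1P _ h11)) (subset_closure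
  (r2P _ h22))).
have -> : enorm h < r.
  apply: le_lt_trans (enormD _ _) _; rewrite !enormZ !gtr0_norm //.
  have : w1 * enorm h1 < w1 * r by rewrite ltr_pM2l.
  have : w2 * enorm h2 < w2 * r by rewrite ltr_pM2l.
  have : w1 * r + w2 * r = r by rewrite -mulrDl w12 mul1r.
  lra.
by move=> /(_ isT); lra.
Qed.

Lemma envelope_subsolution : subsolution Omega (profile 1 \o m) 1.
Proof.
move=> x e s k K Ox e1; apply: touched_profile => // [|e' q' k' K' e'1 q'0 t'].
  by apply: lt_le_trans (root_gt0 Ox) _; apply: envelope_ge; exact: subset_closure.
exact: envelope_touched t'.
Qed.

Let pairs : set ('rV[R]_n * 'rV[R]_n) := closure Omega `*` closure Omega.

Lemma compact_pairs : compact pairs.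
Proof. by apply: compact_setX; exact: compact_closure. Qed.

Lemma mix_continuous : continuous (fun t : 'rV[R]_n * 'rV[R]_n => mix t.1 t.2).
Proof. by apply: comb_continuous => t; [exact: cvg_fst|exact: cvg_snd]. Qed.

Lemma mixz_continuous :
  continuous (fun t : 'rV[R]_n * 'rV[R]_n => profile 1 (mixz t.1 t.2)).
Proof.
have c1 : continuous (fun t : 'rV[R]_n * 'rV[R]_n => uroot t.1).
  by move=> t; apply: (@continuous_comp _ _ _ fst uroot); [exact: cvg_fst|exact:
    root_continuous].
have c2 : continuous (fun t : 'rV[R]_n * 'rV[R]_n => uroot t.2).
  by move=> t; apply: (@continuous_comp _ _ _ snd uroot); [exact: cvg_snd|exact:
    root_continuous].
move=> t; apply: (@continuous_comp _ _ _ (fun t : 'rV[R]_n * 'rV[R]_n => mixz t.1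
  t.2) (profile 1)).
  apply: (@continuousD _ _ _ (fun t : 'rV[R]_n * 'rV[R]_n => w1 * uroot t.1) (fun t
    => w2 * uroot t.2)).
    exact: (continuousM (@cst_continuous _ _ w1 t) (c1 t)).
  exact: (continuousM (@cst_continuous _ _ w2 t) (c2 t)).
exact: profile_continuous.
Qed.

(** Lifted to pairs [(x1, x2)], the objective is continuous on a compact set. *)
Lemma envelope_attains_max : attains_max Omega (profile 1 \o m).
Proof.
move=> y rho g rho0 inO cg.
have cd : continuous (fun t : 'rV[R]_n * 'rV[R]_n => enorm (mix t.1 t.2 - y)).
  by apply: enorm_comp_continuous; exact: mix_continuous.
have [||||[p1 p2] [[/= cp1 cp2] pr] pmax] := @compact_max R _ pairs [set t | enorm
  (mix t.1 t.2 - y) <= rho]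
    (fun t => profile 1 (mixz t.1 t.2) - g (enorm (mix t.1 t.2 - y))).
- exact: compact_pairs.
- apply: (preimage_closed (f := fun t : 'rV[R]_n * 'rV[R]_n => enorm (mix t.1 t.2 -
  y)) (D := [set s | s <= rho])).
    by move=> t _; exact: cd.
  exact: closed_le.
- have cy : closure Omega y by apply: subset_closure; apply: inO; rewrite subrr enorm0.
  by exists (y, y); split => //=; rewrite mix_same subrr enorm0.
- have cg' : continuous (fun t : 'rV[R]_n * 'rV[R]_n => g (enorm (mix t.1 t.2 - y))).
    by move=> t; apply: (@continuous_comp _ _ _ (fun t : 'rV[R]_n * 'rV[R]_n => enorm
      (mix t.1 t.2 - y)) g); [exact: cd|exact: cg].
  by move=> t; exact: (continuousB (@mixz_continuous t) (cg' t)).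
exists (mix p1 p2) => // x xr.
have [x1 [x2 [c1 c2 E mE]]] := m_attained (subset_closure (inO x xr)).
have := pmax (x1, x2) (conj c1 c2); rewrite /= E mE => /(_ xr)/le_trans; apply.
rewrite lerD2r; apply: profile_homo; first exact: ler01.
exact: m_ub.
Qed.

End Weights.
End Concavity.

(** * Comparison of the envelope with the root *)

Section RootConcave.
Variables (R : realType) (n : nat) (Omega : set 'rV[R]_n) (u : 'rV[R]_n -> R).
Implicit Types (x y e h p : 'rV[R]_n) (w : R).
Hypotheses (n_gt0 : (0 < n)%N) (oO : open Omega) (bO : bounded_set Omega)
  (convO : convex_set (Omega : set (convex_lmodType 'rV[R]_n)))
  (isc : interior_sphere_condition Omega) (sol : dirichlet_solution Omega u).

Local Notation u0 := (extension Omega u).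
Local Notation uroot := (uroot Omega u).

Lemma scaled_supersolution theta : 0 < theta ->
  subsolution Omega (fun x => - (theta * u0 x)) (- theta ^+ 3).
Proof.
move=> t0 x e q k K Ox e1 [r r0 rP].
have t3 : 0 < theta ^+ 3 by rewrite exprn_gt0.
have : (q / theta) ^+ 2 * (k / theta) <= - 1.
  apply: (extension_super oO sol (K := K / theta) Ox e1).
  exists r; [exact: r0|move=> h /rP H].
  rewrite -(ler_pM2l t0).
  rewrite [leRHS](_ : _ = - (theta * u0 x) + q * inner e h - k / 2 * inner e h ^+ 2
           + K * (inner h h - inner e h ^+ 2)); first by lra.
  by field; rewrite gt_eqF.
have -> : (q / theta) ^+ 2 * (k / theta) = q ^+ 2 * k / theta ^+ 3.
  by field; rewrite gt_eqF.
by rewrite ler_pdivrMr // mulN1r.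
Qed.

Lemma root_concave x1 x2 w1 w2 : Omega x1 -> Omega x2 -> 0 < w1 -> 0 < w2 -> w1 + w2
  = 1 ->
  w1 * uroot x1 + w2 * uroot x2 <= uroot (w1 *: x1 + w2 *: x2).
Proof.
move=> O1 O2 w10 w20 w12.
have [m [m_ge0 m_ub m_att]] := envelope_exists oO bO convO sol w10 w20 w12.
have fsub := envelope_subsolution n_gt0 oO bO isc sol w10 w20 w12 m_ge0 m_ub m_att.
have fmax := envelope_attains_max oO bO sol w12 m_ub m_att.
have [e0 e01] := unit_exists R n_gt0.
have u0_ge0 := extension_ge0 n_gt0 oO bO sol.
suff mz x : Omega x -> m x <= uroot x.
  apply: le_trans (mz _ (convex_open convO O1 O2 w10 w20 w12)).
  by apply: m_ub; exact: subset_closure.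
move=> Ox; rewrite leNgt; apply/negP => zm.
have cx : closure Omega x by exact: subset_closure.
pose ut y := profile 1 (m y).
have ux0 : 0 < u0 x := extension_gt0 n_gt0 oO bO sol Ox.
have utu : u0 x < ut x.
  rewrite -(profile_root n_gt0 oO bO sol) /ut; apply: profile_lt => //.
  exact: root_ge0.
(* Puts [theta * u0 x] halfway between [u0 x] and [ut x], so that a positive excess [mu] remains
   after scaling. *)
pose theta := 1 + (ut x - u0 x) / (2 * u0 x).
have theta1 : 1 < theta by rewrite ltrDl divr_gt0 ?mulr_gt0 // subr_gt0.
have theta0 : 0 < theta by lra.
pose mu := (ut x - u0 x) / 2.
have mu0 : 0 < mu by rewrite divr_gt0 // subr_gt0.
have muE : ut x - theta * u0 x = mu by rewrite /theta /mu; field; rewrite gt_eqF.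
pose v y := theta * u0 y.
have cv : continuous v.
  by move=> y; exact: (continuousM (@cst_continuous _ _ theta y)
    (@extension_continuous _ _ _ _ oO sol y)).
pose mixz (t : 'rV[R]_n * 'rV[R]_n) := profile 1 (w1 * uroot t.1 + w2 * uroot t.2).
have cmixz : continuous mixz by exact: mixz_continuous.
pose mix (t : 'rV[R]_n * 'rV[R]_n) := w1 *: t.1 + w2 *: t.2.
have cmix : continuous mix by exact: mix_continuous.
pose pairs := closure Omega `*` closure Omega.
have cpairs : compact pairs by exact: compact_pairs.
(* As [v >= 0], a maximum of at least [mu] forces [mixz] to be at least [mu]. The corresponding
   mixtures form a compact subset of [Omega], since [mixz] vanishes when neither point is in
   [Omega]; this fixes [eps] before the maximum is taken. *)
have cX : compact (mix @` (pairs `&` mixz @^-1` [set s | mu <= s])).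
  apply: continuous_compact; first exact: continuous_subspaceT.
  apply: compact_closedI => //.
  by apply: preimage_closed => [? _|]; [exact: cmixz|exact: closed_ge].
have XO : mix @` (pairs `&` mixz @^-1` [set s | mu <= s]) `<=` Omega.
  move=> _ [[y1 y2] [[/= c1 c2] ge_mu] <-].
  have [Oy1|Oy1] := pselect (Omega y1); first exact: (convex_half_closure oO convO).
  have [Oy2|Oy2] := pselect (Omega y2).
    rewrite /mix /= addrC; apply: (convex_half_closure oO convO) => //.
    by rewrite addrC.
  move: ge_mu; rewrite /= /mixz /= !root_out // !mulr0 addr0 profile0.
  by rewrite leNgt mu0.
have [d d0 dP] := compact_margin oO cX XO.
pose eps := d / 10.
have eps0 : 0 < eps by rewrite divr_gt0.
have cD : continuous (fun t : ('rV[R]_n * 'rV[R]_n) * 'rV[R]_n => enorm (mix t.1 -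
  t.2)).
  have c12 : continuous (fun t : ('rV[R]_n * 'rV[R]_n) * 'rV[R]_n => 1 *: mix t.1 +
    (- 1) *: t.2).
    apply: comb_continuous => t; last exact: cvg_snd.
    by apply: (@continuous_comp _ _ _ fst mix); [exact: cvg_fst|exact: cmix].
  have -> : (fun t : ('rV[R]_n * 'rV[R]_n) * 'rV[R]_n => enorm (mix t.1 - t.2))
     = (fun t => enorm (1 *: mix t.1 + (- 1) *: t.2 - 0)).
    by apply/funext => t; rewrite scale1r scaleN1r subr0.
  exact: enorm_comp_continuous.
(* Doubling of variables over triples [(x1, x2, y)]. *)
have [||||[[x1s x2s] ys] [[[/= c1s c2s] cys] /= dist_s] opt] := @compact_max R _
  (pairs `*` closure Omega)
  [set t | enorm (mix t.1 - t.2) <= 2 * eps] (fun t => mixz t.1 - v t.2).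
- by apply: compact_setX => //; exact: compact_closure.
- apply: (preimage_closed (f := fun t : ('rV[R]_n * 'rV[R]_n) * 'rV[R]_n => enorm
  (mix t.1 - t.2)) (D := [set s | s <= 2 * eps])).
    by move=> t _; exact: cD.
  exact: closed_le.
- exists ((x, x), x); split => //=; rewrite /mix /= (mix_same w12) subrr enorm0.
  by rewrite mulr_ge0 // ltW.
- have ca : continuous (fun t : ('rV[R]_n * 'rV[R]_n) * 'rV[R]_n => mixz t.1).
    by move=> t; apply: (@continuous_comp _ _ _ fst mixz); [exact: cvg_fst|exact:
      cmixz].
  have cb : continuous (fun t : ('rV[R]_n * 'rV[R]_n) * 'rV[R]_n => v t.2).
    by move=> t; apply: (@continuous_comp _ _ _ snd v); [exact: cvg_snd|exact: cv].
  by move=> t; exact: (continuousB (ca t) (cb t)).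
have optm y y' : closure Omega y -> closure Omega y' -> enorm (y - y') <= 2 * eps ->
    ut y - v y' <= mixz (x1s, x2s) - v ys.
  move=> cy cy' yy'; have [y1 [y2 [c1 c2 E mE]]] := m_att y cy.
  have := opt ((y1, y2), y') (conj (conj c1 c2) cy').
  by rewrite /= /mix /= E => /(_ yy'); rewrite /ut mE.
set xs := mix (x1s, x2s) in dist_s.
have mixz_le : mixz (x1s, x2s) <= ut xs.
  by rewrite /mixz /ut; apply: profile_homo => //; exact: m_ub.
have v_ge0 y : 0 <= v y by rewrite mulr_ge0 // ltW.
have big : mu <= mixz (x1s, x2s).
  have := optm x x cx cx; rewrite subrr enorm0 mulr_ge0 ?(ltW eps0) // => /(_ isT).
  by rewrite muE; have := v_ge0 ys; lra.
have Xxs : (mix @` (pairs `&` mixz @^-1` [set s | mu <= s])) xs by exists (x1s, x2s).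
pose x0 := xs + (1 / 2) *: (ys - xs).
have xs0 : enorm (xs - x0) <= eps.
  rewrite /x0 opprD addrA subrr add0r enormN enormZ enormB ger0_norm ?divr_ge0 //.
  by lra.
have ys0 : enorm (ys - x0) <= eps.
  have -> : ys - x0 = (- (1 / 2)) *: (xs - ys).
    by apply/rowP => i; rewrite /x0 !mxE; field.
  by rewrite enormZ normrN ger0_norm ?divr_ge0 //; lra.
have inO y : enorm (y - x0) <= 2 * eps -> Omega y.
  move=> yx; have -> : y = xs + (y - xs) by rewrite addrC subrK.
  apply: dP Xxs _; have := enormD (y - x0) (x0 - xs).
  rewrite subrKA (enormB x0) /eps in yx xs0 eps0 *; lra.
have Ox0 : Omega x0 by apply: inO; rewrite subrr enorm0 mulr_ge0 // ltW.
apply: (comparison_local e01 fmax fsub cv (scaled_supersolution theta0) theta1 eps0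
  inO xs0 ys0).
move=> y yx; have Oy := inO y yx; split.
  by have := optm y x0 (subset_closure Oy) (subset_closure Ox0) yx; move: mixz_le;
    rewrite /ut /=; lra.
rewrite enormB in yx.
by have := optm x0 y (subset_closure Ox0) (subset_closure Oy) yx; move: mixz_le;
  rewrite /ut /=; lra.
Qed.

End RootConcave.

(** * Supergradients *)

Section Supergradient.
Variables (R : realType) (n : nat) (Omega : set 'rV[R]_n) (z : 'rV[R]_n -> R).
Implicit Types (x y e h p q : 'rV[R]_n) (w : R).
Hypotheses (oO : open Omega) (cz : continuous z) (z_ge0 : forall x, 0 <= z x)
  (z_gt0 : forall x, Omega x -> 0 < z x)
  (z_concave : forall x1 x2 w1 w2, Omega x1 -> Omega x2 -> 0 < w1 -> 0 < w2 -> w1 +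
    w2 = 1 ->
     w1 * z x1 + w2 * z x2 <= z (w1 *: x1 + w2 *: x2))
  (zsub : subsolution Omega (profile 1 \o z) 1).

Definition supergradient x p := forall y, Omega y -> z y <= z x + inner p (y - x).

(** Closedness of the graph of the superdifferential, at a cluster point of the bounded sequence
    [p_]. The second conclusion records the clustering, on which the continuity of the supergradient
    relies. *)
Lemma supergradient_limit x (y_ p_ : nat -> 'rV[R]_n) (L : R) :
  (forall i, enorm (y_ i - x) < i.+1%:R^-1) ->
  (forall i, enorm (p_ i) <= L) ->
  (\forall i \near \oo, supergradient (y_ i) (p_ i)) ->
  exists2 p, supergradient x p &
    forall eps N, 0 < eps -> exists2 i, (N <= i)%N & enorm (p_ i - p) < eps.
Proof.
move=> yx pL sup_i.
have [p [_ cl]] : [set p | enorm (p - 0) <= L] `&` cluster (p_ @ \oo) !=set0.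
  apply: compact_eball; exists 0%N => // i _ /=.
  by rewrite subr0.
have cl_i (eps : R) (Q : nat -> Prop) : 0 < eps -> (\forall i \near \oo, Q i) ->
    exists2 i, Q i & enorm (p_ i - p) < eps.
  move=> eps0 QF.
  have nb : nbhs p [set q | enorm (q - p) < eps].
    by apply/nbhs_enormP; exists eps => // h; rewrite /= addrAC subrr add0r.
  have im : (p_ @ \oo) (p_ @` Q).
    by apply: filterS QF => i Qi; exists i.
  by have [q [[i Qi <-] /= iq]] := cl _ _ im nb; exists i.
exists p; last first.
  move=> eps N eps0; have [|i Ni iq] := cl_i eps (fun i => (N <= i)%N) eps0.
    by exists N.
  by exists i.
move=> y Oy; rewrite -lerBlDl; apply/ler_addgt0Pr => eps eps0.
have L0 : 0 <= L by apply: le_trans (pL 0%N); exact: enorm_ge0.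
have d3 : 0 < eps / 3 by rewrite divr_gt0.
have /continuous_enormP/(_ _ d3)[r r0 rP] := @cz x.
pose s := Num.min r (eps / (3 * (L + 1))).
have L1 : 0 < L + 1 by lra.
have s0 : 0 < s by rewrite lt_min r0 divr_gt0 // mulr_gt0.
have E1 : 0 < enorm (y - x) + 1 by rewrite ltr_wpDl ?enorm_ge0.
have e3 : 0 < eps / (3 * (enorm (y - x) + 1)) by rewrite divr_gt0 // mulr_gt0.
have near_s : \forall i \near \oo, i.+1%:R^-1 < s.
  have := @cvg_harmonic R => /cvgrPdist_lt/(_ s s0).
  apply: filterS => i; rewrite sub0r normrN /= ger0_norm ?invr_ge0 //.
have [i [si is_] pi] := cl_i _ _ e3 (filterI sup_i near_s).
have yix : enorm (y_ i - x) < s by apply: lt_trans (yx i) is_.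
have := yix; rewrite lt_min ltr_pdivlMr ?mulr_gt0 // => /andP[yr yL].
have := rP _ yr; rewrite [x + _]addrC subrK ltr_norml => /andP[_ zy].
have := si y Oy.
have -> : y - y_ i = (y - x) + (x - y_ i) by rewrite subrKA.
rewrite innerDr.
have := cauchy_schwarz (p_ i) (x - y_ i); rewrite enormB => B1.
have B2 : enorm (p_ i) * enorm (y_ i - x) <= L * enorm (y_ i - x).
  by rewrite ler_wpM2r ?enorm_ge0.
have -> : inner (p_ i) (y - x) = inner p (y - x) + inner (p_ i - p) (y - x).
  by rewrite -innerDl [p + _]addrC subrK.
have B3 := cauchy_schwarz (p_ i - p) (y - x).
have B4 : enorm (p_ i - p) * enorm (y - x) <= eps / (3 * (enorm (y - x) + 1)) * enorm
  (y - x).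
  by rewrite ler_wpM2r ?enorm_ge0 // ltW.
have B5 : eps / (3 * (enorm (y - x) + 1)) * enorm (y - x) <= eps / 3.
  rewrite invfM mulrA mulrAC -mulrA ler_piMr ?(ltW d3) //.
  by rewrite ler_pdivrMr // mul1r lerDl.
have := enorm_ge0 (y_ i - x).
lra.
Qed.

Lemma supergradient_bound x p r : Omega x -> 0 < r ->
  (forall h, enorm h < r -> Omega (x + h)) -> supergradient x p -> enorm p <= 2 * z x
    / r.
Proof.
move=> Ox r0 rO sp.
have zx := z_ge0 x.
have [->|p0] := eqVneq p 0; first by rewrite enorm0 divr_ge0 ?mulr_ge0 // ltW.
have p1 := enorm_gt0 p0.
pose h := (- (r / 2 / enorm p)) *: p.
have hr : enorm h < r.
  by rewrite /h enormZ normrN gtr0_norm ?divr_gt0 // divfK ?gt_eqF //; lra.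
have := sp _ (rO _ hr); rewrite addrAC subrr add0r /h innerZr -enorm_sqr.
have -> : - (r / 2 / enorm p) * enorm p ^+ 2 = - (r / 2 * enorm p) by field; rewrite
  gt_eqF.
have := z_ge0 (x + (- (r / 2 / enorm p)) *: p).
by rewrite ler_pdivlMr //; lra.
Qed.

(** Concavity makes the local bound global: on the segment towards [y] the quadratic term is of
    order [t ^ 2] and disappears after division by [t]. *)
Lemma supergradient_of_touching x c (C : R) : Omega x ->
  (exists2 r, 0 < r & forall h, enorm h < r -> z (x + h) <= z x + inner c h + C *
    inner h h) ->
  supergradient x c.
Proof.
move=> Ox [r r0 rP] y Oy.
rewrite -lerBlDl; apply/ler_addgt0Pr => eps eps0.
set d := y - x.
have D1 : 0 < enorm d + 1 by rewrite ltr_wpDl ?enorm_ge0.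
have C1 : 0 < `|C| * inner d d + 1 by rewrite ltr_wpDl // mulr_ge0 ?inner_ge0.
pose t := Num.min (1 / 2) (Num.min (r / (enorm d + 1)) (eps / (`|C| * inner d d +
  1))) / 2.
have M0 : 0 < Num.min (1 / 2) (Num.min (r / (enorm d + 1)) (eps / (`|C| * inner d d +
  1))).
  by rewrite !lt_min !divr_gt0.
have t0 : 0 < t by rewrite divr_gt0.
have : t < Num.min (1 / 2) (Num.min (r / (enorm d + 1)) (eps / (`|C| * inner d d +
  1))) by rewrite /t; lra.
rewrite !lt_min !ltr_pdivlMr // => /and3P[t1 tr tC]; clearbody t.
have w0 : 0 < 1 - t by lra.
have := z_concave Ox Oy w0 t0 (subrK t 1).
have -> : (1 - t) *: x + t *: y = x + t *: d by apply/rowP => i; rewrite /d !mxE; ring.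
move=> /le_trans/(_ (rP _ _)) H.
have {}H : (1 - t) * z x + t * z y <= z x + inner c (t *: d) + C * inner (t *: d) (t
  *: d).
  by apply: H; rewrite enormZ gtr0_norm //; lra.
rewrite !innerZr innerZl in H.
have H2 : t * (z y - z x) <= t * (inner c d + t * (C * inner d d)) by lra.
rewrite ler_pM2l // in H2.
have H3 : t * (C * inner d d) <= t * (`|C| * inner d d).
  by rewrite ler_pM2l // ler_wpM2r ?inner_ge0 // ler_norm.
lra.
Qed.

(** [x] lies between [y] and a point [w] at distance [r / 2] beyond [x], where [z] is
    nonnegative. *)
Lemma slope_bound x y r : Omega x -> Omega y -> 0 < r ->
  (forall h, enorm h < r -> Omega (x + h)) ->
  z y - z x <= 2 * z x / r * enorm (y - x).
Proof.
move=> Ox Oy r0 rO.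
have [->|yx] := eqVneq y x; first by rewrite !subrr enorm0 mulr0.
have d0 : 0 < enorm (y - x) by rewrite enorm_gt0 // subr_eq0.
set d := enorm (y - x) in d0 *.
pose s := r / 2.
have s0 : 0 < s by rewrite divr_gt0.
have sd : 0 < s + d by rewrite addr_gt0.
pose w := x + (- (s / d)) *: (y - x).
have Ow : Omega w.
  by apply: rO; rewrite enormZ normrN gtr0_norm ?divr_gt0 // divfK ?gt_eqF // /s; lra.
have W : s / (s + d) + d / (s + d) = 1 by field; rewrite gt_eqF.
have := z_concave Oy Ow (divr_gt0 s0 sd) (divr_gt0 d0 sd) W.
have -> : s / (s + d) *: y + d / (s + d) *: w = x.
  by apply/rowP => i; rewrite /w !mxE; field; rewrite !gt_eqF.
have := z_ge0 w => zw H.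
have : s * z y <= (s + d) * z x.
  have -> : s * z y = (s + d) * (s / (s + d) * z y) by field; rewrite gt_eqF.
  rewrite ler_pM2l //; apply: le_trans H; rewrite lerDl mulr_ge0 // divr_ge0 ?(ltW
    d0) ?(ltW sd) //.
move=> H2; have -> : 2 * z x / r * d = d * z x / s by rewrite /s; field; rewrite gt_eqF.
by rewrite ler_pdivlMr //; lra.
Qed.

(* [z - k |. - x|^2] has a maximum near [x], where [z] has a supergradient; these
   are bounded and accumulate, as [k] grows, at a supergradient at [x]. *)
Lemma supergradient_exists x : Omega x -> exists p, supergradient x p.
Proof.
move=> Ox.
have [r r0 rO] := open_enorm oO Ox.
pose c0 := 2 * z x / r.
have c00 : 0 <= c0 by rewrite divr_ge0 ?mulr_ge0 // ltW.
pose rho := r / 2.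
have rho0 : 0 < rho by rewrite divr_gt0.
have inO y : enorm (y - x) <= rho -> Omega y.
  move=> yx; have -> : y = x + (y - x) by rewrite addrC subrK.
  by apply: rO; rewrite /rho in yx *; lra.
have step (i : nat) : exists yp : 'rV[R]_n * 'rV[R]_n,
   [/\ enorm (yp.1 - x) < i.+1%:R^-1, enorm yp.2 <= 2 * c0 &
     c0 / ((c0 + 1) * i.+1%:R) < rho -> supergradient yp.1 yp.2].
  (* The maximum point is then within [c0 / k < 1 / (i + 1)] of [x], while the supergradient
     [2 k (y - x)] stays bounded by [2 * c0]. That the point is interior to the ball holds only for
     large [i]. *)
  pose k : R := (c0 + 1) * i.+1%:R.
  have k0 : 0 < k by rewrite mulr_gt0 //; lra.
  have cg : continuous (fun s : R => k * s ^+ 2).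
    move=> s; apply: differentiable_continuous; apply/derivable1_diffP.
    have [] // : is_derive s 1 (fun s : R => k * s ^+ 2) (2 * k * s).
    by apply: (@is_derive_line _ _ _ _ _ _ k) => h; rewrite scaler1; ring.
  have [y yr ymax] := continuous_attains_max (Omega := Omega) cz (ltW rho0) inO cg.
  have yx : enorm (y - x) <= c0 / k.
    have := ymax x; rewrite subrr enorm0 expr0n /= mulr0 subr0 => /(_ (ltW rho0)).
    have := slope_bound Ox (inO _ yr) r0 rO; rewrite -/c0 => A1 A2.
    have [->|ne] := eqVneq (enorm (y - x)) 0; first by rewrite divr_ge0 // ltW.
    have d0 : 0 < enorm (y - x) by rewrite lt_def ne enorm_ge0.
    by rewrite ler_pdivlMr // -(ler_pM2r d0); lra.
  exists (y, (2 * k) *: (y - x)); split => /=.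
  - apply: le_lt_trans yx _; rewrite /k invfM mulrA gtr_pMl ?invr_gt0 //.
    by rewrite ltr_pdivrMr ?mul1r; lra.
  - rewrite enormZ gtr0_norm ?mulr_gt0 //; rewrite ler_pdivlMr // in yx; lra.
  - move=> small; have yr' : enorm (y - x) < rho by apply: le_lt_trans yx small.
    apply: (@supergradient_of_touching y _ k); first exact: inO.
    exists (rho - enorm (y - x)); first by rewrite subr_gt0.
    move=> h hr; have := ymax (y + h); rewrite addrAC => /(_ _).
    have -> : enorm (y - x + h) <= rho by apply: le_trans (enormD _ _) _; lra.
    move=> /(_ isT); rewrite !enorm_sqr (inner_sqrD (y - x) h) innerZl; lra.
have [yp ypP] := choice step.
have [||| p sp _] := @supergradient_limit x (fun i => (yp i).1) (fun i => (yp i).2)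
  (2 * c0).
- by move=> i; have [] := ypP i.
- by move=> i; have [] := ypP i.
- have := @cvg_harmonic R => /cvgrPdist_lt/(_ rho rho0).
  apply: filterS => i; rewrite sub0r normrN /= ger0_norm ?invr_ge0 // => iP.
  have [_ _] := ypP i; apply; apply: le_lt_trans iP.
  rewrite invfM mulrA ler_piMl ?invr_ge0 //.
  by rewrite ler_pdivrMr ?mul1r; lra.
by exists p.
Qed.

(* [min (a, b) <= (a + b) / 2 - k (a - b)^2] for [|a - b| <= 1 / (2 k)]: a
   paraboloid with gradient [(p + q) / 2] touches [z] from above and is very
   concave along [p - q], which is not orthogonal to [p + q] if the norms of [p]
   and [q] differ. *)
Lemma supergradient_norm_eq x p q : Omega x -> supergradient x p -> supergradient x q ->
  inner p p = inner q q.
Proof.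
move=> Ox sp sq; apply/eqP; apply: contrapT => /negP pq.
pose m := (1 / 2) *: (p + q); pose d := p - q.
have md : inner m d = (inner p p - inner q q) / 2.
  by rewrite /m /d innerZl !innerE (innerC q p); field.
have md0 : inner m d != 0 by rewrite md mulf_neq0 ?invr_eq0 // subr_eq0.
have m0 : m != 0 by apply: contraNneq md0 => ->; rewrite inner0l.
have m1 := enorm_gt0 m0.
pose e := (enorm m)^-1 *: m.
have e1 : enorm e = 1 by exact: unit_dir.
pose d1 := inner d e.
have d1E : d1 != 0 by rewrite /d1 innerZr innerC mulf_neq0 // invr_neq0 // gt_eqF.
have mE h : enorm m * inner e h = inner m h.
  by rewrite innerZl mulrA divff ?mul1r // gt_eqF.
clearbody e.
have d10 : 0 < d1 ^+ 2 by rewrite lt_def sqr_ge0 sqrf_eq0 d1E.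
have zx := z_gt0 Ox.
have touch k : 0 < k -> touched z x e (enorm m) (k * d1 ^+ 2) (k * inner d d).
  move=> k0; have [r r0 rP] := open_enorm oO Ox.
  have D1 : 0 < 2 * k * (enorm d + 1) by rewrite !mulr_gt0 // ltr_wpDl ?enorm_ge0.
  exists (Num.min r (1 / (2 * k * (enorm d + 1)))); first by rewrite lt_min r0 divr_gt0.
  move=> h; rewrite lt_min ltr_pdivlMr // => /andP[/rP Oh hk].
  have := sp _ Oh; have := sq _ Oh; rewrite addrAC subrr add0r.
  set l := inner e h.
  have ml : enorm m * l = inner m h := mE h.
  have mh : inner m h = (inner p h + inner q h) / 2 by rewrite /m innerZl innerDl;
    field.
  have dh : inner d h = inner p h - inner q h by rewrite /d innerDl innerNl.
  have dk : `|inner d h| * (2 * k) <= 1.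
    have := cauchy_schwarz_norm d h; have := enorm_ge0 h; have := normr_ge0 (inner d
      h) => A1 A2 A3.
    have : `|inner d h| * (2 * k) <= enorm d * enorm h * (2 * k) by rewrite ler_pM2r
      // mulr_gt0.
    have : 0 <= enorm h * k by rewrite mulr_ge0 // ltW.
    lra.
  have quad_min : k * inner d h ^+ 2 <= `|inner d h| / 2.
    have -> : k * inner d h ^+ 2 = `|inner d h| / 2 * (`|inner d h| * (2 * k)).
      by rewrite -(real_normK (num_real (inner d h))); field.
    by rewrite ler_piMr // divr_ge0.
  have ee : inner e e = 1 by rewrite -enorm_sqr e1 expr1n.
  pose g := h - l *: e.
  have gg : inner g g = inner h h - l ^+ 2.
    by rewrite /g !innerE (innerC h e) -/l ee; ring.
  have dg : inner d h = d1 * l + inner d g.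
    by rewrite /g innerDr innerNr innerZr -/d1; ring.
  have dg2 : inner d g ^+ 2 <= inner d d * inner g g.
    rewrite -!enorm_sqr -exprMn -real_normK ?num_real //.
    by rewrite ler_pXn2r ?nnegrE ?mulr_ge0 ?enorm_ge0 // cauchy_schwarz_norm.
  (* Separates the part of [d] along [e], which produces the curvature, from the part orthogonal to
     [e], which goes into the transverse term. *)
  have young : (d1 * l) ^+ 2 / 2 - inner d d * inner g g <= inner d h ^+ 2.
    have : 0 <= (d1 * l + 2 * inner d g) ^+ 2 by exact: sqr_ge0.
    by rewrite dg; lra.
  have := ler_wpM2l (ltW k0) young.
  have [dpos|dneg] := leP 0 (inner d h).
    move: quad_min; rewrite ger0_norm // gg ml mh dh => A1 A2 A3 A4; lra.
  by move: quad_min; rewrite ltr0_norm // gg ml mh dh => A1 A2 A3 A4; lra.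
pose k := (root_rhs (enorm m) + 1) / (z x * d1 ^+ 2).
have rhs0 := root_rhs_gt0 m1.
have k0 : 0 < k by apply: divr_gt0; [lra|exact: mulr_gt0].
have := touched_root zsub Ox zx e1 m1 (touch k k0).
have -> : z x * (k * d1 ^+ 2) = root_rhs (enorm m) + 1.
  by rewrite /k; field; rewrite d1E gt_eqF.
lra.
Qed.

(** The midpoint is a supergradient too, so [p], [q] and [(p + q) / 2] have equal norms; strict
    convexity of the Euclidean norm concludes. *)
Lemma supergradient_unique x p q : Omega x -> supergradient x p -> supergradient x q
  -> p = q.
Proof.
move=> Ox sp sq.
have sm : supergradient x ((1 / 2) *: (p + q)).
  by move=> y Oy; have := sp y Oy; have := sq y Oy; rewrite innerZl innerDl; lra.
have := supergradient_norm_eq Ox sp sq; have := supergradient_norm_eq Ox sp sm.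
rewrite innerZl innerZr inner_sqrD => A1 A2.
apply/eqP; rewrite -subr_eq0; apply/eqP/enorm_eq0/eqP.
rewrite -sqrf_eq0 enorm_sqr inner_sqrD !innerNr innerNl opprK.
by apply/eqP; lra.
Qed.

Lemma supergradient_selection : exists P : 'rV[R]_n -> 'rV[R]_n,
  forall x, Omega x -> supergradient x (P x).
Proof.
have : forall x, exists p, Omega x -> supergradient x p.
  move=> x; have [Ox|Ox] := pselect (Omega x); last by exists 0.
  by have [p sp] := supergradient_exists Ox; exists p.
by move=> /choice[P PP]; exists P.
Qed.

(** Supergradients near [x] are bounded, and any cluster point of them is a supergradient at [x],
    hence [P x]. *)
Lemma supergradient_continuous (P : 'rV[R]_n -> 'rV[R]_n) x :
  (forall x, Omega x -> supergradient x (P x)) -> Omega x ->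
  forall eps, 0 < eps -> exists2 r, 0 < r &
    forall h, enorm h < r -> enorm (P (x + h) - P x) < eps.
Proof.
move=> sP Ox eps eps0; apply: contrapT => nex.
have [r r0 rO] := open_enorm oO Ox.
have /continuous_enormP/(_ _ ltr01)[r1 r10 r1P] := @cz x.
have step (i : nat) : exists h, enorm h < i.+1%:R^-1 /\ enorm h < Num.min (r / 2) r1 /\
    eps <= enorm (P (x + h) - P x).
  apply: contrapT => nh; apply: nex.
  exists (Num.min i.+1%:R^-1 (Num.min (r / 2) r1)).
    by rewrite !lt_min r10 invr_gt0 ltr0n /= divr_gt0.
  move=> h; rewrite lt_min => /andP[h1 h2]; rewrite ltNge; apply/negP => bad.
  by apply: nh; exists h.
have [h_ hP] := choice step.
have hO i : Omega (x + h_ i).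
  by have [_ [+ _]] := hP i; rewrite lt_min => /andP[h1 _]; apply: rO; lra.
have [||| p sp cl] := @supergradient_limit x (fun i => x + h_ i) (fun i => P (x + h_ i))
    (2 * (z x + 1) / (r / 2)).
- by move=> i; rewrite addrAC subrr add0r; have [] := hP i.
- move=> i; have [_ [+ _]] := hP i; rewrite lt_min => /andP[h1 h2].
  have r20 : 0 < r / 2 by rewrite divr_gt0.
  apply: le_trans (supergradient_bound (hO i) r20 _ (sP _ (hO i))) _.
    move=> h hr; rewrite -addrA; apply: rO; apply: le_lt_trans (enormD _ _) _; lra.
  rewrite ler_pM2r ?invr_gt0 // ler_pM2l //.
  by have := r1P _ h2; rewrite ltr_norml => /andP[_ ?]; lra.
- by apply: nearW => i; exact/sP/hO.
have pE := supergradient_unique Ox sp (sP x Ox).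
have [i _] := cl eps 0%N eps0; rewrite pE => H.
by have [_ [_]] := hP i; lra.
Qed.

(** The supergradient inequalities at [x] and at [x + h] enclose [z (x + h) - z x] between
    [inner (P (x + h)) h] and [inner (P x) h]. *)
Lemma supergradient_differential (P : 'rV[R]_n -> 'rV[R]_n) x :
  (forall x, Omega x -> supergradient x (P x)) -> Omega x ->
  forall eps : R, 0 < eps -> exists2 r, 0 < r & forall h, enorm h < r ->
     `|z (x + h) - z x - inner (P x) h| <= eps * enorm h.
Proof.
move=> sP Ox eps eps0.
have [r r0 rO] := open_enorm oO Ox.
have [r1 r10 r1P] := supergradient_continuous sP Ox eps0.
exists (Num.min r r1); first by rewrite lt_min r0.
move=> h; rewrite lt_min => /andP[/rO Oh /r1P Ph].
have := sP x Ox _ Oh; have := sP _ Oh _ Ox.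
have -> : x - (x + h) = - h by rewrite opprD addrA subrr add0r.
rewrite [x + h - x]addrAC subrr add0r innerNr => A1 A2.
have := cauchy_schwarz_norm (P (x + h) - P x) h; rewrite innerDl innerNl ler_norml =>
  /andP[A3 A4].
have : enorm (P (x + h) - P x) * enorm h <= eps * enorm h by rewrite ler_wpM2r
  ?enorm_ge0 // ltW.
have : 0 <= eps * enorm h by rewrite mulr_ge0 ?enorm_ge0 // ltW.
by move=> *; rewrite ler_norml; apply/andP; split; lra.
Qed.

End Supergradient.

Theorem corollary11 (R : realType) (n : nat) (Omega : set 'rV[R]_n)
    (u : 'rV[R]_n -> R) :
  (0 < n)%N ->
  Omega !=set0 ->
  open Omega ->
  bounded_set Omega ->
  convex_set (Omega : set (convex_lmodType 'rV[R]_n)) ->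
  interior_sphere_condition Omega ->
  dirichlet_solution Omega u ->
  C1_on Omega u.
Proof.
move=> n_gt0 _ oO bO convO isc sol.
pose z := uroot Omega u.
have cz : continuous z := root_continuous oO sol.
have z_ge0 x : 0 <= z x by exact: root_ge0.
have z_gt0 x : Omega x -> 0 < z x := @root_gt0 _ _ _ _ n_gt0 oO bO sol x.
have zconc := root_concave n_gt0 oO bO convO isc sol.
have zsub := root_subsolution n_gt0 oO bO sol.
have [P sP] := supergradient_selection oO cz z_ge0 zconc.
have Pcont x (Ox : Omega x) := supergradient_continuous oO cz z_ge0 z_gt0 zsub sP Ox.
have Pdiff x (Ox : Omega x) := supergradient_differential oO cz z_ge0 z_gt0 zsub sP Ox.
have uE x : Omega x -> u x = profile 1 (z x).
  by move=> Ox; rewrite (profile_root n_gt0 oO bO sol) extension_in.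
pose F1 x := dprofile 1 (z x).
(* Chain rule for [u = z ^ (4 / 3)], available because [z > 0] in [Omega]; the identity holds on
   [Omega] only, so [x + h] is kept there. *)
have du x : Omega x -> differentiable u x /\ gradient u x = F1 x *: P x.
  move=> Ox; apply: differentiable_gradient => eps eps0.
  have F10 : 0 < F1 x by apply: dprofile_gt0 => //; exact: z_gt0.
  have P1 : 0 < enorm (P x) + 1 by rewrite ltr_wpDl ?enorm_ge0.
  have e1 : 0 < eps / 2 / (enorm (P x) + 1) by rewrite !divr_gt0.
  have e2 : 0 < Num.min 1 (eps / 2 / F1 x) by rewrite lt_min ltr01 !divr_gt0.
  have /is_derive_epsP/(_ _ e1)[d d0 dP] := profile_derive 1 (z_gt0 x Ox).
  have [r1 r10 r1P] := Pdiff x Ox _ e2.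
  have [r r0 rO] := open_enorm oO Ox.
  exists (Num.min r (Num.min r1 (d / (enorm (P x) + 1)))).
    by rewrite !lt_min r0 r10 divr_gt0.
  move=> h; rewrite !lt_min ltr_pdivlMr // => /and3P[/rO Oh /r1P dz hd].
  set s := z (x + h) - z x in dz *.
  have h0 := enorm_ge0 h.
  have dz1 : `|s - inner (P x) h| <= enorm h.
    by apply: le_trans dz _; rewrite ler_piMl // ge_min lexx.
  have dz2 : `|s - inner (P x) h| <= eps / 2 / F1 x * enorm h.
    by apply: le_trans dz _; rewrite ler_wpM2r // ge_min lexx orbT.
  have sle : `|s| <= (enorm (P x) + 1) * enorm h.
    have -> : s = (s - inner (P x) h) + inner (P x) h by rewrite subrK.
    apply: le_trans (ler_normD _ _) _.
    by have := cauchy_schwarz_norm (P x) h; lra.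
  have dPs : `|profile 1 (z (x + h)) - profile 1 (z x) - s * F1 x|
      <= eps / 2 / (enorm (P x) + 1) * `|s|.
    have := dP s; rewrite scaler1 subrK; apply; lra.
  rewrite !uE // innerZl.
  move: (profile 1 (z (x + h))) (profile 1 (z x)) dPs => a b dPs.
  have -> : a - b - F1 x * inner (P x) h
    = (a - b - s * F1 x) + (s - inner (P x) h) * F1 x by ring.
  apply: le_trans (ler_normD _ _) _; rewrite normrM (gtr0_norm F10).
  have B1 : `|s - inner (P x) h| * F1 x <= eps / 2 * enorm h.
    have -> : eps / 2 * enorm h = eps / 2 / F1 x * enorm h * F1 x by field; rewrite
      gt_eqF.
    by rewrite ler_pM2r.
  have B2 : eps / 2 / (enorm (P x) + 1) * `|s| <= eps / 2 * enorm h.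
    have -> : eps / 2 * enorm h = eps / 2 / (enorm (P x) + 1) * ((enorm (P x) + 1) *
      enorm h).
      by field; rewrite gt_eqF.
    by rewrite ler_pM2l.
  lra.
move=> x Ox; split; first by have [] := du x Ox.
apply: continuous_rV_enormP => eps eps0.
have F10 : 0 < F1 x by apply: dprofile_gt0 => //; exact: z_gt0.
have P1 : 0 < enorm (P x) + 1 by rewrite ltr_wpDl ?enorm_ge0.
have cF : {for x, continuous F1}.
  apply: (@continuous_comp _ _ _ z (dprofile 1)); first exact: cz.
  have [dd _] := dprofile_derive 1 (z_gt0 x Ox).
  exact/differentiable_continuous/derivable1_diffP.
clearbody F1.
have e1 : 0 < Num.min (F1 x) (eps / 2 / (enorm (P x) + 1)) by rewrite lt_min F10
  !divr_gt0.
have /continuous_enormP/(_ _ e1)[r1 r10 r1P] := cF.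
have e2 : 0 < eps / 2 / (2 * F1 x) by rewrite !divr_gt0 // mulr_gt0.
have [r2 r20 r2P] := Pcont x Ox _ e2.
have [r r0 rO] := open_enorm oO Ox.
exists (Num.min r (Num.min r1 r2)); first by rewrite !lt_min r0 r10.
move=> h; rewrite !lt_min => /and3P[/rO Oh /r1P + /r2P dP]; rewrite lt_min =>
  /andP[dF1 dF2].
have [_ ->] := du _ Oh; have [_ ->] := du _ Ox.
have -> : F1 (x + h) *: P (x + h) - F1 x *: P x
  = F1 (x + h) *: (P (x + h) - P x) + (F1 (x + h) - F1 x) *: P x.
  by rewrite scalerBr scalerBl subrKA.
apply: le_lt_trans (enormD _ _) _; rewrite !enormZ.
have F2 : `|F1 (x + h)| <= 2 * F1 x.
  rewrite -(subrK (F1 x) (F1 (x + h))); apply: le_trans (ler_normD _ _) _.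
  by rewrite (gtr0_norm F10); lra.
have B1 : `|F1 (x + h)| * enorm (P (x + h) - P x) < eps / 2.
  apply: le_lt_trans (ler_wpM2r (enorm_ge0 _) F2) _.
  by rewrite mulrC -ltr_pdivlMr // mulr_gt0.
have B2 : `|F1 (x + h) - F1 x| * enorm (P x) <= eps / 2.
  move: dF2; rewrite ltr_pdivlMr // => /ltW; apply: le_trans.
  by rewrite ler_wpM2l // lerDl.
lra.
Qed.
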